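(* Let $d\ge 1$, $\beta>0$, $Q>0$, $F\geq \max\{Q,1\}$, and let $K$ be a kernel of order $\lfloor\beta\rfloor$ with $\|K\|_\infty<\infty$ and support in $[-1,1]$. Then there exist constants $C_1,C_2,C_3$ depending only on $F,K,d,Q,\beta$ such that the following holds. For every $n\geq 3$, every density $f_0\in\mathcal{C}^\beta_d([0,1]^d,Q)$, every function class $\mathcal{F}\subseteq\{f:[0,1]^d\to\mathbb{R}:\|f\|_\infty\le F\}$, every two-stage nonparametric density estimator $\widehat f$ with kernel $K$ (of order $\lfloor\beta\rfloor$) taking values in $\mathcal{F}$, and every $\delta>0$, $$R(\widehat f,f_0)\leq C_1\frac{\log^2(n)\log(n\vee\mathcal{N}_{\mathcal{F}}(\delta))}{n}+C_2\delta+C_3\Big(\frac{\log(n)}{n}\Big)^{\frac{2\beta}{d}}+6\Delta_n(\widehat f,f_0)+7\inf_{f\in\mathcal{F}}\mathbb{E}_{\mathbf X}\big[(f(\mathbf X)-f_0(\mathbf X))^2\big].$$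
   Context: Conventions: $\lfloor x\rfloor$ denotes the largest integer strictly smaller than $x$; $x\vee y=\max(x,y)$; $\|\cdot\|_\infty$ is the supremum norm on the domain; $\log$ is the natural logarithm. Hölder balls. For $\beta>0$ and $\mathcal{D}\subseteq\mathbb{R}^d$, $\mathcal{H}^\beta_d(\mathcal{D},Q)$ is the set of $f:\mathcal{D}\to\mathbb{R}$ with $$\sum_{\gamma:0\le|\gamma|_1<\beta}\|\partial^\gamma f\|_\infty+\sum_{\gamma:|\gamma|_1=\lfloor\beta\rfloor}\ \sup_{x,y\in\mathcal{D},x\ne y}\frac{|\partial^\gamma f(x)-\partial^\gamma f(y)|}{|x-y|_\infty^{\beta-\lfloor\beta\rfloor}}\le Q,$$ with multi-indices $\gamma\in\{0,1,2,\dots\}^d$. (If $\mathcal D$ is not open, it is assumed that $f$ has an extension to an open set containing $\mathcal D$ on which the partial derivatives of order $<\beta$ are defined.) Smooth densities. $\mathcal{C}^\beta_d(Q)$ is the set of $f\in\mathcal{H}^\beta_d(\mathbb{R}^d,Q)$ with $\operatorname{supp} f\subseteq[0,1]^d$, $f\ge0$, $\int_{[0,1]^d}f=1$. $\mathcal{C}^\beta_d([0,1]^d,Q)$ is the set of restrictions to $[0,1]^d$ of functions in $\mathcal{C}^\beta_d(Q)$. Kernels. A function $K:\mathbb{R}\to\mathbb{R}$ is a kernel if $\int K(u)\,du=1$. It is of order $s$ if moreover $\int u^\ell K(u)\,du=0$ for all $\ell=1,\dots,s$ and $\int|u|^{s+1}K(u)\,du<\infty$ (for $s=0$ there is no vanishing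 moment condition). Density estimation model and two-stage estimator. One observes $2n$ i.i.d. random vectors $\mathbf{X}_1,\dots,\mathbf{X}_n,\mathbf{X}_1',\dots,\mathbf{X}_n'$ in $[0,1]^d$ with density $f_0$. Let $h_n$ be a bandwidth with $(\log(n)/n)^{1/d}\le h_n\le 2(\log(n)/n)^{1/d}$ and $h_n^{-1}$ a positive integer. Define $$\widehat f_{\mathrm{KDE}}(\mathbf{x})=\frac{1}{nh_n^d}\sum_{\ell=1}^n\prod_{r=1}^dK\Big(\frac{X'_{\ell,r}-x_r}{h_n}\Big),\qquad Y_i=\widehat f_{\mathrm{KDE}}(\mathbf{X}_i),\quad i=1,\dots,n.$$ A two-stage nonparametric density estimator is any estimator $\widehat f$ computed from the data $(\mathbf{X}_1,Y_1),\dots,(\mathbf{X}_n,Y_n)$. Risk and optimization error. With $\mathbf{X}\sim f_0$ independent of the data, $$R(\widehat f,f_0)=\mathbb{E}_{f_0,\mathbf X}\big[(\widehat f(\mathbf{X})-f_0(\mathbf{X}))^2\big],$$ the expectation being over the data and $\mathbf X$; $\mathbb{E}_{\mathbf X}$ is the expectation over $\mathbf X$ only. For $\widehat f$ taking values in $\mathcal{F}$, $$\Delta_n(\widehat f,f_0)=\mathbb{E}_{f_0}\Big[\frac1n\sum_{i=1}^n(Y_i-\widehat f(\mathbf{X}_i))^2-\inf_{f\in\mathcal{F}}\frac1n\sum_{i=1}^n(Y_i-f(\mathbf{X}_i))^2\Big],$$ the expectation being over the full data set. Covering number. $\mathcal{N}_{\mathcal{F}}(\delta)$ is the smallest number of supremum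 norm balls of radius $\delta$ with centers in $\mathcal{F}$ needed to cover $\mathcal{F}$. Functions in $\mathcal F$ and estimators are tacitly measurable. *)

(* Defs.v *)
From HB Require Import structures.
From mathcomp Require Import all_boot all_order all_algebra.
From mathcomp Require Import all_classical all_reals all_analysis.

Set Implicit Arguments.
Unset Strict Implicit.
Unset Printing Implicit Defensive.
Import Order.TTheory GRing.Theory Num.Theory.
Import numFieldNormedType.Exports.

Local Open Scope classical_set_scope.
Local Open Scope ring_scope.

Section measurable_rV.
Context {disp : measure_display} {T : measurableType disp}.
Variable n : nat.

Let coord (i : 'I_n) (x : 'rV[T]_n) : T := x ord0 i.

Let rV_set0 : g_sigma_preimage coord set0.
Proof. exact: sigma_algebra0. Qed.

Let rV_setC A : g_sigma_preimage coord A -> g_sigma_preimage coord (~` A).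
Proof. exact: sigma_algebraC. Qed.

Let rV_bigcup (F : (set 'rV[T]_n)^nat) :
  (forall i, g_sigma_preimage coord (F i)) ->
  g_sigma_preimage coord (\bigcup_i (F i)).
Proof. exact: sigma_algebra_bigcup. Qed.

(* The sigma-algebra generated by the coordinates; for T = R this is the Borel
   sigma-algebra of R^n. *)
HB.instance Definition _ := @isMeasurable.Build (measure_tuple_display disp)
  'rV[T]_n (g_sigma_preimage coord) rV_set0 rV_setC rV_bigcup.

Lemma measurable_coord (i : 'I_n) :
  measurable_fun [set: 'rV[T]_n] (fun x : 'rV[T]_n => x ord0 i).
Proof.
move=> _ Y mY; rewrite setTI; apply: sub_sigma_algebra => /=.
rewrite -bigcup_seq/=; exists i => /=; first by rewrite mem_index_enum.
by exists Y => //; rewrite setTI.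
Qed.

Lemma measurable_fun_rV (disp' : measure_display) (S : measurableType disp')
    (f : S -> 'rV[T]_n) :
  (forall i, measurable_fun [set: S] (fun s => f s ord0 i)) ->
  measurable_fun [set: S] f.
Proof.
move=> mf; apply: (@measurability _ _ _ _ setT f
  (\big[setU/set0]_(i < n) preimage_set_system setT (coord i) measurable)) => //.
move=> _ [B + <-]; rewrite -bigcup_seq/= => -[i _ [A mA <-]].
by rewrite !setTI; have := mf i measurableT A mA; rewrite setTI.
Qed.

End measurable_rV.

Section lebesgue_rV.
Context {R : realType}.

Definition cons_rV n (p : R * 'rV[R]_n) : 'rV[R]_n.+1 :=
  row_mx (p.1%:M : 'M[R]_1) p.2.

Definition uncons_rV n (x : 'rV[R]_n.+1) : R * 'rV[R]_n :=
  (x ord0 ord0, \row_i x ord0 (lift ord0 i)).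

Lemma cons_rV0 n (p : R * 'rV[R]_n) : cons_rV p ord0 ord0 = p.1.
Proof.
rewrite /cons_rV; have -> : ord0 = lshift n ord0 :> 'I_(1 + n) by exact/val_inj.
by apply: (etrans (row_mxEl _ _ _ _)); rewrite mxE.
Qed.

Lemma cons_rVS n (p : R * 'rV[R]_n) i :
  cons_rV p ord0 (lift ord0 i) = p.2 ord0 i.
Proof.
rewrite /cons_rV.
have -> : lift ord0 i = rshift 1 i :> 'I_(1 + n) by exact/val_inj.
exact: row_mxEr.
Qed.

Lemma uncons_rVK n : cancel (@uncons_rV n) (@cons_rV n).
Proof.
move=> x; apply/rowP => i; case: (unliftP ord0 i) => [j|] ->.
  by rewrite cons_rVS mxE.
by rewrite cons_rV0.
Qed.

Lemma cons_rVK n : cancel (@cons_rV n) (@uncons_rV n).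
Proof.
move=> p; rewrite /uncons_rV cons_rV0 [RHS]surjective_pairing; congr pair.
by apply/rowP => i; rewrite mxE cons_rVS.
Qed.

Lemma measurable_cons_rV n : measurable_fun setT (@cons_rV n).
Proof.
apply: measurable_fun_rV => i; case: (unliftP ord0 i) => [j|] ->.
  under eq_fun do rewrite cons_rVS.
  exact: (measurableT_comp (measurable_coord j) measurable_snd).
by under eq_fun do rewrite cons_rV0; exact: measurable_fst.
Qed.

Lemma measurable_uncons_rV n : measurable_fun setT (@uncons_rV n).
Proof.
apply: measurable_fun_pair; first exact: measurable_coord.
apply: measurable_fun_rV => i; under eq_fun do rewrite mxE.
exact: measurable_coord.
Qed.

Section step.
Variables (n : nat) (mu : {sigma_finite_measure set 'rV[R]_n -> \bar R}).

Definition lebesgue_rV_step : set 'rV[R]_n.+1 -> \bar R :=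
  pushforward (@lebesgue_measure R \x mu)%E (@cons_rV n).

Let step0 : lebesgue_rV_step set0 = 0%E.
Proof. by rewrite /lebesgue_rV_step /pushforward preimage_set0 measure0. Qed.

Let step_ge0 A : (0 <= lebesgue_rV_step A)%E.
Proof. exact: (measure_ge0 (@lebesgue_measure R \x mu)%E). Qed.

Let step_sigma_additive : semi_sigma_additive lebesgue_rV_step.
Proof.
have mpre A : measurable A -> measurable (@cons_rV n @^-1` A).
  by move=> mA; rewrite -[X in measurable X]setTI; exact: measurable_cons_rV.
move=> F mF tF mUF; rewrite /lebesgue_rV_step /pushforward preimage_bigcup.
apply: (@measure_semi_sigma_additive _ _ _ (@lebesgue_measure R \x mu)%E (fun k => @cons_rV n @^-1` F k)).
- by move=> k; exact: mpre.
- apply/trivIsetP => i j _ _ ij; rewrite -preimage_setI.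
  by move/trivIsetP : tF => /(_ _ _ _ _ ij) ->//; rewrite preimage_set0.
- by rewrite -preimage_bigcup; exact: mpre.
Qed.

HB.instance Definition _ := isMeasure.Build _ _ _
  lebesgue_rV_step step0 step_ge0 step_sigma_additive.

Let step_sigma_finite : sigma_finite setT lebesgue_rV_step.
Proof.
have /sigma_finiteP[F [TF ndF Foo]] := sigma_finiteT (@lebesgue_measure R).
have /sigma_finiteP[G [TG ndG Goo]] := sigma_finiteT mu.
exists (fun k => @uncons_rV n @^-1` (F k `*` G k)).
  rewrite -preimage_bigcup; apply/seteqP; split => // x _ /=.
  have : setT (uncons_rV x).1 by [].
  have : setT (uncons_rV x).2 by [].
  rewrite TF TG => -[k _ Gk] [l _ Fl]; exists (maxn k l) => //; split.
    by move: Fl; exact/subsetPset/ndF/leq_maxr.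
  by move: Gk; exact/subsetPset/ndG/leq_maxl.
move=> k; have [mF Fk] := Foo k; have [mG Gk] := Goo k; split.
  rewrite -[X in measurable X]setTI.
  by apply: measurable_uncons_rV => //; exact: measurableX.
rewrite /lebesgue_rV_step /pushforward.
have -> : @cons_rV n @^-1` (@uncons_rV n @^-1` (F k `*` G k)) = F k `*` G k.
  by apply/seteqP; split => p; rewrite /preimage/mkset cons_rVK.
by rewrite product_measure1E// lte_mul_pinfty// ge0_fin_numE.
Qed.

HB.instance Definition _ := Measure_isSigmaFinite.Build _ _ _
  lebesgue_rV_step step_sigma_finite.

End step.

Fixpoint lebesgue_rV (n : nat) : {sigma_finite_measure set 'rV[R]_n -> \bar R} :=
  match n with
  | 0 => @dirac _ 'rV[R]_0 0 R
  | m.+1 => @lebesgue_rV_step m (lebesgue_rV m)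
  end.

Lemma lebesgue_rV_box n (A : 'I_n -> set R) : (forall i, measurable (A i)) ->
  lebesgue_rV n [set x | forall i, A i (x ord0 i)] =
  (\prod_(i < n) lebesgue_measure (A i))%E.
Proof.
elim: n A => [|n IH] A mA.
  rewrite big_ord0 /= diracE mem_set//= => -[].
  by [].
pose B : set 'rV[R]_n := [set x | forall i, A (lift ord0 i) (x ord0 i)].
have mB : measurable B.
  have -> : B = \bigcap_(i in [set: 'I_n])
      [set x : 'rV[R]_n | A (lift ord0 i) (x ord0 i)].
    by apply/seteqP; split => x /= Bx i *; exact: Bx.
  apply: fin_bigcap_measurable => // i _.
  by rewrite -[X in measurable X]setTI; exact: measurable_coord.
rewrite big_ord_recl -IH// -[X in lebesgue_rV n X]/B -product_measure1E//=;
  last exact: mA.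
rewrite /lebesgue_rV_step /pushforward; congr (_ _).
apply/seteqP; split => p /=.
  by move=> Ap; split => [|i]; [have := Ap ord0; rewrite cons_rV0
    |have := Ap (lift ord0 i); rewrite cons_rVS].
move=> [A0 AS] i; case: (unliftP ord0 i) => [j|] ->.
  by rewrite cons_rVS; exact: AS.
by rewrite cons_rV0.
Qed.

End lebesgue_rV.

Definition supnorm (R : realType) (T : Type) (D : set T) (f : T -> R) : \bar R :=
  ereal_sup [set `|f x|%:E | x in D].

Definition fsupport (R : realType) (T : topologicalType) (f : T -> R) : set T :=
  closure [set x | f x != 0].

Definition cube (R : realType) (d : nat) : set 'rV[R]_d :=
  [set x | forall i, 0 <= x ord0 i <= 1].
Arguments cube {R d}.

(* A function [0,1]^d -> R is represented by a function on 'rV[R]_d of which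
   only the values on the cube are ever used. The balls are closed, and the
   covering number is +oo when no finite cover exists. *)
Definition covering_number (R : realType) (d : nat) (FF : set ('rV[R]_d -> R))
    (delta : R) : \bar R :=
  ereal_inf [set m%:R%:E | m in [set m : nat |
    exists2 c : 'I_m -> ('rV[R]_d -> R), (forall j, FF (c j)) &
      forall f, FF f -> exists j,
        (supnorm cube (f \- c j)%R <= delta%:E)%E]].

(* Largest integer strictly smaller than x, for x > 0 (see sfloorP). *)
Definition sfloor (R : realType) (x : R) : nat := `|Num.ceil x - 1|%N.

Lemma sfloorP (R : realType) (x : R) (m : nat) : 0 < x ->
  (m%:R < x) = (m <= sfloor x)%N.
Proof.
move=> x0; rewrite /sfloor.
have c0 : 0 < Num.ceil x by rewrite ceil_gt0.
have c1 : 0 <= Num.ceil x - 1 by rewrite subr_ge0.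
rewrite -lez_nat gez0_abs// lerBrDr -ltzD1 ltrD2r ceil_gt_int.
by rewrite -pmulrn.
Qed.

Section holder.
Context {R : realType} {d : nat}.
Implicit Types (f : 'rV[R]_d -> R).

Definition partial (i : 'I_d) f : 'rV[R]_d -> R :=
  fun x => 'D_(delta_mx ord0 i) f x.

(* All partial derivatives of order < beta, taken in any order, exist. *)
Definition has_partials (beta : R) f : Prop :=
  forall (s : seq 'I_d) (i : 'I_d), (size s).+1%:R < beta ->
    forall x, derivable (foldr partial f s) x (delta_mx ord0 i).

(* The norm of 'rV[R]_d is the maximum norm. *)
Definition holder_seminorm (s : R) f : \bar R :=
  ereal_sup [set (`|f z.1 - f z.2| / `|z.1 - z.2| `^ s)%:E
            | z in [set z : 'rV[R]_d * 'rV[R]_d | z.1 != z.2]].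

(* The bound on the entries of the multi-indices only makes their type finite:
   an entry of a multi-index of order < beta is at most sfloor beta. *)
Definition multi_index (beta : R) := {ffun 'I_d -> 'I_(sfloor beta).+1}.

Definition mi_order (beta : R) (g : multi_index beta) : nat :=
  (\sum_i g i)%N.

Definition mpartial (beta : R) (g : multi_index beta) f : 'rV[R]_d -> R :=
  foldr (fun i => iter (g i) (partial i)) f (enum 'I_d).

Definition holder_norm (beta : R) f : \bar R :=
  (\sum_(g : multi_index beta | ((mi_order g)%:R < beta)%R)
      supnorm setT (mpartial g f) +
   \sum_(g : multi_index beta | mi_order g == sfloor beta)
      holder_seminorm (beta - (sfloor beta)%:R)%R (mpartial g f))%E.

Definition holder_ball (beta Q : R) : set ('rV[R]_d -> R) :=
  [set f | has_partials beta f /\ (holder_norm beta f <= Q%:E)%E].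

Definition smooth_density (beta Q : R) : set ('rV[R]_d -> R) :=
  [set f | [/\ holder_ball beta Q f, fsupport f `<=` cube,
    forall x, 0 <= f x & (\int[lebesgue_rV d]_(x in cube) (f x)%:E = 1)%E]].

Definition smooth_density_cube (beta Q : R) : set ('rV[R]_d -> R) :=
  [set f | exists2 f1, smooth_density beta Q f1 &
    forall x, cube x -> f x = f1 x].

End holder.

Section kernel.
Context {R : realType}.
Local Notation leb := (@lebesgue_measure R).

Definition is_kernel (K : R -> R) : Prop :=
  leb.-integrable setT (EFin \o K) /\ (\int[leb]_u (K u)%:E = 1)%E.

Definition kernel_of_order (s : nat) (K : R -> R) : Prop :=
  [/\ is_kernel K,
    forall l : nat, (1 <= l <= s)%N ->
      leb.-integrable setT (fun u => (u ^+ l * K u)%:E) /\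
      (\int[leb]_u (u ^+ l * K u)%:E = 0)%E &
    leb.-integrable setT (fun u => (`|u| ^+ s.+1 * K u)%:E)].

End kernel.

Section model.
Context {R : realType} {d n : nat}.

Definition bandwidth (h : R) : Prop :=
  [/\ (ln n%:R / n%:R) `^ (d%:R^-1) <= h,
      h <= 2 * (ln n%:R / n%:R) `^ (d%:R^-1) &
      exists2 m : nat, (0 < m)%N & h^-1 = m%:R].

Definition kde (K : R -> R) (h : R) (x' : 'I_n -> 'rV[R]_d) (x : 'rV[R]_d) : R :=
  (n%:R * h ^+ d)^-1 *
  \sum_(l < n) \prod_(r < d) K ((x' l ord0 r - x ord0 r) / h).

Definition two_stage_data (K : R -> R) (h : R) (x x' : 'I_n -> 'rV[R]_d) :
    n.-tuple ('rV[R]_d * R) :=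
  [tuple (x i, kde K h x' (x i)) | i < n].

Definition empirical_risk (s : n.-tuple ('rV[R]_d * R)) (f : 'rV[R]_d -> R) : R :=
  n%:R^-1 * \sum_(i < n) ((tnth s i).2 - f (tnth s i).1) ^+ 2.

Definition is_estimator (FF : set ('rV[R]_d -> R))
    (fhat : n.-tuple ('rV[R]_d * R) -> 'rV[R]_d -> R) : Prop :=
  (forall s, FF (fhat s)) /\
  measurable_fun (setT `*` cube)
    (fun p : n.-tuple ('rV[R]_d * R) * 'rV[R]_d => fhat p.1 p.2).

End model.
Arguments bandwidth {R} d n h.

Section probability_model.
Context {disp : measure_display} {Omega : measurableType disp} {R : realType}.
Variable P : probability Omega R.

(* Taking B i = setT for i outside J gives the product rule over any
   subfamily J. *)
Definition mutually_independent (I : finType) (disp' : measure_display)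
    (T : measurableType disp') (Z : I -> {RV P >-> T}) : Prop :=
  forall B : I -> set T, (forall i, measurable (B i)) ->
    P (\bigcap_i (Z i @^-1` B i)) = (\prod_(i : I) P (Z i @^-1` B i))%E.

Definition has_density d (Z : {RV P >-> 'rV[R]_d}) (f0 : 'rV[R]_d -> R) : Prop :=
  forall A, measurable A ->
    distribution P Z A = (\int[lebesgue_rV d]_(x in A `&` cube) (f0 x)%:E)%E.

Definition all_vectors (n : nat) (T : Type) (X X' : 'I_n -> T) (X0 : T)
    (k : option ('I_n + 'I_n)) : T :=
  match k with
  | Some (inl i) => X i
  | Some (inr i) => X' i
  | None => X0
  end.

(* X and X' are the two halves of the sample; X0 is the additional vector with
   density f0, independent of the data, at which the risk is evaluated. *)
Definition density_model d n (f0 : 'rV[R]_d -> R)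
    (X X' : 'I_n -> {RV P >-> 'rV[R]_d}) (X0 : {RV P >-> 'rV[R]_d}) : Prop :=
  [/\ forall k omega, cube (all_vectors X X' X0 k omega),
      forall k, has_density (all_vectors X X' X0 k) f0 &
      mutually_independent (all_vectors X X' X0)].

Definition observed d n (K : R -> R) (h : R)
    (X X' : 'I_n -> {RV P >-> 'rV[R]_d}) (omega : Omega) :
    n.-tuple ('rV[R]_d * R) :=
  two_stage_data K h (fun i => X i omega) (fun i => X' i omega).

Definition risk d n (K : R -> R) (h : R) (f0 : 'rV[R]_d -> R)
    (X X' : 'I_n -> {RV P >-> 'rV[R]_d}) (X0 : {RV P >-> 'rV[R]_d})
    (fhat : n.-tuple ('rV[R]_d * R) -> 'rV[R]_d -> R) : \bar R :=
  ('E_P[fun omega =>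
    ((fhat (observed K h X X' omega) (X0 omega) - f0 (X0 omega)) ^+ 2)%R])%E.

(* The integrand is nonnegative when fhat takes values in FF; should the
   infimum fail to be measurable, the library integral is the lower integral. *)
Definition optim_error d n (K : R -> R) (h : R)
    (X X' : 'I_n -> {RV P >-> 'rV[R]_d}) (FF : set ('rV[R]_d -> R))
    (fhat : n.-tuple ('rV[R]_d * R) -> 'rV[R]_d -> R) : \bar R :=
  ('E_P[fun omega => let s := observed K h X X' omega in
    (empirical_risk s (fhat s) - inf [set empirical_risk s f | f in FF])%R])%E.

Definition approx_error d (f0 : 'rV[R]_d -> R) (X0 : {RV P >-> 'rV[R]_d})
    (FF : set ('rV[R]_d -> R)) : \bar R :=
  ereal_inf [set ('E_P[fun omega => ((f (X0 omega) - f0 (X0 omega)) ^+ 2)%R])%E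
            | f in FF].

End probability_model.

(* Main.v *)
(* The excess risk is compared with the empirical one through the offset
   variables -4 (c(X_i) - f0(X_i))^2 + 8 e(X_i) (c(X_i) - f*(X_i)), where c runs
   over the centers of a cover of the class, f* is a competitor and
   e = fKDE - f0 is the noise in the responses. The quadratic term absorbs the
   variance, so the exponential moment of order tau n of their centered mean is
   at most 1 for a tau that does not depend on n, and the maximum over the cover
   costs only log N / (tau n).

   Conditionally on the primed sample the noise is a fixed function. It is cut
   off at a constant level; since n h^d >= log n, Chernoff's bound at each point
   makes the expected excess at most 1/n, and no uniform control of the kernel
   density estimator is needed. What remains of the noise is linear in the
   primed sample; its exponential moment factorizes, and its mean is the bias of
   the kernel estimator, which is O(h^beta) by a Taylor expansion in one
   coordinate at a time. *)
From HB Require Import structures.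
Require Import Defs.
From mathcomp Require Import all_boot all_order all_algebra.
From mathcomp Require Import all_classical all_reals all_analysis.
From mathcomp Require Import measurable_realfun charge ring lra.
Import Order.TTheory GRing.Theory Num.Theory.
Import numFieldNormedType.Exports.
Local Open Scope classical_set_scope.
Local Open Scope ring_scope.

Set Implicit Arguments.
Unset Strict Implicit.
Unset Printing Implicit Defensive.

(** * Expectations of bounded functions *)

(** All responses are built from the same primed sample, so the pairs (X_i, Y_i) are dependent and,
    because of the bias, the noise is not centered given X_i. Two successive integrations answer
    this: over the X_i with the primed sample held fixed, then over the primed sample. The first
    asks for a bounded noise, the second for a linear one, and truncation destroys linearity. Hence
    the mean of the truncated noise over a fresh point is exchanged for the mean of the full noise,
    and the deviation carries the mean excess that pays for it. Constants: let a and b be the mean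
    squared distances of c and of the competitor from f0. The deviation adds a - 3 b to offsets
    whose quadratic part has mean - 4 a, which leaves - 3 (a + b). The bias takes a + b of this; the
    remaining 2 (a + b) covers the second-order terms of both exponential moments, which fixes tau.
    The 3 b return in the risk bound, next to 4 b from the empirical error of the competitor:
    together the factor 7. All integrands are bounded, so conditional expectations become iterated
    integrals to which Fubini applies. *)

Definition bounded_mfun d (T : measurableType d) (R : realType) (f : T -> R) : Prop :=
  measurable_fun setT f /\ exists M, forall x, `|f x| <= M.

Section bounded_mfun_closure.
Context d (T : measurableType d) (R : realType).
Implicit Types f g : T -> R.

Lemma bounded_mfun_cst c : bounded_mfun (fun _ : T => c : R).
Proof. by split; [exact: measurable_cst|exists `|c|]. Qed.

Lemma bounded_mfunD f g :
  bounded_mfun f -> bounded_mfun g -> bounded_mfun (fun x => f x + g x).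
Proof.
move=> [mf [M fM]] [mg [N gN]]; split; first exact: measurable_funD.
by exists (M + N) => x; rewrite (le_trans (ler_normD _ _))// lerD.
Qed.

Lemma bounded_mfunM f g :
  bounded_mfun f -> bounded_mfun g -> bounded_mfun (fun x => f x * g x).
Proof.
move=> [mf [M fM]] [mg [N gN]]; split; first exact: measurable_funM.
by exists (M * N) => x; rewrite normrM ler_pM.
Qed.

Lemma bounded_mfunZ c f : bounded_mfun f -> bounded_mfun (fun x => c * f x).
Proof. exact/bounded_mfunM/bounded_mfun_cst. Qed.

Lemma bounded_mfunN f : bounded_mfun f -> bounded_mfun (fun x => - f x).
Proof.
move=> [mf [M fM]]; split; first exact: measurable_funN.
by exists M => x; rewrite normrN.
Qed.

Lemma bounded_mfunB f g :
  bounded_mfun f -> bounded_mfun g -> bounded_mfun (fun x => f x - g x).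
Proof. by move=> bf bg; apply: bounded_mfunD => //; exact: bounded_mfunN. Qed.

Lemma bounded_mfunX f n : bounded_mfun f -> bounded_mfun (fun x => f x ^+ n).
Proof.
move=> [mf [M fM]]; split; first exact: measurable_funX.
by exists (M ^+ n) => x; rewrite normrX lerXn2r// nnegrE (le_trans _ (fM x)).
Qed.

Lemma bounded_mfun_norm f : bounded_mfun f -> bounded_mfun (fun x => `|f x|).
Proof.
move=> [mf [M fM]]; split; first exact: measurableT_comp.
by exists M => x; rewrite normr_id.
Qed.

Lemma bounded_mfun_expR f : bounded_mfun f -> bounded_mfun (fun x => expR (f x)).
Proof.
move=> [mf [M fM]]; split; first exact: measurableT_comp.
exists (expR M) => x; rewrite ger0_norm ?expR_ge0// ler_expR.
by rewrite (le_trans (ler_norm _)).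
Qed.

Lemma bounded_mfun_sum (I : eqType) (s : seq I) (h : I -> T -> R) :
  (forall i, bounded_mfun (h i)) -> bounded_mfun (fun x => \sum_(i <- s) h i x).
Proof.
move=> bh; elim: s => [|i s IH].
  by under eq_fun do rewrite big_nil; exact: bounded_mfun_cst.
by under eq_fun do rewrite big_cons; exact: bounded_mfunD.
Qed.

Lemma bounded_mfun_prod (I : eqType) (s : seq I) (h : I -> T -> R) :
  (forall i, bounded_mfun (h i)) -> bounded_mfun (fun x => \prod_(i <- s) h i x).
Proof.
move=> bh; elim: s => [|i s IH].
  by under eq_fun do rewrite big_nil; exact: bounded_mfun_cst.
by under eq_fun do rewrite big_cons; exact: bounded_mfunM.
Qed.

Lemma bounded_mfun_le f g : measurable_fun setT f -> bounded_mfun g ->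
  (forall x, `|f x| <= `|g x|) -> bounded_mfun f.
Proof.
by move=> mf [_ [M gM]] fg; split => //; exists M => x; rewrite (le_trans (fg x)).
Qed.

End bounded_mfun_closure.

Lemma bounded_mfun_comp d d' (T : measurableType d) (T' : measurableType d')
    (R : realType) (f : T' -> R) (u : T -> T') :
  bounded_mfun f -> measurable_fun setT u -> bounded_mfun (fun x => f (u x)).
Proof.
by move=> [mf [M fM]] mu; split; [exact: measurableT_comp|exists M].
Qed.

Lemma bounded_mfun_pair1 d d' (T : measurableType d) (T' : measurableType d')
    (R : realType) (f : T * T' -> R) (y : T') :
  bounded_mfun f -> bounded_mfun (fun x => f (x, y)).
Proof. by move=> bf; exact: bounded_mfun_comp. Qed.

Lemma bounded_mfun_pair2 d d' (T : measurableType d) (T' : measurableType d')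
    (R : realType) (f : T * T' -> R) (x : T) :
  bounded_mfun f -> bounded_mfun (fun y => f (x, y)).
Proof. by move=> bf; exact: bounded_mfun_comp. Qed.

Lemma bounded_mfun_emeasurable d (T : measurableType d) (R : realType) (f : T -> R) :
  bounded_mfun f -> measurable_fun setT (fun x => (f x)%:E).
Proof. by move=> [mf _]; exact/measurable_EFinP. Qed.

Section bounded_expectation.
Context d (T : measurableType d) (R : realType) (mu : probability T R).
Implicit Types f g : T -> R.

Lemma bounded_mfun_integrable f :
  bounded_mfun f -> mu.-integrable setT (EFin \o f).
Proof.
move=> [mf [M fM]]; apply: measurable_bounded_integrable => //.
  by rewrite (le_lt_trans (probability_le1 _ _)) ?ltry.
exists M; split; first exact: num_real.
by move=> y My x _ /=; rewrite (le_trans (fM x))// ltW.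
Qed.

Lemma fin_Rintegral f : bounded_mfun f ->
  (\int[mu]_x (f x)%:E)%E = (\int[mu]_x f x)%:E.
Proof.
by move=> bf; rewrite fineK//; apply: integrable_fin_num => //; exact: bounded_mfun_integrable.
Qed.

Lemma expectD f g : bounded_mfun f -> bounded_mfun g ->
  \int[mu]_x (f x + g x) = \int[mu]_x f x + \int[mu]_x g x.
Proof. by move=> bf bg; rewrite RintegralD//; exact: bounded_mfun_integrable. Qed.

Lemma expectB f g : bounded_mfun f -> bounded_mfun g ->
  \int[mu]_x (f x - g x) = \int[mu]_x f x - \int[mu]_x g x.
Proof. by move=> bf bg; rewrite RintegralB//; exact: bounded_mfun_integrable. Qed.

Lemma expectZ c f : bounded_mfun f ->
  \int[mu]_x (c * f x) = c * \int[mu]_x f x.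
Proof. by move=> bf; rewrite RintegralZl//; exact: bounded_mfun_integrable. Qed.

Lemma expect_cst (c : R) : \int[mu]_x c = c.
Proof.
have mu1 : fine (mu setT) = 1 by rewrite probability_setT.
by rewrite Rintegral_cst// mu1 mulr1.
Qed.

Lemma expect_le f g : bounded_mfun f -> bounded_mfun g ->
  (forall x, f x <= g x) -> \int[mu]_x f x <= \int[mu]_x g x.
Proof.
by move=> bf bg fg; apply: le_Rintegral => //; exact: bounded_mfun_integrable.
Qed.

Lemma expect_ge0 f : (forall x, 0 <= f x) -> 0 <= \int[mu]_x f x.
Proof. by move=> f0; exact: Rintegral_ge0. Qed.

Lemma expect_norm f : bounded_mfun f ->
  `|\int[mu]_x f x| <= \int[mu]_x `|f x|.
Proof. by move=> bf; apply: le_normr_Rintegral => //; exact: bounded_mfun_integrable. Qed.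

Lemma expect_sum (I : eqType) (s : seq I) (h : I -> T -> R) :
  (forall i, bounded_mfun (h i)) ->
  \int[mu]_x (\sum_(i <- s) h i x) = \sum_(i <- s) \int[mu]_x h i x.
Proof.
move=> bh; elim: s => [|i s IH].
  by under eq_Rintegral do rewrite big_nil; rewrite expect_cst big_nil.
under eq_Rintegral do rewrite big_cons.
by rewrite expectD ?IH ?big_cons//; exact: bounded_mfun_sum.
Qed.

End bounded_expectation.

Section bounded_fubini.
Context d1 d2 (T1 : measurableType d1) (T2 : measurableType d2) (R : realType).
Variables (m1 : probability T1 R) (m2 : probability T2 R).
Variable f : T1 * T2 -> R.
Hypothesis bf : bounded_mfun f.

Lemma bounded_mfun_integrable_prod : (m1 \x m2)%E.-integrable setT (EFin \o f).
Proof.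
case: bf => mf [M fM]; apply: measurable_bounded_integrable => //.
  have m1m2 : (m1 \x m2)%E setT = 1%E.
    rewrite -setXTT product_measure1E//.
    rewrite [X in (X * _)%E](@probability_setT _ _ _ m1).
    by rewrite [X in (_ * X)%E](@probability_setT _ _ _ m2) mule1.
  by rewrite [X in (X < _)%E]m1m2 ltry.
exists M; split; first exact: num_real.
by move=> y My x _ /=; rewrite (le_trans (fM x))// ltW.
Qed.

Lemma bounded_mfun_expect1 : bounded_mfun (fun x => \int[m2]_y f (x, y)).
Proof.
split.
  apply/measurable_EFinP.
  rewrite [X in measurable_fun _ X](_ : _ = fun x => (\int[m2]_y (f (x, y))%:E)%E).
    exact: measurable_fubini_F bounded_mfun_integrable_prod.
  apply/funext => x /=; rewrite fin_Rintegral//; exact: bounded_mfun_pair2.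
case: (bf) => _ [M fM]; exists M => x; rewrite -[M](expect_cst m2).
rewrite (le_trans (expect_norm _ _))//; first exact: bounded_mfun_pair2.
apply: expect_le => //; last exact: bounded_mfun_cst.
exact/bounded_mfun_norm/bounded_mfun_pair2.
Qed.

Lemma bounded_mfun_expect2 : bounded_mfun (fun y => \int[m1]_x f (x, y)).
Proof.
split.
  apply/measurable_EFinP.
  rewrite [X in measurable_fun _ X](_ : _ = fun y => (\int[m1]_x (f (x, y))%:E)%E).
    exact: measurable_fubini_G bounded_mfun_integrable_prod.
  apply/funext => x /=; rewrite fin_Rintegral//; exact: bounded_mfun_pair1.
case: (bf) => _ [M fM]; exists M => x; rewrite -[M](expect_cst m1).
rewrite (le_trans (expect_norm _ _))//; first exact: bounded_mfun_pair1.
apply: expect_le => //; last exact: bounded_mfun_cst.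
exact/bounded_mfun_norm/bounded_mfun_pair1.
Qed.

Lemma expect_swap :
  \int[m1]_x \int[m2]_y f (x, y) = \int[m2]_y \int[m1]_x f (x, y).
Proof.
apply: EFin_inj; rewrite -!fin_Rintegral; last 2 first.
  exact: bounded_mfun_expect2.
  exact: bounded_mfun_expect1.
have E1 x : (\int[m2]_y f (x, y))%:E = (\int[m2]_y (f (x, y))%:E)%E.
  by rewrite fin_Rintegral//; exact: bounded_mfun_pair2.
have E2 y : (\int[m1]_x f (x, y))%:E = (\int[m1]_x (f (x, y))%:E)%E.
  by rewrite fin_Rintegral//; exact: bounded_mfun_pair1.
under eq_integral do rewrite E1.
under [in RHS]eq_integral do rewrite E2.
exact: (Fubini bounded_mfun_integrable_prod).
Qed.

End bounded_fubini.

(** Exponents are bounded from above only, so the negative quadratic part of an offset does no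
    harm. *)
Lemma expR_le_quadratic (R : realType) (u : R) :
  u <= 1 -> expR u <= 1 + u + 2 * u ^+ 2.
Proof.
move=> u1.
(* [exp (-u) >= (1 - u/2)^2] and [(1 + u + 2u^2) (1 - u/2)^2 >= 1]. *)
have h : (1 - u / 2) ^+ 2 <= expR (- u).
  have -> : - u = 2%:R * - (u / 2) by field.
  rewrite expRM_natl lerXn2r// ?nnegrE ?expR_ge0//; first lra.
  by rewrite (le_trans _ (expR_ge1Dx _)).
have p : 1 <= (1 + u + 2 * u ^+ 2) * (1 - u / 2) ^+ 2.
  rewrite -subr_ge0 (_ : _ - 1 = u ^+ 2 / 4 * ((1 - u) * (5 - 2 * u))); last by field.
  by rewrite mulr_ge0 ?divr_ge0 ?sqr_ge0// mulr_ge0; lra.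
have q : 0 <= 1 + u + 2 * u ^+ 2 by nra.
have := ler_wpM2l q h; rewrite expRN => /(le_trans p).
by rewrite ler_pdivlMr ?expR_gt0// mul1r.
Qed.

Section expectation_exponential.
Context d (T : measurableType d) (R : realType) (mu : probability T R).

Lemma expect_expR_le (f : T -> R) : bounded_mfun f -> (forall x, f x <= 1) ->
  \int[mu]_x expR (f x) <=
  expR (\int[mu]_x f x + 2 * \int[mu]_x (f x ^+ 2)).
Proof.
move=> bf f1; have bf2 := bounded_mfunX 2 bf.
have b1 := @bounded_mfun_cst _ T R 1.
rewrite (le_trans _ (expR_ge1Dx _))//.
rewrite -expectZ// -expectD//; last exact: bounded_mfunZ.
rewrite -[X in _ <= X + _](expect_cst mu) -expectD//; last first.
  exact/bounded_mfunD/bounded_mfunZ.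
apply: expect_le => [|//|x]; first exact: bounded_mfun_expR.
  by apply: bounded_mfunD => //; exact/bounded_mfunD/bounded_mfunZ.
by rewrite addrA; exact: expR_le_quadratic.
Qed.

(** Cauchy-Schwarz for the measure with density [|k|], of mass at most [M]. Integrated over the
    other variable of a two-variable kernel it becomes Schur's test. *)
Lemma expect_cauchy_schwarz (k f : T -> R) (M : R) :
  bounded_mfun k -> bounded_mfun f -> 0 < M -> \int[mu]_x `|k x| <= M ->
  (\int[mu]_x (k x * f x)) ^+ 2 <= M * \int[mu]_x (`|k x| * f x ^+ 2).
Proof.
move=> bk bf M0 kM.
have bkf := bounded_mfunM bk bf; have bk' := bounded_mfun_norm bk.
have bf' := bounded_mfun_norm bf.
have bkf2 := bounded_mfunM bk' (bounded_mfunX 2 bf).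
have bkf1 := bounded_mfunM bk' bf'.
set B := \int[mu]_x (`|k x| * `|f x|).
have B0 : 0 <= B by apply: expect_ge0 => x; rewrite mulr_ge0.
apply: (@le_trans _ _ (B ^+ 2)).
  rewrite -real_normK ?num_real// lerXn2r// ?nnegrE//.
  rewrite (le_trans (expect_norm _ _))// /B.
  by under eq_Rintegral do rewrite normrM.
(* Integrate [0 <= |k| (|f| - t)^2] at [t = B / M]. *)
set t := B / M.
have : 0 <= \int[mu]_x (`|k x| * (`|f x| - t) ^+ 2).
  by apply: expect_ge0 => x; rewrite mulr_ge0// sqr_ge0.
have -> : \int[mu]_x (`|k x| * (`|f x| - t) ^+ 2) =
   \int[mu]_x (`|k x| * f x ^+ 2 + (- (2 * t) * (`|k x| * `|f x|) + t ^+ 2 * `|k x|)).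
  by apply: eq_Rintegral => x _; rewrite -[f x ^+ 2]real_normK ?num_real//; ring.
rewrite expectD//; last by apply: bounded_mfunD; exact: bounded_mfunZ.
rewrite expectD; [|exact: bounded_mfunZ|exact: bounded_mfunZ].
rewrite !expectZ// -/B => h.
have h2 : t ^+ 2 * \int[mu]_x `|k x| <= t ^+ 2 * M by rewrite ler_wpM2l// sqr_ge0.
have Bt : B = t * M by rewrite /t divfK// gt_eqF.
set C := \int[mu]_x _ in h *; rewrite Bt in h *.
have : 0 <= C - t ^+ 2 * M by move: h h2; set D := \int[mu]_x _; lra.
move=> /(mulr_ge0 (ltW M0)); lra.
Qed.

End expectation_exponential.

(** * Independence as resampling *)

Definition set_coord (T : Type) N (w : 'rV[T]_N) (k : 'I_N) (x : T) : 'rV[T]_N :=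
  \row_j if j == k then x else w ord0 j.

Lemma set_coord_eq (T : Type) N (w : 'rV[T]_N) k x : set_coord w k x ord0 k = x.
Proof. by rewrite mxE eqxx. Qed.

Lemma set_coord_neq (T : Type) N (w : 'rV[T]_N) k x j :
  j != k -> set_coord w k x ord0 j = w ord0 j.
Proof. by rewrite mxE => /negbTE ->. Qed.

Section resampling.
Context d (T : measurableType d) (R : realType) (N : nat).
Implicit Types (w : 'rV[T]_N) (k : 'I_N).

Lemma measurable_set_coord k :
  measurable_fun setT (fun p : T * 'rV[T]_N => set_coord p.2 k p.1).
Proof.
apply: measurable_fun_rV => j; have [->|jk] := eqVneq j k.
  by under eq_fun do rewrite set_coord_eq; exact: measurable_fst.
under eq_fun do rewrite set_coord_neq//.
exact: (measurableT_comp (measurable_coord j) measurable_snd).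
Qed.

Variables (L : probability 'rV[T]_N R) (mu : probability T R).

(* [L] is the law of a vector of independent variables of law [mu]: independence
   enters only through this invariance under redrawing one coordinate. *)
Definition resampling : Prop := forall k (f : 'rV[T]_N -> R), bounded_mfun f ->
  \int[L]_w f w = \int[L]_w \int[mu]_x f (set_coord w k x).

Hypothesis HL : resampling.

Lemma bounded_mfun_coord (f : T * 'rV[T]_N -> R) k :
  bounded_mfun f -> bounded_mfun (fun w => f (w ord0 k, w)).
Proof.
move=> bf; apply: bounded_mfun_comp bf _.
exact: measurable_fun_pair (measurable_coord k) (@measurable_id _ _ _).
Qed.

Lemma expect_coord (f : T * 'rV[T]_N -> R) k : bounded_mfun f ->
  (forall x y w, f (x, set_coord w k y) = f (x, w)) ->
  \int[L]_w f (w ord0 k, w) = \int[L]_w \int[mu]_x f (x, w).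
Proof.
move=> bf fk; rewrite (HL k); last exact: bounded_mfun_coord.
by apply: eq_Rintegral => w _; apply: eq_Rintegral => x _; rewrite set_coord_eq fk.
Qed.

(** Given the remaining coordinates, those in [ks] are independent draws from [mu]. This takes the
    place of conditioning on the primed sample. *)
Lemma expect_prod_coord (ks : seq 'I_N) (f : T * 'rV[T]_N -> R)
    (H : 'rV[T]_N -> R) :
  uniq ks -> bounded_mfun f -> bounded_mfun H ->
  (forall k x y w, k \in ks -> f (x, set_coord w k y) = f (x, w)) ->
  (forall k y w, k \in ks -> H (set_coord w k y) = H w) ->
  \int[L]_w ((\prod_(k <- ks) f (w ord0 k, w)) * H w) =
  \int[L]_w ((\int[mu]_x f (x, w)) ^+ size ks * H w).
Proof.
move=> + bf; elim: ks H => [|k ks IH] H /=.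
  by move=> _ _ _ _; apply: eq_Rintegral => w _; rewrite big_nil expr0.
move=> /andP[kks uks] bH fks Hks.
have bfk := bounded_mfun_coord k bf.
have bmf : bounded_mfun (fun w => \int[mu]_x f (x, w)) by exact: bounded_mfun_expect2.
under eq_Rintegral do rewrite big_cons [f _ * _]mulrC -mulrA.
(* The factor of [k] joins [H]: it ignores the coordinates in the tail because [k] is not one of
   them. *)
rewrite (IH (fun w => f (w ord0 k, w) * H w))//; last 3 first.
- exact: bounded_mfunM.
- by move=> j x y w jks; rewrite fks// inE jks orbT.
- move=> j y w jks; rewrite Hks ?inE ?jks ?orbT// set_coord_neq//.
    by rewrite fks// inE jks orbT.
  by apply: contraNneq kks => ->.
(* The power produced by the induction ignores coordinate [k], so a redrawn value enters through
   [f p] alone. *)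
pose g p := (\int[mu]_x f (x, p.2)) ^+ size ks * (f p * H p.2).
have bg : bounded_mfun g.
  apply: bounded_mfunM.
    by apply: bounded_mfunX; exact: (bounded_mfun_comp bmf measurable_snd).
  by apply: bounded_mfunM => //; exact: (bounded_mfun_comp bH measurable_snd).
have ksk : k \in k :: ks by rewrite inE eqxx.
rewrite (@expect_coord g k)//; last first.
  move=> x y w; rewrite /g/= fks// Hks//; congr (_ ^+ _ * _).
  by apply: eq_Rintegral => z _; rewrite fks.
apply: eq_Rintegral => w _; rewrite /g/=.
have -> : \int[mu]_x ((\int[mu]_x0 f (x0, w)) ^+ size ks * (f (x, w) * H w)) =
    \int[mu]_x (((\int[mu]_x0 f (x0, w)) ^+ size ks * H w) * f (x, w)).
  by apply: eq_Rintegral => x _; rewrite mulrA mulrAC.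
rewrite expectZ; last exact: bounded_mfun_pair1.
by rewrite exprS mulrC mulrA.
Qed.

End resampling.

(** * The oracle inequality for bounded kernels *)

Section two_sample.
Context d (T : measurableType d) (R : realType) (n : nat).
Local Notation I := (option ('I_n + 'I_n)).
Local Notation W := 'rV[T]_#|{: I}|.

(* Positions of X_i, X'_i and X_0 in the vector of all observations. *)
Definition coord1 (i : 'I_n) : 'I_#|{: I}| := enum_rank (Some (inl i) : I).
Definition coord2 (i : 'I_n) : 'I_#|{: I}| := enum_rank (Some (inr i) : I).
Definition coord0 : 'I_#|{: I}| := enum_rank (None : I).

Lemma coord1_inj : injective coord1.
Proof. by move=> i j /enum_rank_inj[]. Qed.

Lemma coord2_inj : injective coord2.
Proof. by move=> i j /enum_rank_inj[]. Qed.

Lemma coord21 i j : coord2 i != coord1 j.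
Proof. by apply/eqP => /enum_rank_inj. Qed.

Lemma coord10 i : coord1 i != coord0.
Proof. by apply/eqP => /enum_rank_inj. Qed.

Lemma coord20 i : coord2 i != coord0.
Proof. by apply/eqP => /enum_rank_inj. Qed.

Variables (L : probability W R) (mu : probability T R).
Hypothesis HL : resampling L mu.

Lemma expect_prod_coord1 (f : T * W -> R) (H : W -> R) :
  bounded_mfun f -> bounded_mfun H ->
  (forall i x y w, f (x, set_coord w (coord1 i) y) = f (x, w)) ->
  (forall i y w, H (set_coord w (coord1 i) y) = H w) ->
  \int[L]_w ((\prod_(i < n) f (w ord0 (coord1 i), w)) * H w) =
  \int[L]_w ((\int[mu]_x f (x, w)) ^+ n * H w).
Proof.
move=> bf bH fi Hi.
have := @expect_prod_coord _ _ _ _ _ _ HL [seq coord1 i | i <- enum 'I_n] f H.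
rewrite size_map size_enum_ord => <- //.
- by apply: eq_Rintegral => w _; rewrite big_map big_enum.
- by rewrite map_inj_uniq ?enum_uniq//; exact: coord1_inj.
- by move=> k x y w /mapP[i _ ->].
- by move=> k y w /mapP[i _ ->].
Qed.

Lemma expect_prod_coord2 (f : T -> R) : bounded_mfun f ->
  \int[L]_w (\prod_(i < n) f (w ord0 (coord2 i))) = (\int[mu]_x f x) ^+ n.
Proof.
move=> bf.
have bf2 : bounded_mfun (fun p : T * W => f p.1).
  exact: (bounded_mfun_comp bf measurable_fst).
have := @expect_prod_coord _ _ _ _ _ _ HL [seq coord2 i | i <- enum 'I_n]
  (fun p => f p.1) (fun=> 1).
rewrite size_map size_enum_ord => h.
transitivity (\int[L]_w ((\int[mu]_x f x) ^+ n * 1)).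
  rewrite -h//; last 2 first.
  - by rewrite map_inj_uniq ?enum_uniq//; exact: coord2_inj.
  - exact: bounded_mfun_cst.
  by apply: eq_Rintegral => w _; rewrite mulr1 big_map big_enum.
by rewrite expect_cst mulr1.
Qed.

Variables (Kh : T * T -> R) (f1 : T -> R) (s kap M1 F rho tau : R).
(* [s] stands for n h^d. *)
Hypotheses (n0 : (0 < n)%N) (s1 : 1 <= s) (ns : ln n%:R <= s).
Hypotheses (bK : bounded_mfun Kh) (bf1 : bounded_mfun f1).
Hypothesis Kkap : forall p, s * `|Kh p| <= kap * n%:R.
Hypotheses (M10 : 0 < M1) (F1 : 1 <= F).
Hypothesis KM1 : forall x, \int[mu]_y `|Kh (y, x)| <= M1.
Hypothesis KM2 : forall y, \int[mu]_x `|Kh (y, x)| <= M1.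
Hypothesis Kbias : forall x, `|\int[mu]_y Kh (y, x) - f1 x| <= rho.
Hypothesis f1F : forall x, 0 <= f1 x <= F.

Let nR0 : 0 < n%:R :> R. Proof. by rewrite ltr0n. Qed.
Let s0 : 0 <= s. Proof. by rewrite (le_trans ler01). Qed.
Let F0 : 0 <= F. Proof. by rewrite (le_trans ler01). Qed.

Definition smooth (p : T * W) : R :=
  n%:R^-1 * \sum_(l < n) Kh (p.2 ord0 (coord2 l), p.1).

Definition noise (p : T * W) : R := smooth p - f1 p.1.

(* Such that [s * (2 * F - level) + 2 * s * expR (2 * kap) * M1 = - s], which is
   at most [- ln n]. *)
Definition level : R := 2 * expR (2 * kap) * M1 + 2 * F + 1.

Definition tnoise (p : T * W) : R := if `|noise p| <= level then noise p else 0.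

Definition excess (p : T * W) : R := `|noise p - tnoise p|.

Lemma level_ge0 : 0 <= level.
Proof.
have : 0 <= 2 * expR (2 * kap) * M1 by rewrite !mulr_ge0 ?expR_ge0// ltW.
by have := F0; rewrite /level; lra.
Qed.

Lemma bounded_mfun_Kcoord (l : 'I_n) :
  bounded_mfun (fun p : T * W => Kh (p.2 ord0 (coord2 l), p.1)).
Proof.
apply: bounded_mfun_comp bK _; apply: measurable_fun_pair => //.
exact: (measurableT_comp (measurable_coord _) measurable_snd).
Qed.

Lemma bounded_mfun_smooth : bounded_mfun smooth.
Proof. exact/bounded_mfunZ/bounded_mfun_sum/bounded_mfun_Kcoord. Qed.

Lemma bounded_mfun_noise : bounded_mfun noise.
Proof.
apply: bounded_mfunB; first exact: bounded_mfun_smooth.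
exact: (bounded_mfun_comp bf1 measurable_fst).
Qed.

Lemma bounded_mfun_tnoise : bounded_mfun tnoise.
Proof.
apply: (bounded_mfun_le _ bounded_mfun_noise) => [|p].
  apply: measurable_fun_ifT => //; last exact: bounded_mfun_noise.1.
  apply: measurable_fun_ler => //; exact: (bounded_mfun_norm bounded_mfun_noise).1.
by rewrite /tnoise; case: ifP => // _; rewrite normr0.
Qed.

Lemma bounded_mfun_excess : bounded_mfun excess.
Proof.
apply: bounded_mfun_norm; apply: bounded_mfunB bounded_mfun_noise _.
exact: bounded_mfun_tnoise.
Qed.

Lemma tnoise_le p : `|tnoise p| <= level.
Proof. by rewrite /tnoise; case: ifP => // _; rewrite normr0 level_ge0. Qed.

Lemma smooth_coord1 x w i y : smooth (x, set_coord w (coord1 i) y) = smooth (x, w).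
Proof.
by congr (_ * _); apply: eq_bigr => l _; rewrite /= set_coord_neq ?coord21.
Qed.

Lemma noise_coord1 x w i y : noise (x, set_coord w (coord1 i) y) = noise (x, w).
Proof. by rewrite /noise smooth_coord1. Qed.

Lemma tnoise_coord1 x w i y : tnoise (x, set_coord w (coord1 i) y) = tnoise (x, w).
Proof. by rewrite /tnoise noise_coord1. Qed.

Lemma excess_coord1 x w i y : excess (x, set_coord w (coord1 i) y) = excess (x, w).
Proof. by rewrite /excess noise_coord1 tnoise_coord1. Qed.

(** Let [e] be the size of a noise above the level. As [s >= 1],
    [e <= exp (s e) <= exp (2 s e - s level)], and [s e] is at most [s F] plus the rescaled kernel
    sum. The factor 2 lets Chernoff's bound control the first moment of the excess and not merely
    its probability. *)
Lemma excess_le x w : excess (x, w) <=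
  expR (s * (2 * F - level)) *
  \prod_(l < n) expR (2 * (s / n%:R * `|Kh (w ord0 (coord2 l), x)|)).
Proof.
rewrite -expR_sum -expRD -mulr_sumr.
rewrite /excess /tnoise; case: (leP `|noise (x, w)|) => [_|lt_noise].
  by rewrite subrr normr0 expR_ge0.
rewrite subr0; set e := `|noise _| in lt_noise *.
have se : s * e <= s * F + \sum_(l < n) s / n%:R * `|Kh (w ord0 (coord2 l), x)|.
  have -> : \sum_(l < n) s / n%:R * `|Kh (w ord0 (coord2 l), x)| =
    s * (n%:R^-1 * \sum_(l < n) `|Kh (w ord0 (coord2 l), x)|).
    by rewrite !mulr_sumr; apply: eq_bigr => l _; rewrite mulrA.
  rewrite -mulrDr ler_wpM2l//.
  rewrite addrC (le_trans (ler_normB _ _))// lerD//.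
    rewrite normrM ger0_norm ?invr_ge0// ler_wpM2l ?invr_ge0//.
    exact: ler_norm_sum.
  by have /andP[f0 fF] := f1F x; rewrite ger0_norm.
have e0 : 0 <= e by exact: normr_ge0.
rewrite (@le_trans _ _ (expR (s * e)))//.
  rewrite (le_trans _ (expR_ge1Dx _))//.
  have : 0 <= (s - 1) * e by rewrite mulr_ge0// subr_ge0.
  rewrite -/e; lra.
rewrite ler_expR.
have : 0 <= s * (e - level) by rewrite mulr_ge0// subr_ge0 ltW.
set S := \sum_(l < n) _ in se *.
by rewrite !mulrBr mulrDr; lra.
Qed.

(** The rescaled kernel [k] is at most [kap] with mean at most [s M1 / n], so the [n] factors
    together contribute at most [exp (2 exp (2 kap) M1 s)]. The choice of [level] leaves
    [exp (- s)], which is at most [1 / n]. *)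
Lemma expect_excess x : \int[L]_w excess (x, w) <= n%:R^-1.
Proof.
have sn0 : 0 <= s / n%:R by rewrite divr_ge0.
pose k y := s / n%:R * `|Kh (y, x)|.
have k0 y : 0 <= k y by rewrite mulr_ge0.
have kk y : k y <= kap by rewrite /k mulrAC ler_pdivrMr.
have bk : bounded_mfun k by exact/bounded_mfunZ/bounded_mfun_norm/bounded_mfun_pair1.
have bexp : bounded_mfun (fun y => expR (2 * k y)) by exact/bounded_mfun_expR/bounded_mfunZ.
have bprod : bounded_mfun (fun w : W => \prod_(l < n) expR (2 * k (w ord0 (coord2 l)))).
  apply: bounded_mfun_prod => l; apply: (bounded_mfun_comp bexp).
  exact: measurable_coord.
apply: (@le_trans _ _ (\int[L]_w (expR (s * (2 * F - level)) *
    \prod_(l < n) expR (2 * k (w ord0 (coord2 l)))))).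
  apply: expect_le => [||w]; last exact: excess_le.
    exact: bounded_mfun_pair2 bounded_mfun_excess.
  exact: bounded_mfunZ.
rewrite expectZ// (@expect_prod_coord2 (fun y => expR (2 * k y)))//.
have h : \int[mu]_y expR (2 * k y) <= expR (2 * expR (2 * kap) * (s / n%:R * M1)).
  apply: le_trans (expR_ge1Dx _).
  rewrite -[X in _ <= X + _](expect_cst mu).
  apply: (@le_trans _ _ (\int[mu]_y (1 + 2 * expR (2 * kap) * k y))).
    apply: expect_le => // [|y].
      by apply: bounded_mfunD; [exact: bounded_mfun_cst|exact: bounded_mfunZ].
    (* Multiplying [1 - 2 k <= exp (- 2 k)] by [exp (2 k)] gives [exp (2 k) <= 1 + 2 k exp (2 k)];
       then [k <= kap] linearizes the exponential. *)
    have := expR_ge1Dx (- (2 * k y)); rewrite expRN => h.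
    have := ler_wpM2r (expR_ge0 (2 * k y)) h.
    rewrite mulVf ?gt_eqF ?expR_gt0// => {}h.
    have h2 : expR (2 * k y) <= expR (2 * kap) by rewrite ler_expR ler_wpM2l.
    have := ler_wpM2l (k0 y) h2; move: h; lra.
  rewrite expectD; [|exact: bounded_mfun_cst|exact: bounded_mfunZ].
  rewrite lerD2l// expectZ// ler_wpM2l ?mulr_ge0 ?expR_ge0//.
  rewrite expectZ; last exact/bounded_mfun_norm/bounded_mfun_pair1.
  by rewrite ler_wpM2l.
have hn : (\int[mu]_y expR (2 * k y)) ^+ n <= expR (s * (2 * expR (2 * kap) * M1)).
  have -> : s * (2 * expR (2 * kap) * M1) = n%:R * (2 * expR (2 * kap) * (s / n%:R * M1)).
    by field; rewrite gt_eqF.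
  rewrite expRM_natl lerXn2r// ?nnegrE ?expR_ge0//.
  by apply: expect_ge0 => y; rewrite expR_ge0.
apply: (le_trans (ler_wpM2l (expR_ge0 _) hn)).
rewrite -expRD -mulrDr (_ : 2 * F - level + _ = -1); last by rewrite /level; ring.
by rewrite -[n%:R]lnK ?posrE// -expRN ler_expR mulrN1 lerN2.
Qed.

(** [tau1] and [tau2] keep the exponents below 1 in the integrations over the X_i and over the
    primed sample; [tau3] bounds the second-order terms of both. *)
Hypothesis tau0 : 0 < tau.
Hypothesis tau1 : tau * (16 * F ^+ 2 + 16 * F * level) <= 1.
Hypothesis tau2 : tau * (16 * F * M1) <= 1.
Hypothesis tau3 :
  tau * (128 * F ^+ 2 + 256 * level ^+ 2 + 128 * M1 ^+ 2) <= 1.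

Lemma bounded_mfun_mean_excess :
  bounded_mfun (fun w : W => \int[mu]_x excess (x, w)).
Proof. exact: bounded_mfun_expect2 bounded_mfun_excess. Qed.

(** * Exponential moment of the deviation for one center *)

Section competitor.
Variables c fs : T -> R.
Hypotheses (bc : bounded_mfun c) (bfs : bounded_mfun fs).
Hypotheses (cF : forall x, `|c x| <= F) (fsF : forall x, `|fs x| <= F).

Local Notation a := (\int[mu]_x ((c x - f1 x) ^+ 2)).
Local Notation b := (\int[mu]_x ((fs x - f1 x) ^+ 2)).

Definition offset (p : T * W) : R :=
  - 4 * (c p.1 - f1 p.1) ^+ 2 + 8 * (tnoise p * (c p.1 - fs p.1)).

(* [3 * b + 32 * rho ^+ 2] and the last term pay for the mean of the offsets:
   this is the centering for which [expect_expR_deviation] holds. *)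
Definition deviation (w : W) : R :=
  a - 3 * b - 32 * rho ^+ 2 + n%:R^-1 * \sum_(i < n) offset (w ord0 (coord1 i), w)
  - 16 * F * \int[mu]_x excess (x, w).

Let bphi : bounded_mfun (fun x => c x - fs x). Proof. exact: bounded_mfunB. Qed.
Let br : bounded_mfun (fun x => (c x - f1 x) ^+ 2).
Proof. exact/bounded_mfunX/bounded_mfunB. Qed.
Let brs : bounded_mfun (fun x => (fs x - f1 x) ^+ 2).
Proof. exact/bounded_mfunX/bounded_mfunB. Qed.
Let bphi1 : bounded_mfun (fun p : T * W => c p.1 - fs p.1).
Proof. exact: (bounded_mfun_comp bphi measurable_fst). Qed.

Let a0 : 0 <= a. Proof. by apply: expect_ge0 => x; rewrite sqr_ge0. Qed.
Let b0 : 0 <= b. Proof. by apply: expect_ge0 => x; rewrite sqr_ge0. Qed.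

Let phiF x : `|c x - fs x| <= 2 * F.
Proof.
by rewrite (le_trans (ler_normB _ _))// mulr_natl mulr2n lerD.
Qed.

Let rF x : `|c x - f1 x| <= 2 * F.
Proof.
rewrite (le_trans (ler_normB _ _))// mulr_natl mulr2n lerD//.
by have /andP[f0 fF] := f1F x; rewrite ger0_norm.
Qed.

Lemma expect_phi2 : \int[mu]_x ((c x - fs x) ^+ 2) <= 2 * (a + b).
Proof.
rewrite -expectD// -expectZ; last exact: bounded_mfunD.
apply: expect_le => [||x]; first exact: bounded_mfunX.
  by apply: bounded_mfunZ; exact: bounded_mfunD.
have := sqr_ge0 ((c x - f1 x) + (fs x - f1 x)).
by rewrite -subr_ge0 => h; rewrite -subr_ge0; move: h; rewrite !expr2; lra.
Qed.

Lemma bounded_mfun_offset : bounded_mfun offset.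
Proof.
apply: bounded_mfunD; apply: bounded_mfunZ.
  exact: (bounded_mfun_comp br measurable_fst).
by apply: bounded_mfunM => //; exact: bounded_mfun_tnoise.
Qed.

Lemma offset_coord1 x w i y : offset (x, set_coord w (coord1 i) y) = offset (x, w).
Proof. by rewrite /offset tnoise_coord1. Qed.

Let r2F x : (c x - f1 x) ^+ 2 <= 4 * F ^+ 2.
Proof.
rewrite -real_normK ?num_real// (_ : 4 * _ = (2 * F) ^+ 2); last by ring.
by rewrite lerXn2r// nnegrE// mulr_ge0.
Qed.

Let tphi p : `|tnoise p * (c p.1 - fs p.1)| <= level * `|c p.1 - fs p.1|.
Proof. by rewrite normrM ler_wpM2r// tnoise_le. Qed.

Let tnoise2 p : (tnoise p * (c p.1 - fs p.1)) ^+ 2 <= level ^+ 2 * (c p.1 - fs p.1) ^+ 2.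
Proof.
rewrite exprMn ler_wpM2r ?sqr_ge0// -real_normK ?num_real//.
by rewrite lerXn2r ?tnoise_le// nnegrE level_ge0.
Qed.

Lemma tau_offset_le1 p : tau * offset p <= 1.
Proof.
apply: le_trans tau1; rewrite ler_wpM2l ?(ltW tau0)// /offset.
have := le_trans (ler_norm _) (tphi p).
have := ler_wpM2l level_ge0 (phiF p.1).
have := sqr_ge0 (c p.1 - f1 p.1); have := sqr_ge0 F.
rewrite mulrCA; lra.
Qed.

(** One factor of the fourth power is bounded by [4 F^2], so the second moment becomes a multiple of
    [a + b], the quantity that the quadratic term can absorb. *)
Lemma offset2_le p :
  offset p ^+ 2 <= 128 * F ^+ 2 * (c p.1 - f1 p.1) ^+ 2 +
                   128 * level ^+ 2 * (c p.1 - fs p.1) ^+ 2.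
Proof.
have h1 := ler_wpM2r (sqr_ge0 (c p.1 - f1 p.1)) (r2F p.1).
have h2 := tnoise2 p.
rewrite /offset; set u := (c p.1 - f1 p.1) ^+ 2 in h1 *.
set v := tnoise p * _ in h2 *.
have := sqr_ge0 (- 4 * u - 8 * v); move: h1 h2; rewrite !expr2; lra.
Qed.

Lemma expect_noise w :
  \int[mu]_x (noise (x, w) * (c x - fs x)) =
  n%:R^-1 * \sum_(l < n) \int[mu]_x (Kh (w ord0 (coord2 l), x) * (c x - fs x))
  - \int[mu]_x (f1 x * (c x - fs x)).
Proof.
have bKphi l : bounded_mfun (fun x => Kh (w ord0 (coord2 l), x) * (c x - fs x)).
  by apply: bounded_mfunM => //; exact: bounded_mfun_pair2.
rewrite -expect_sum// -expectZ; last exact: bounded_mfun_sum.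
rewrite -expectB; [|exact/bounded_mfunZ/bounded_mfun_sum|exact: bounded_mfunM].
apply: eq_Rintegral => x _; rewrite /noise /smooth mulrBl -mulrA mulr_suml.
by [].
Qed.

(** Inside the mean over [x] the truncation is undone, since only the full noise is linear in the
    primed sample. The price is the excess times [|c - fs| <= 2 F]. *)
Lemma expect_tnoise w :
  \int[mu]_x (tnoise (x, w) * (c x - fs x)) <=
  \int[mu]_x (noise (x, w) * (c x - fs x)) +
  2 * F * \int[mu]_x excess (x, w).
Proof.
have bn1 : bounded_mfun (fun x => noise (x, w) * (c x - fs x)).
  by apply: bounded_mfunM => //; exact: bounded_mfun_pair1 bounded_mfun_noise.
have be : bounded_mfun (fun x => excess (x, w)) by exact: bounded_mfun_pair1 bounded_mfun_excess.
rewrite -expectZ// -expectD//; last exact: bounded_mfunZ.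
apply: expect_le => [||x].
- by apply: bounded_mfunM => //; exact: bounded_mfun_pair1 bounded_mfun_tnoise.
- by apply: bounded_mfunD => //; exact: bounded_mfunZ.
rewrite -lerBlDl -mulrBl (le_trans (ler_norm _))// normrM.
by rewrite distrC mulrC ler_wpM2r.
Qed.

Lemma expect_expR_offset w :
  \int[mu]_x expR (tau * offset (x, w)) <=
  expR (tau * (- 4 * a + 8 * \int[mu]_x (noise (x, w) * (c x - fs x)) +
    16 * F * \int[mu]_x excess (x, w)
    + 2 * tau * (128 * F ^+ 2 + 256 * level ^+ 2) * (a + b))).
Proof.
have bo : bounded_mfun (fun x => offset (x, w)) by exact: bounded_mfun_pair1 bounded_mfun_offset.
have bt : bounded_mfun (fun x => tnoise (x, w) * (c x - fs x)).
  by apply: bounded_mfunM => //; exact: bounded_mfun_pair1 bounded_mfun_tnoise.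
have bto := bounded_mfunZ tau bo.
apply: le_trans (expect_expR_le mu bto _) _ => [x|]; first exact: tau_offset_le1.
rewrite ler_expR expectZ//.
have -> : \int[mu]_x (tau * offset (x, w)) ^+ 2 = tau ^+ 2 * \int[mu]_x (offset (x, w) ^+ 2).
  by rewrite -expectZ; [apply: eq_Rintegral => x _; rewrite exprMn|exact: bounded_mfunX].
have h1 : \int[mu]_x offset (x, w) = - 4 * a + 8 * \int[mu]_x (tnoise (x, w) * (c x - fs x)).
  by rewrite -!expectZ// -expectD//; exact: bounded_mfunZ.
have h2 : \int[mu]_x (offset (x, w) ^+ 2) <=
    (128 * F ^+ 2 + 256 * level ^+ 2) * (a + b).
  apply: (@le_trans _ _ (\int[mu]_x (128 * F ^+ 2 * (c x - f1 x) ^+ 2 +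
                   128 * level ^+ 2 * (c x - fs x) ^+ 2))).
    apply: expect_le => [||x]; first exact: bounded_mfunX.
      apply: bounded_mfunD; apply: bounded_mfunZ => //; exact: bounded_mfunX.
    exact: (offset2_le (x, w)).
  rewrite expectD; [|exact: bounded_mfunZ|exact/bounded_mfunZ/bounded_mfunX].
  rewrite !expectZ//; last exact: bounded_mfunX.
  have := ler_wpM2l (mulr_ge0 (ler0n _ 128) (sqr_ge0 level)) expect_phi2.
  have := mulr_ge0 (mulr_ge0 (ler0n _ 128) (sqr_ge0 F)) b0.
  set A := a; set B := b; lra.
have := ler_wpM2l (mulr_ge0 (ltW tau0) (ltW tau0)) h2.
have := ler_wpM2l (ltW tau0) (expect_tnoise w); rewrite h1 !expr2.
set X := \int[mu]_x offset _ ^+ 2; lra.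
Qed.

(** The exponent is a sum of [G] over independent observations: the mean of [G] carries the bias,
    and its second moment is controlled by Schur's test. *)
Lemma expect_expR_kernel :
  \int[L]_w expR (8 * tau * \sum_(l < n) \int[mu]_x
      (Kh (w ord0 (coord2 l), x) * (c x - fs x))) <=
  expR (tau * n%:R * (8 * \int[mu]_x (f1 x * (c x - fs x)) + 32 * rho ^+ 2
    + (a + b) + 256 * tau * M1 ^+ 2 * (a + b))).
Proof.
pose G y := \int[mu]_x (Kh (y, x) * (c x - fs x)).
have bphi2 : bounded_mfun (fun p : T * T => c p.2 - fs p.2).
  exact: (bounded_mfun_comp bphi measurable_snd).
have bKphi : bounded_mfun (fun p : T * T => Kh p * (c p.2 - fs p.2)) by exact: bounded_mfunM.
have bG : bounded_mfun G by exact: bounded_mfun_expect1 bKphi.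
have b8G : bounded_mfun (fun y => 8 * tau * G y) by exact: bounded_mfunZ.
have bKphi2 : bounded_mfun (fun p : T * T => `|Kh p| * (c p.2 - fs p.2) ^+ 2).
  by apply: bounded_mfunM; [exact: bounded_mfun_norm|exact: bounded_mfunX].
have GF y : `|G y| <= 2 * F * M1.
  have bKy : bounded_mfun (fun x => Kh (y, x)) by exact: bounded_mfun_pair2.
  rewrite (le_trans (expect_norm _ _))//; first exact: bounded_mfunM.
  apply: (le_trans _ (ler_wpM2l (mulr_ge0 (ler0n _ 2) F0) (KM2 y))).
  rewrite -expectZ; last exact: bounded_mfun_norm.
  apply: expect_le => [||x].
  - exact/bounded_mfun_norm/bounded_mfunM.
  - exact/bounded_mfunZ/bounded_mfun_norm.
  by rewrite normrM mulrC ler_wpM2r.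
have G1 y : 8 * tau * G y <= 1.
  apply: le_trans tau2; have := le_trans (ler_norm _) (GF y).
  by move=> /(ler_wpM2l (mulr_ge0 (ler0n _ 8) (ltW tau0))); lra.
(* Schur's test: Cauchy-Schwarz in [x] with the mass from [KM2], then integration in [y] with the
   mass from [KM1]. *)
have G2 : \int[mu]_y (G y ^+ 2) <= M1 ^+ 2 * (2 * (a + b)).
  apply: (@le_trans _ _ (\int[mu]_y (M1 * \int[mu]_x (`|Kh (y, x)| * (c x - fs x) ^+ 2)))).
    apply: expect_le => [||y]; first exact: bounded_mfunX.
      apply: bounded_mfunZ; exact: (bounded_mfun_expect1 mu mu bKphi2).
    by apply: expect_cauchy_schwarz => //; exact: bounded_mfun_pair2.
  rewrite expectZ; last exact: (bounded_mfun_expect1 mu mu bKphi2).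
  rewrite (expect_swap mu mu bKphi2)/= expr2 -mulrA ler_wpM2l ?(ltW M10)//.
  apply: (le_trans _ (ler_wpM2l (ltW M10) expect_phi2)).
  rewrite -expectZ; last exact: bounded_mfunX.
  apply: expect_le => [||x]; first exact: (bounded_mfun_expect2 mu mu bKphi2).
    exact/bounded_mfunZ/bounded_mfunX.
  under eq_Rintegral do rewrite mulrC.
  rewrite expectZ; last exact/bounded_mfun_norm/bounded_mfun_pair1.
  by rewrite mulrC ler_wpM2r ?sqr_ge0.
(* With [phi = c - fs], [8 rho |phi| <= 32 rho^2 + phi^2 / 2], and the mean of [phi^2 / 2] is at
   most [a + b]. *)
have Gbias : 8 * \int[mu]_y G y <=
    8 * \int[mu]_x (f1 x * (c x - fs x)) + 32 * rho ^+ 2 + (a + b).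
  have -> : \int[mu]_y G y = \int[mu]_x ((\int[mu]_y Kh (y, x)) * (c x - fs x)).
    rewrite (expect_swap mu mu bKphi)/=; apply: eq_Rintegral => x _.
    rewrite mulrC -expectZ; last exact: bounded_mfun_pair1.
    by apply: eq_Rintegral => y _; rewrite mulrC.
  have bK2 : bounded_mfun (fun x => \int[mu]_y Kh (y, x)) by exact: bounded_mfun_expect2.
  pose e x := (\int[mu]_y Kh (y, x) - f1 x) * (c x - fs x).
  have be : bounded_mfun e by apply: bounded_mfunM => //; exact: bounded_mfunB.
  have -> : \int[mu]_x ((\int[mu]_y Kh (y, x)) * (c x - fs x)) =
      \int[mu]_x (f1 x * (c x - fs x)) + \int[mu]_x e x.
    rewrite -expectD//; last exact: bounded_mfunM.
    by apply: eq_Rintegral => x _; rewrite /e; ring.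
  have bphi22 : bounded_mfun (fun x => 2^-1 * (c x - fs x) ^+ 2).
    exact/bounded_mfunZ/bounded_mfunX.
  have : \int[mu]_x (8 * e x) <= \int[mu]_x (32 * rho ^+ 2 + 2^-1 * (c x - fs x) ^+ 2).
    apply: expect_le => [||x]; first exact: bounded_mfunZ.
      by apply: bounded_mfunD => //; exact: bounded_mfun_cst.
    have he : e x <= rho * `|c x - fs x|.
      by rewrite (le_trans (ler_norm _))// normrM ler_wpM2r.
    have := sqr_ge0 (8 * rho - `|c x - fs x|).
    rewrite sqrrB [`|_| ^+ 2]real_normK ?num_real// exprMn; move: he.
    by set u := `|_|; lra.
  rewrite expectZ// expectD//; last exact: bounded_mfun_cst.
  rewrite expect_cst expectZ; last exact: bounded_mfunX.
  have := expect_phi2; set u := \int[mu]_x _; lra.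
have tn0 : 0 <= tau * n%:R by rewrite mulr_ge0 ?(ltW tau0).
have -> : \int[L]_w expR (8 * tau * \sum_(l < n) G (w ord0 (coord2 l))) =
    (\int[mu]_y expR (8 * tau * G y)) ^+ n.
  rewrite -(@expect_prod_coord2 (fun y => expR (8 * tau * G y))); last first.
    exact: bounded_mfun_expR.
  by apply: eq_Rintegral => w _; rewrite mulr_sumr expR_sum.
have h := expect_expR_le mu b8G G1.
have eG : \int[mu]_y expR (8 * tau * G y) <= expR (tau * (8 * \int[mu]_y G y +
    256 * tau * M1 ^+ 2 * (a + b))).
  apply: (le_trans h); rewrite ler_expR expectZ//.
  have -> : \int[mu]_y (8 * tau * G y) ^+ 2 = (8 * tau) ^+ 2 * \int[mu]_y (G y ^+ 2).
    by rewrite -expectZ; [apply: eq_Rintegral => y _; rewrite exprMn|exact: bounded_mfunX].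
  have := ler_wpM2l (mulr_ge0 (ltW tau0) (ltW tau0)) G2.
  by set X := \int[mu]_y (G y ^+ 2); rewrite exprMn; lra.
apply: (@le_trans _ _ (expR (tau * (8 * \int[mu]_y G y +
    256 * tau * M1 ^+ 2 * (a + b))) ^+ n)).
  by rewrite lerXn2r// ?nnegrE ?expR_ge0// expect_ge0// => y; rewrite expR_ge0.
rewrite -expRM_natl ler_expR mulrA [n%:R * _]mulrC ler_wpM2l//.
by rewrite lerD2r.
Qed.

Lemma bounded_mfun_deviation : bounded_mfun deviation.
Proof.
apply: bounded_mfunB; last exact/bounded_mfunZ/bounded_mfun_mean_excess.
apply: bounded_mfunD; first exact: bounded_mfun_cst.
apply/bounded_mfunZ/bounded_mfun_sum => i.
exact: bounded_mfun_coord bounded_mfun_offset.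
Qed.

Lemma expect_expR_deviation : \int[L]_w expR (tau * n%:R * deviation w) <= 1.
Proof.
have tn0 : 0 <= tau * n%:R by rewrite mulr_ge0 ?(ltW tau0).
(* [H] gathers what the unprimed observations do not enter; the rest is a product over them. *)
pose H w := expR (tau * n%:R * (a - 3 * b - 32 * rho ^+ 2
   - 16 * F * \int[mu]_x excess (x, w))).
have bH : bounded_mfun H.
  apply/bounded_mfun_expR/bounded_mfunZ/bounded_mfunB; first exact: bounded_mfun_cst.
  exact/bounded_mfunZ/bounded_mfun_mean_excess.
pose f p := expR (tau * offset p).
have bf : bounded_mfun f by exact/bounded_mfun_expR/bounded_mfunZ/bounded_mfun_offset.
have -> : \int[L]_w expR (tau * n%:R * deviation w) =
    \int[L]_w ((\prod_(i < n) f (w ord0 (coord1 i), w)) * H w).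
  apply: eq_Rintegral => w _; rewrite -expR_sum -expRD -mulr_sumr; congr expR.
  by rewrite /deviation; set S := \sum_(i < n) _; field; rewrite gt_eqF.
rewrite expect_prod_coord1//; last 2 first.
- by move=> i x y w; rewrite /f offset_coord1.
- move=> i y w; rewrite /H; congr (expR (_ * (_ - _ * _))).
  by apply: eq_Rintegral => x _; rewrite excess_coord1.
(* The mean excess cancels against the centering, and the part linear in the primed sample is split
   off as [S]. The term with [f1] will cancel the one in [expect_expR_kernel]. *)
set D := - (3 * a) - 3 * b - 32 * rho ^+ 2 - 8 * \int[mu]_x (f1 x * (c x - fs x))
   + 2 * tau * (128 * F ^+ 2 + 256 * level ^+ 2) * (a + b).
pose S (w : W) := \sum_(l < n) \int[mu]_x (Kh (w ord0 (coord2 l), x) * (c x - fs x)).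
have bS : bounded_mfun S.
  apply: bounded_mfun_sum => l.
  apply: (bounded_mfun_comp (f := fun y => \int[mu]_x (Kh (y, x) * (c x - fs x)))
    _ (measurable_coord (coord2 l))).
  apply: (bounded_mfun_expect1 mu mu (f := fun p => Kh p * (c p.2 - fs p.2))).
  apply: bounded_mfunM => //; exact: (bounded_mfun_comp bphi measurable_snd).
have beS : bounded_mfun (fun w => expR (8 * tau * S w)).
  exact/bounded_mfun_expR/bounded_mfunZ.
apply: (@le_trans _ _ (\int[L]_w (expR (tau * n%:R * D) * expR (8 * tau * S w)))).
  apply: expect_le => [||w].
  - apply: bounded_mfunM => //; apply: bounded_mfunX; exact: bounded_mfun_expect2.
  - exact: bounded_mfunZ.
  have := expect_expR_offset w.
  move=> h; apply: (@le_trans _ _ (expR (tau * (- 4 * a +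
    8 * \int[mu]_x (noise (x, w) * (c x - fs x)) +
    16 * F * \int[mu]_x excess (x, w)
    + 2 * tau * (128 * F ^+ 2 + 256 * level ^+ 2) * (a + b))) ^+ n * H w)).
    rewrite ler_wpM2r ?expR_ge0// lerXn2r ?nnegrE ?expR_ge0//.
    by apply: expect_ge0 => x; rewrite expR_ge0.
  rewrite -expRM_natl /H -!expRD ler_expR expect_noise -/(S w) /D.
  set A := a; set B := b; set E := \int[mu]_x _; set G := \int[mu]_x _.
  rewrite le_eqVlt; apply/orP; left; apply/eqP.
  by field; rewrite gt_eqF.
rewrite expectZ//.
apply: (le_trans (ler_wpM2l (expR_ge0 _) expect_expR_kernel)).
rewrite -expRD -mulrDr -[X in _ <= X]expR0 ler_expR mulr_ge0_le0//.
(* The balance: [- 3 (a + b)] from [D], [a + b] from the bias, and by [tau3] at most [2 (a + b)]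
   from the second-order terms. *)
have := ler_wpM2r (addr_ge0 a0 b0) tau3; rewrite /D.
set A := a; set B := b; set G := \int[mu]_x _.
have := a0; have := b0; rewrite -/A -/B; lra.
Qed.

End competitor.

Let mean_cst (c : R) : n%:R^-1 * (\sum_(i < n) c) = c.
Proof. by rewrite sumr_const card_ord -[c *+ n]mulr_natl mulKf// gt_eqF. Qed.

Lemma expect_mean_excess : \int[L]_w \int[mu]_x excess (x, w) <= n%:R^-1.
Proof.
rewrite -(expect_swap mu L bounded_mfun_excess) -[X in _ <= X](expect_cst mu).
apply: expect_le => [||x]; last exact: expect_excess.
  exact: bounded_mfun_expect1 bounded_mfun_excess.
exact: bounded_mfun_cst.
Qed.

(** Passing from the estimator to a center costs [delta] times the noise, so a first absolute moment
    bounded uniformly in [n] suffices. *)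
Lemma expect_mean_noise : \int[L]_w \int[mu]_x `|noise (x, w)| <= M1 + F.
Proof.
have bn := bounded_mfun_norm bounded_mfun_noise.
rewrite -(expect_swap mu L bn) -[X in _ <= X](expect_cst mu).
apply: expect_le => [||x]; first exact: (bounded_mfun_expect1 mu L bn).
  exact: bounded_mfun_cst.
have bKl l : bounded_mfun (fun w : W => `|Kh (w ord0 (coord2 l), x)|).
  apply: bounded_mfun_norm.
  exact: (bounded_mfun_comp (bounded_mfun_pair1 x bK) (measurable_coord _)).
have bsum : bounded_mfun (fun w : W =>
    n%:R^-1 * \sum_(l < n) `|Kh (w ord0 (coord2 l), x)|).
  exact/bounded_mfunZ/bounded_mfun_sum.
apply: (@le_trans _ _ (\int[L]_w (n%:R^-1 * \sum_(l < n) `|Kh (w ord0 (coord2 l), x)| + F))).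
  apply: expect_le => [||w]; first exact: bounded_mfun_pair2 bn.
    by apply: bounded_mfunD => //; exact: bounded_mfun_cst.
  rewrite (le_trans (ler_normB _ _))// lerD//.
    rewrite normrM ger0_norm ?invr_ge0// ler_wpM2l ?invr_ge0//.
    exact: ler_norm_sum.
  by have /andP[f0 fF] := f1F x; rewrite ger0_norm.
rewrite expectD//; last exact: bounded_mfun_cst.
rewrite expect_cst lerD2r expectZ; last exact: bounded_mfun_sum.
rewrite expect_sum// -[X in _ <= X]mean_cst ler_wpM2l ?invr_ge0//.
apply: ler_sum => l _.
rewrite (@expect_coord _ _ _ _ _ _ HL (fun p => `|Kh (p.1, x)|) (coord2 l))//=.
  by rewrite expect_cst.
apply: (bounded_mfun_comp _ measurable_fst (f := fun y => `|Kh (y, x)|)).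
exact/bounded_mfun_norm/bounded_mfun_pair1.
Qed.

(** * From the maximum over the cover to the risk of the estimator *)

Section estimator.
Variables (m : nat) (cs : 'I_m -> T -> R) (fs : T -> R) (fh : T * W -> R).
Variable delta : R.
Hypotheses (bcs : forall j, bounded_mfun (cs j)) (bfs : bounded_mfun fs).
Hypothesis bfh : bounded_mfun fh.
Hypotheses (csF : forall j x, `|cs j x| <= F) (fsF : forall x, `|fs x| <= F).
Hypothesis fhF : forall p, `|fh p| <= F.
Hypothesis fhcs : forall w, exists j, forall x, `|fh (x, w) - cs j x| <= delta.
Hypothesis delta0 : 0 <= delta.

(** Excess of the estimator's squared loss over the competitor's at one point; its average over the
    X_i is at most the empirical optimization gap. *)
Definition gain (p : T * W) : R :=
  (smooth p - fh p) ^+ 2 - (smooth p - fs p.1) ^+ 2.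

Lemma bounded_mfun_gain : bounded_mfun gain.
Proof.
apply: bounded_mfunB; apply/bounded_mfunX/bounded_mfunB => //;
  try exact: bounded_mfun_smooth.
exact: (bounded_mfun_comp bfs measurable_fst).
Qed.

Lemma expect_mean_coord1 (f : T * W -> R) : bounded_mfun f ->
  (forall i x y w, f (x, set_coord w (coord1 i) y) = f (x, w)) ->
  \int[L]_w (n%:R^-1 * \sum_(i < n) f (w ord0 (coord1 i), w)) =
  \int[L]_w \int[mu]_x f (x, w).
Proof.
move=> bf fi; have bfi i : bounded_mfun (fun w : W => f (w ord0 (coord1 i), w)).
  exact: bounded_mfun_coord.
rewrite expectZ; last exact: bounded_mfun_sum.
rewrite expect_sum//; under eq_bigr do rewrite (expect_coord HL)//.
exact: mean_cst.
Qed.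

Let sqr_diff_le (u v : R) : `|u| <= 2 * F -> `|v| <= 2 * F -> `|u - v| <= delta ->
  u ^+ 2 <= v ^+ 2 + 4 * F * delta.
Proof.
move=> uF vF uv; rewrite -lerBlDl subr_sqr (le_trans (ler_norm _))// normrM.
rewrite mulrC ler_pM// (le_trans (ler_normD _ _))//; lra.
Qed.

Let centered_le x (u : R) : `|u| <= F -> `|u - f1 x| <= 2 * F.
Proof.
move=> uF; rewrite (le_trans (ler_normB _ _))// mulr_natl mulr2n lerD//.
by have /andP[f0 fF] := f1F x; rewrite ger0_norm.
Qed.

(** With [fh] in place of the center and the full noise in place of the truncated one, the identity
    [gain = (fh - f1)^2 - 2 noise (fh - fs) - (fs - f1)^2] gives equality in the first two terms.
    The other three are the costs of these replacements. *)
Lemma offset_ge_gain j x w : `|fh (x, w) - cs j x| <= delta ->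
  - offset (cs j) fs (x, w) <= 4 * gain (x, w) + 4 * (fs x - f1 x) ^+ 2 +
    16 * F * delta + 8 * delta * `|noise (x, w)| + 16 * F * excess (x, w).
Proof.
move=> fcd.
have h1 : (cs j x - f1 x) ^+ 2 <= (fh (x, w) - f1 x) ^+ 2 + 4 * F * delta.
  apply: sqr_diff_le; [exact: centered_le|exact: centered_le|].
  by rewrite opprB addrA subrK distrC.
have h2 : noise (x, w) * (fh (x, w) - cs j x) <= delta * `|noise (x, w)|.
  by rewrite (le_trans (ler_norm _))// normrM mulrC ler_wpM2r.
have h3 : (noise (x, w) - tnoise (x, w)) * (cs j x - fs x) <= 2 * F * excess (x, w).
  rewrite (le_trans (ler_norm _))// normrM mulrC ler_wpM2r//.
  by rewrite (le_trans (ler_normB _ _))// mulr_natl mulr2n lerD.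
move: h1 h2 h3; rewrite /gain /offset/=.
have -> : smooth (x, w) = noise (x, w) + f1 x by rewrite /noise subrK.
rewrite !expr2; lra.
Qed.

(** The center near the estimate depends on the data, hence the existential and, later, a maximum
    over the cover. In [20 F delta], 4 comes from exchanging estimator and center in the risk and 16
    from the offsets. *)
Lemma risk_le_deviation w : exists j,
  \int[mu]_x ((fh (x, w) - f1 x) ^+ 2) <= deviation (cs j) fs w +
    3 * \int[mu]_x ((fs x - f1 x) ^+ 2) + 32 * rho ^+ 2 + 20 * F * delta
    + 16 * F * \int[mu]_x excess (x, w)
    + n%:R^-1 * \sum_(i < n) (4 * gain (w ord0 (coord1 i), w) +
        4 * (fs (w ord0 (coord1 i)) - f1 (w ord0 (coord1 i))) ^+ 2 +
        8 * delta * `|noise (w ord0 (coord1 i), w)| +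
        16 * F * excess (w ord0 (coord1 i), w)).
Proof.
have [j fcd] := fhcs w; exists j.
have h1 : \int[mu]_x ((fh (x, w) - f1 x) ^+ 2) <=
    \int[mu]_x ((cs j x - f1 x) ^+ 2) + 4 * F * delta.
  rewrite -[X in _ + X](expect_cst mu) -expectD; last 2 first.
  - exact/bounded_mfunX/bounded_mfunB.
  - exact: bounded_mfun_cst.
  apply: expect_le => [||x].
  - by apply/bounded_mfunX/bounded_mfunB => //; exact: bounded_mfun_pair1.
  - by apply: bounded_mfunD; [exact/bounded_mfunX/bounded_mfunB|exact: bounded_mfun_cst].
  by apply: sqr_diff_le; rewrite ?centered_le// opprB addrA subrK.
have h2 : - (n%:R^-1 * \sum_(i < n) offset (cs j) fs (w ord0 (coord1 i), w)) <=
    n%:R^-1 * \sum_(i < n) (4 * gain (w ord0 (coord1 i), w) +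
        4 * (fs (w ord0 (coord1 i)) - f1 (w ord0 (coord1 i))) ^+ 2 +
        8 * delta * `|noise (w ord0 (coord1 i), w)| +
        16 * F * excess (w ord0 (coord1 i), w)) + 16 * F * delta.
  rewrite -[16 * F * delta]mean_cst.
  rewrite -mulrDr -big_split/= -mulrN ler_wpM2l ?invr_ge0//.
  rewrite -sumrN; apply: ler_sum => i _.
  by have := offset_ge_gain (fcd (w ord0 (coord1 i))); lra.
rewrite /deviation; move: h1 h2.
set A := n%:R^-1 * _; set B := n%:R^-1 * _; lra.
Qed.

(** The factor 7 is 3 from the centering of the deviation plus 4 from the offsets. The term
    [32 F / n] pays for the mean excess twice: in the centering and averaged over the X_i. *)
Lemma two_stage_bound :
  \int[L]_w \int[mu]_x ((fh (x, w) - f1 x) ^+ 2) <=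
  4 * \int[L]_w (n%:R^-1 * \sum_(i < n) gain (w ord0 (coord1 i), w))
  + 7 * \int[mu]_x ((fs x - f1 x) ^+ 2) + 32 * rho ^+ 2
  + ln m%:R / (tau * n%:R) + 32 * F / n%:R
  + (20 * F + 8 * (M1 + F)) * delta.
Proof.
have tn0 : 0 < tau * n%:R by rewrite mulr_gt0.
have m0 : 0 < m%:R :> R.
  by rewrite ltr0n; have [j _] := fhcs point; rewrite (leq_trans _ (ltn_ord j)).
set b := \int[mu]_x ((fs x - f1 x) ^+ 2).
pose g1 (w : W) := n%:R^-1 * \sum_(i < n) gain (w ord0 (coord1 i), w).
pose g2 (w : W) := n%:R^-1 * \sum_(i < n) (fs (w ord0 (coord1 i)) - f1 (w ord0 (coord1 i))) ^+ 2.
pose g3 (w : W) := n%:R^-1 * \sum_(i < n) `|noise (w ord0 (coord1 i), w)|.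
pose g4 (w : W) := n%:R^-1 * \sum_(i < n) excess (w ord0 (coord1 i), w).
pose g5 (w : W) := \int[mu]_x excess (x, w).
pose g6 (w : W) := \sum_(j < m) expR (tau * n%:R * deviation (cs j) fs w).
have bmean f : bounded_mfun f ->
    bounded_mfun (fun w : W => n%:R^-1 * \sum_(i < n) f (w ord0 (coord1 i), w)).
  by move=> bf; apply/bounded_mfunZ/bounded_mfun_sum => i; exact: bounded_mfun_coord.
have b1 : bounded_mfun g1 by apply: bmean; exact: bounded_mfun_gain.
have brs1 : bounded_mfun (fun p : T * W => (fs p.1 - f1 p.1) ^+ 2).
  apply: (bounded_mfun_comp (f := fun x => (fs x - f1 x) ^+ 2)) => //.
  exact/bounded_mfunX/bounded_mfunB.
have b2 : bounded_mfun g2 by exact: bmean brs1.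
have bn1 := bounded_mfun_norm bounded_mfun_noise.
have b3 : bounded_mfun g3 by exact: bmean bn1.
have b4 : bounded_mfun g4 by apply: bmean; exact: bounded_mfun_excess.
have b5 : bounded_mfun g5 by exact: bounded_mfun_mean_excess.
have b6 : bounded_mfun g6.
  apply: bounded_mfun_sum => j; apply/bounded_mfun_expR/bounded_mfunZ.
  exact: bounded_mfun_deviation.
have e2 : \int[L]_w g2 w = b.
  by rewrite (@expect_mean_coord1 (fun p => (fs p.1 - f1 p.1) ^+ 2))//= expect_cst.
have e3 : \int[L]_w g3 w <= M1 + F.
  rewrite (@expect_mean_coord1 (fun p => `|noise p|))//; first exact: expect_mean_noise.
  by move=> i x y w; rewrite noise_coord1.
have e5 := expect_mean_excess.
have e4 : \int[L]_w g4 w <= n%:R^-1.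
  rewrite (@expect_mean_coord1 excess)//; first exact: bounded_mfun_excess.
  by move=> i x y w; rewrite excess_coord1.
have e6 : \int[L]_w g6 w <= m%:R.
  rewrite expect_sum; last first.
    move=> j; apply/bounded_mfun_expR/bounded_mfunZ; exact: bounded_mfun_deviation.
  have -> : m%:R = \sum_(j < m) (1 : R) by rewrite sumr_const card_ord.
  by apply: ler_sum => j _; exact: expect_expR_deviation.
pose cst := 3 * b + 32 * rho ^+ 2 + 20 * F * delta + (ln m%:R - 1) / (tau * n%:R).
have key w : \int[mu]_x ((fh (x, w) - f1 x) ^+ 2) <=
    cst + ((tau * n%:R)^-1 * m%:R^-1 * g6 w + (16 * F * g5 w + (4 * g1 w +
      (4 * g2 w + (8 * delta * g3 w + 16 * F * g4 w))))).
  have [j hj] := risk_le_deviation w; apply: (le_trans hj).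
  have -> : n%:R^-1 * \sum_(i < n) (4 * gain (w ord0 (coord1 i), w) +
        4 * (fs (w ord0 (coord1 i)) - f1 (w ord0 (coord1 i))) ^+ 2 +
        8 * delta * `|noise (w ord0 (coord1 i), w)| +
        16 * F * excess (w ord0 (coord1 i), w)) =
      4 * g1 w + 4 * g2 w + 8 * delta * g3 w + 16 * F * g4 w.
    by rewrite 3!big_split/= -!mulr_sumr; rewrite /g1 /g2 /g3 /g4; ring.
  (* [z <= (exp (lambda z - theta) + theta - 1) / lambda] at [theta = ln m]
     turns the exponential moments into a bound for the maximum. *)
  have hz : deviation (cs j) fs w <=
      (tau * n%:R)^-1 * m%:R^-1 * g6 w + (ln m%:R - 1) / (tau * n%:R).
    set z := deviation _ _ _.
    have h := expR_ge1Dx (tau * n%:R * z - ln m%:R).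
    rewrite expRD expRN lnK ?posrE// in h.
    have h6 : expR (tau * n%:R * z) <= g6 w.
      rewrite /g6 (bigD1 j)//= lerDl sumr_ge0// => k _; exact: expR_ge0.
    have := ler_wpM2l (ltW m0 : 0 <= m%:R) h; rewrite mulrCA mulfV ?gt_eqF// mulr1 => {}h.
    have := le_trans h h6 => {}h.
    have h7 : 1 + (tau * n%:R * z - ln m%:R) <= m%:R^-1 * g6 w by rewrite ler_pdivlMl.
    have -> : z = (tau * n%:R)^-1 * (tau * n%:R * z) by rewrite mulKf// gt_eqF.
    have -> : (tau * n%:R)^-1 * m%:R^-1 * g6 w + (ln m%:R - 1) / (tau * n%:R) =
        (tau * n%:R)^-1 * (m%:R^-1 * g6 w + (ln m%:R - 1)) by ring.
    rewrite ler_wpM2l ?invr_ge0 ?(ltW tn0)//.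
    by move: h7; set y := _^-1 * _; lra.
  rewrite /cst /g5 -/b; set t1 := (tau * n%:R)^-1 * _ * _ in hz *.
  set t2 := _ / _ in hz *; lra.
have bG : bounded_mfun (fun w => \int[mu]_x ((fh (x, w) - f1 x) ^+ 2)).
  apply: (bounded_mfun_expect2 mu L (f := fun p => (fh p - f1 p.1) ^+ 2)).
  apply/bounded_mfunX/bounded_mfunB => //; exact: (bounded_mfun_comp bf1 measurable_fst).
have bc := @bounded_mfun_cst _ W R cst.
have z1 := bounded_mfunZ 4 b1; have z2 := bounded_mfunZ 4 b2.
have z3 := bounded_mfunZ (8 * delta) b3; have z4 := bounded_mfunZ (16 * F) b4.
have z5 := bounded_mfunZ (16 * F) b5.
have z6 := bounded_mfunZ ((tau * n%:R)^-1 * m%:R^-1) b6.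
have z34 := bounded_mfunD z3 z4; have z24 := bounded_mfunD z2 z34.
have z14 := bounded_mfunD z1 z24; have z15 := bounded_mfunD z5 z14.
have z16 := bounded_mfunD z6 z15.
apply: (le_trans (expect_le L bG (bounded_mfunD bc z16) key)).
rewrite expectD// expectD// expectD// expectD// expectD// expectD// expect_cst.
rewrite (expectZ L _ b1) (expectZ L _ b2) (expectZ L _ b3) (expectZ L _ b4).
rewrite (expectZ L _ b5) (expectZ L _ b6) e2 /cst -/g1 -/b.
(* The expected sum of exponentials is at most [m], so this term is at most [1 / (tau n)] and is
   cancelled by the [- 1] in [cst]. *)
have k6 : (tau * n%:R)^-1 * m%:R^-1 * \int[L]_w g6 w <= (tau * n%:R)^-1.
  by rewrite -mulrA ler_piMr ?invr_ge0 ?(ltW tn0)// ler_pdivrMl// mulr1.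
have k5 := ler_wpM2l (mulr_ge0 (ler0n _ 16) F0) e5.
have k4 := ler_wpM2l (mulr_ge0 (ler0n _ 16) F0) e4.
have k3 := ler_wpM2l (mulr_ge0 (ler0n _ 8) delta0) e3.
rewrite mulrBl mul1r; move: k6 k5 k4 k3; rewrite -/g5.
set t1 := (tau * n%:R)^-1 * _ * _; set t2 := \int[L]_w g5 w.
set t3 := ln _ / _; set t4 := _^-1; set t5 := n%:R^-1.
set t6 := \int[L]_w g1 w; set t7 := \int[L]_w g3 w; set t8 := \int[L]_w g4 w.
lra.
Qed.

End estimator.
End two_sample.

(** * The law of the sample *)

Section vector_law.
Context d (T : measurableType d) (R : realType).
Context dO (Omega : measurableType dO) (P : probability Omega R).
Variable I : finType.
Local Notation W := 'rV[T]_#|I|.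
Variable Z : I -> {RV P >-> T}.

Definition sample_vector (omega : Omega) : W := \row_j Z (enum_val j) omega.

Lemma measurable_sample_vector : measurable_fun setT sample_vector.
Proof.
apply: measurable_fun_rV => j.
have -> : (fun omega => sample_vector omega ord0 j) = Z (enum_val j).
  by apply/funext => omega; rewrite mxE.
exact: measurable_funP.
Qed.

HB.instance Definition _ :=
  isMeasurableFun.Build _ _ _ _ sample_vector measurable_sample_vector.

Definition box (B : 'I_#|I| -> set T) : set W := [set w | forall j, B j (w ord0 j)].

Definition boxes : set (set W) :=
  [set A | exists2 B : 'I_#|I| -> set T, (forall j, measurable (B j)) & A = box B].

Lemma measurable_box B : (forall j, measurable (B j)) -> measurable (box B).
Proof.
move=> mB; have -> : box B = \bigcap_(j in [set: 'I_#|I|])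
    [set w : W | B j (w ord0 j)].
  by apply/seteqP; split => [x Bx i _|x Bx i]; exact: Bx.
apply: fin_bigcap_measurable => // i _.
by rewrite -[X in measurable X]setTI; exact: measurable_coord.
Qed.

Lemma measurable_rV_boxes : measurable = <<s boxes >> :> set (set W).
Proof.
rewrite eqEsubset; split.
  apply: smallest_sub; first exact: smallest_sigma_algebra.
  move=> A; rewrite -bigcup_seq/= => -[i _ [B mB <-]].
  apply: sub_sigma_algebra; exists (fun j => if j == i then B else setT).
    by move=> j; case: ifP.
  apply/seteqP; split => [w [_ Bw] j|w /(_ i)]; rewrite /box/=.
    by case: eqP => // ->.
  by rewrite eqxx.
apply: smallest_sub; first exact: sigma_algebra_measurable.
by move=> _ [B mB ->]; exact: measurable_box.
Qed.

Lemma setI_closed_boxes : setI_closed boxes.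
Proof.
move=> _ _ [A mA ->] [B mB ->]; exists (fun j => A j `&` B j).
  by move=> j; exact: measurableI.
apply/seteqP; split => [w [Aw Bw] j|w ABw]; first by split.
by split => j; have [] := ABw j.
Qed.

Hypothesis indep : mutually_independent Z.

Section masked.
Variables (k : 'I_#|I|) (x0 : T).

(** Overwriting coordinate [k] by a constant keeps the type of the vector but removes its dependence
    on the [k]-th variable: it stands for the vector of all other observations. *)
Definition masked_vector (omega : Omega) : W := set_coord (sample_vector omega) k x0.

Lemma measurable_masked_vector : measurable_fun setT masked_vector.
Proof.
have h : measurable_fun setT (fun omega => (x0, sample_vector omega)).
  exact: (measurable_fun_pair (measurable_cst _) measurable_sample_vector).
exact: (measurableT_comp (measurable_set_coord k) h).
Qed.

HB.instance Definition _ :=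
  isMeasurableFun.Build _ _ _ _ masked_vector measurable_masked_vector.

Lemma independent_masked_box (A : set T) B : measurable A ->
  (forall j, measurable (B j)) ->
  P (Z (enum_val k) @^-1` A `&` masked_vector @^-1` box B) =
  (P (Z (enum_val k) @^-1` A) * P (masked_vector @^-1` box B))%E.
Proof.
move=> mA mB; have [Bx0|Bx0] := pselect (B k x0); last first.
  have -> : masked_vector @^-1` box B = set0.
    apply/seteqP; split => // omega /(_ k)/=.
    by rewrite /masked_vector set_coord_eq.
  by rewrite setI0 measure0 mule0.
(* [C S] puts [S] in place of the [k]-th side of the box; [S = setT] describes the masked event
   alone. *)
pose C (S : set T) i : set T := if i == enum_val k then S else B (enum_rank i).
have mC S : measurable S -> forall i, measurable (C S i).
  by move=> mS i; rewrite /C; case: ifP.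
have CE S : \bigcap_i (Z i @^-1` C S i) =
    Z (enum_val k) @^-1` S `&` masked_vector @^-1` box B.
  apply/seteqP; split => [omega Com|omega [Sk Bom] i _].
    split; first by have := Com (enum_val k) Logic.I; rewrite /C/= eqxx.
    move=> j; rewrite /masked_vector; have [->|jk] := eqVneq j k.
      by rewrite set_coord_eq.
    rewrite set_coord_neq// mxE; have := Com (enum_val j) Logic.I.
    by rewrite /C/= (inj_eq enum_val_inj) (negbTE jk) enum_valK.
  rewrite /C/=; case: eqVneq => [->//|ik].
  have := Bom (enum_rank i); rewrite /masked_vector set_coord_neq ?mxE ?enum_rankK//.
  by apply: contra ik => /eqP <-; rewrite enum_rankK.
rewrite -CE -[in RHS](setTI (masked_vector @^-1` _)) -(preimage_setT (Z (enum_val k))) -CE.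
rewrite !indep; [|exact: mC|exact: mC].
rewrite (bigD1 (enum_val k))//= [in RHS](bigD1 (enum_val k))//=.
rewrite /C eqxx preimage_setT probability_setT mul1e; congr (_ * _)%E.
by apply: eq_bigr => i ik; rewrite (negbTE ik).
Qed.

(** For fixed [A] both sides are finite measures in [B], and they agree on the boxes, a generating
    pi-system. *)
Lemma independent_masked (A : set T) (B : set W) : measurable A -> measurable B ->
  P (Z (enum_val k) @^-1` A `&` masked_vector @^-1` B) =
  (P (Z (enum_val k) @^-1` A) * P (masked_vector @^-1` B))%E.
Proof.
move=> mA mB.
have mZA : measurable (Z (enum_val k) @^-1` A).
  by rewrite -[X in measurable X]setTI; exact: measurable_funP.
have pf : (0 <= fine (P (Z (enum_val k) @^-1` A)))%R by rewrite fine_ge0.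
have fP : P (Z (enum_val k) @^-1` A) \is a fin_num by exact: fin_num_measure.
pose m1 := (pushforward (mrestr P mZA) masked_vector : {measure set W -> \bar R}).
pose m2 := (mscale (NngNum pf) (distribution P masked_vector) : {measure set W -> \bar R}).
rewrite setIC -(fineK fP) -[LHS]/(m1 measurable_masked_vector B) -[RHS]/(m2 B).
apply: (measure_unique boxes (fun=> setT)) => //.
- exact: measurable_rV_boxes.
- exact: setI_closed_boxes.
- by move=> _; exists (fun=> setT) => //; apply/seteqP; split.
- by rewrite bigcup_const//; exists 0%N.
- move=> _ [C mC ->]; rewrite /m1 /m2 /= /mscale /distribution /pushforward /mrestr/= setIC.
  by rewrite independent_masked_box// fineK.
- move=> _; rewrite /m1 /= /pushforward /mrestr preimage_setT setTI.
  by rewrite -ge0_fin_numE.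
Qed.

End masked.

Variable mu : probability T R.
Hypothesis Zmu : forall i A, measurable A -> distribution P (Z i) A = mu A.

(** The [k]-th variable and the masked vector have a product law, and the sample vector is a
    function of the two. Fubini integrates out the former first, and the redrawn vector again
    depends on the masked one only. *)
Lemma resampling_sample_vector : resampling (distribution P sample_vector) mu.
Proof.
move=> k f bf; pose x0 : T := point.
pose F (p : T * W) := f (set_coord p.2 k p.1).
have bF : bounded_mfun F by exact: (bounded_mfun_comp bf (measurable_set_coord k)).
pose pair omega := (Z (enum_val k) omega, masked_vector k x0 omega).
have mpair : measurable_fun setT pair.
  exact: (measurable_fun_pair (measurable_funP _) (measurable_masked_vector k x0)).
pose Q := (pushforward P pair : {measure set (T * W) -> \bar R}).
have QE X : measurable X ->
    (mu \x distribution P (masked_vector k x0))%E X = Q mpair X.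
  apply: product_measure_unique => A B mA mB.
  apply: etrans (independent_masked k x0 mA mB) _; congr (_ * _)%E.
  exact: Zmu.
have bFp : bounded_mfun (F \o pair) by exact: bounded_mfun_comp bF mpair.
have fE omega : f (sample_vector omega) = F (pair omega).
  rewrite /F /pair/= /masked_vector; congr f; apply/rowP => j.
  have [->|jk] := eqVneq j k; first by rewrite set_coord_eq mxE.
  by rewrite !set_coord_neq.
have FE omega x : f (set_coord (sample_vector omega) k x) = F (x, masked_vector k x0 omega).
  rewrite /F /= /masked_vector; congr f; apply/rowP => j.
  have [->|jk] := eqVneq j k; first by rewrite !set_coord_eq.
  by rewrite !set_coord_neq.
pose g w := \int[mu]_x f (set_coord w k x).
have bg : bounded_mfun g.
  exact: (bounded_mfun_expect2 mu (distribution P (masked_vector k x0)) bF).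
rewrite /Rintegral; congr fine.
rewrite integral_distribution; [|exact: (bounded_mfun_emeasurable bf)|]; last first.
  apply: (bounded_mfun_integrable P (f := f \o sample_vector)).
  exact: bounded_mfun_comp bf measurable_sample_vector.
rewrite [RHS]integral_distribution; [|exact: (bounded_mfun_emeasurable bg)|]; last first.
  apply: (bounded_mfun_integrable P (f := g \o sample_vector)).
  exact: bounded_mfun_comp bg measurable_sample_vector.
transitivity (\int[P]_omega (F (pair omega))%:E)%E.
  by apply: eq_integral => omega _ /=; rewrite fE.
transitivity (\int[Q mpair]_p (F p)%:E)%E.
  rewrite integral_pushforward//; first exact: (bounded_mfun_emeasurable bF).
  exact: (bounded_mfun_integrable P bFp).
transitivity (\int[mu \x distribution P (masked_vector k x0)]_p (F p)%:E)%E.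
  by apply: eq_measure_integral => A mA _; exact/esym/QE.
rewrite -integral21_prod_meas1; last exact: bounded_mfun_integrable_prod.
pose G w := \int[mu]_x F (x, w).
have bG : bounded_mfun G.
  exact: (bounded_mfun_expect2 mu (distribution P (masked_vector k x0)) bF).
transitivity (\int[distribution P (masked_vector k x0)]_w (G w)%:E)%E.
  apply: eq_integral => w _ /=; rewrite -fin_Rintegral//.
  exact: bounded_mfun_pair1.
rewrite integral_distribution; [|exact: (bounded_mfun_emeasurable bG)|]; last first.
  apply: (bounded_mfun_integrable P (f := G \o masked_vector k x0)).
  exact: bounded_mfun_comp bG (measurable_masked_vector k x0).
apply: eq_integral => omega _ /=; congr EFin.
by apply: eq_Rintegral => x _; rewrite FE.
Qed.

End vector_law.

(** * Integrals of products over R^n *)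

Section density.
Context d (T : measurableType d) (R : realType).
Variables (mu : probability T R) (m : {sigma_finite_measure set T -> \bar R}).
Variable p : T -> R.
Hypotheses (mp : measurable_fun setT p) (p0 : forall x, 0 <= p x).
Hypothesis mup : forall A, measurable A -> mu A = (\int[m]_(x in A) (p x)%:E)%E.

(** [p] agrees almost everywhere with the Radon-Nikodym derivative, whose change of variables
    handles signed [g] directly. *)
Lemma expect_density (g : T -> R) : bounded_mfun g ->
  (\int[mu]_x (g x)%:E = \int[m]_x (g x * p x)%:E)%E.
Proof.
move=> bg; have mpE : measurable_fun setT (EFin \o p) by exact/measurable_EFinP.
have dom : mu `<< m.
  apply/null_content_dominatesP => A mA mA0; rewrite mup//.
  by apply: null_set_integral => //; exact: measurable_funTS.
rewrite -(Radon_Nikodym_change_of_variables dom measurableT (bounded_mfun_integrable mu bg)).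
apply: ae_eq_integral => //.
- apply: emeasurable_funM; first exact: bounded_mfun_emeasurable.
  by apply: (measurable_int m); exact: Radon_Nikodym_integrable.
- by apply/measurable_EFinP/measurable_funM => //; case: bg.
have -> : (fun x => (g x * p x)%:E) = ((EFin \o g) \* (EFin \o p))%E.
  by apply/funext => x; rewrite /= EFinM.
apply: ae_eqe_mul2l; apply: integral_ae_eq => //.
  exact: Radon_Nikodym_integrable.
by move=> A _ mA; rewrite -Radon_Nikodym_integral//=; exact: mup.
Qed.

End density.

Section affine.
Context (R : realType).
Local Notation leb := (@lebesgue_measure R).

Lemma measurable_affine (c h : R) : measurable_fun setT (fun y : R => (y - c) / h).
Proof. by apply: measurable_funM => //; exact: measurable_funB. Qed.

(** The rescaled image measure gives half-open intervals their length, hence is Lebesgue measure. *)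
Lemma ge0_integral_affine (c h : R) (f : R -> \bar R) : 0 < h ->
  measurable_fun setT f -> (forall u, 0 <= f u)%E ->
  (\int[leb]_y f ((y - c) / h)%R = h%:E * \int[leb]_u f u)%E.
Proof.
move=> h0 mf f0; have hV0 : 0 <= h^-1 by rewrite invr_ge0 ltW.
pose phi (y : R) : measurableTypeR R := (y - c) / h.
have mphi : measurable_fun [set: measurableTypeR R] phi by exact: measurable_affine.
pose nu := (mscale (NngNum hV0) (pushforward leb phi) :
  {measure set (measurableTypeR R) -> \bar R}).
have lebE A : measurable A -> leb A = nu mphi A.
  apply: lebesgue_measure_unique => _ [[a b] _ <-] /=.
  change (leb `]a, b]%classic = ((h^-1)%:E * leb (phi @^-1` `]a, b]%classic))%E).
  have -> : phi @^-1` `]a, b]%classic = `](c + h * a), (c + h * b)]%classic.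
    apply/seteqP; split => y; rewrite /phi /= !in_itv/= ltr_pdivlMr// ler_pdivrMr//.
      by rewrite ltrBrDl lerBlDl [a * h]mulrC [b * h]mulrC.
    by rewrite ltrBrDl lerBlDl [a * h]mulrC [b * h]mulrC.
  rewrite !lebesgue_measure_itv/= !lte_fin ltrD2l ltr_pM2l//.
  case: ifP => _; last by rewrite mule0.
  by rewrite -!EFinB -EFinM; congr EFin; field; rewrite gt_eqF.
have -> : (\int[leb]_u f u = \int[nu mphi]_u f u)%E.
  by apply: eq_measure_integral => A mA _; exact: lebE.
rewrite ge0_integral_mscale//= ge0_integral_pushforward//= muleA -EFinM.
by rewrite mulfV ?gt_eqF// mul1e.
Qed.

Lemma integrable_affine (c h : R) (f : R -> R) : 0 < h ->
  leb.-integrable setT (EFin \o f) ->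
  leb.-integrable setT (fun y => (f ((y - c) / h))%:E).
Proof.
move=> h0 /integrableP[mf foo]; apply/integrableP; split.
  exact: measurableT_comp mf (measurable_affine c h).
rewrite (ge0_integral_affine c (f := fun u => `|(f u)%:E|%E))//.
  by rewrite lte_mul_pinfty// lee_fin ltW.
exact: measurableT_comp.
Qed.

Lemma Rintegral_affine (c h : R) (f : R -> R) : 0 < h ->
  leb.-integrable setT (EFin \o f) ->
  \int[leb]_y f ((y - c) / h) = h * \int[leb]_u f u.
Proof.
move=> h0 fi; have mf := measurable_int _ fi.
suff E : (\int[leb]_y (f ((y - c) / h))%:E = h%:E * \int[leb]_u (f u)%:E)%E.
  rewrite /Rintegral E fineM//; exact: integrable_fin_num.
rewrite integralE [in RHS]integralE muleBr//; last first.
  by apply: fin_num_adde_defr; exact: (integrable_pos_fin_num measurableT fi).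
rewrite -(@ge0_integral_affine c h (fun u => (EFin \o f)^\+ u)%E)//; last exact: measurable_funepos.
rewrite -(@ge0_integral_affine c h (fun u => (EFin \o f)^\- u)%E)//; last exact: measurable_funeneg.
congr (_ - _)%E.
  apply: eq_integral => y _.
  by rewrite !funeposE.
apply: eq_integral => y _.
by rewrite !funenegE.
Qed.

(** A scaled kernel is also integrated over its center, where its argument appears reflected. *)
Lemma Rintegral_opp (f : R -> R) : leb.-integrable setT (EFin \o f) ->
  (forall x, 0 <= f x) ->
  leb.-integrable setT (fun y => (f (- y))%:E) /\
  \int[leb]_y f (- y) = \int[leb]_u f u.
Proof.
move=> /integrableP[mf foo] f0.
have mN : measurable_fun [set: measurableTypeR R] (-%R : R -> measurableTypeR R).
  exact: measurable_funN.
pose nu := (pushforward leb (-%R : R -> measurableTypeR R) :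
  {measure set (measurableTypeR R) -> \bar R}).
have lebE : (\int[leb]_u (f u)%:E = \int[leb]_y (f (- y))%:E)%E.
  transitivity (\int[nu mN]_u (f u)%:E)%E.
    by apply: eq_measure_integral => A mA _; exact/esym/lebesgue_measureN.
  rewrite ge0_integral_pushforward//= => u _; by rewrite lee_fin.
have mfN : measurable_fun setT (fun y : R => (f (- y))%:E).
  exact: measurableT_comp mf mN.
split; last by rewrite /Rintegral lebE.
apply/integrableP; split => //; move: foo.
under eq_integral do rewrite /= ger0_norm//.
by under [X in _ -> (X < _)%E]eq_integral do rewrite /= ger0_norm//; rewrite lebE.
Qed.

End affine.

(** * Fubini and product integrands for Lebesgue measure on R^n *)

Section product_rV.
Context (R : realType).
Local Notation leb := (@lebesgue_measure R).
Local Notation lebn n := (@lebesgue_rV R n).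

Lemma integral_rV0 (f : 'rV[R]_0 -> \bar R) :
  measurable_fun setT f -> (\int[lebn 0]_y f y = f (0 : 'rV[R]_0)%R)%E.
Proof.
by move=> mf; rewrite /lebesgue_rV integral_dirac// diracT mul1e.
Qed.

Lemma ge0_integral_rVS n (f : 'rV[R]_n.+1 -> \bar R) :
  measurable_fun setT f -> (forall y, 0 <= f y)%E ->
  (\int[lebn n.+1]_y f y = \int[leb]_u \int[lebn n]_y f (cons_rV (u, y)))%E.
Proof.
move=> mf f0.
pose nu := (pushforward (leb \x lebn n)%E (@cons_rV R n) :
  {measure set 'rV[R]_n.+1 -> \bar R}).
have h : (\int[lebn n.+1]_y f y = \int[(leb \x lebn n)%E]_p f (cons_rV p))%E.
  transitivity (\int[nu (@measurable_cons_rV R n)]_y f y)%E.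
    apply: eq_measure_integral => A mA _.
    (* [lebesgue_rV n.+1] is this pushforward by definition. *)
    reflexivity.
  by rewrite ge0_integral_pushforward//; exact: measurable_cons_rV.
rewrite h fubini_tonelli1//.
exact: measurableT_comp mf (@measurable_cons_rV R n).
Qed.

Lemma integrable_rVS n (f : 'rV[R]_n.+1 -> \bar R) :
  (lebn n.+1).-integrable setT f ->
  (leb \x lebn n)%E.-integrable setT (f \o @cons_rV R n).
Proof.
move=> /integrableP[mf foo]; apply/integrableP; split.
  exact: measurableT_comp mf (@measurable_cons_rV R n).
move: foo; rewrite ge0_integral_rVS//; last exact: measurableT_comp.
rewrite fubini_tonelli1//.
exact: measurableT_comp (measurableT_comp mf (@measurable_cons_rV R n)).
Qed.

Lemma integral_rVS n (f : 'rV[R]_n.+1 -> \bar R) :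
  (lebn n.+1).-integrable setT f ->
  (\int[lebn n.+1]_y f y = \int[leb]_u \int[lebn n]_y f (cons_rV (u, y)))%E.
Proof.
move=> fi; have fc := integrable_rVS fi.
pose nu := (pushforward (leb \x lebn n)%E (@cons_rV R n) :
  {measure set 'rV[R]_n.+1 -> \bar R}).
have h : (\int[lebn n.+1]_y f y = \int[(leb \x lebn n)%E]_p f (cons_rV p))%E.
  transitivity (\int[nu (@measurable_cons_rV R n)]_y f y)%E.
    apply: eq_measure_integral => A mA _.
    reflexivity.
  rewrite integral_pushforward//; first exact: measurable_cons_rV.
  exact: (measurable_int _ fi).
by rewrite h -integral12_prod_meas1.
Qed.

Lemma cons_rV_prod n (k : 'I_n.+1 -> R -> R) (u : R) (y : 'rV[R]_n) :
  \prod_(r < n.+1) k r (cons_rV (u, y) ord0 r) =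
  k ord0 u * \prod_(r < n) k (lift ord0 r) (y ord0 r).
Proof.
by rewrite big_ord_recl cons_rV0; congr (_ * _); apply: eq_bigr => r _; rewrite cons_rVS.
Qed.

Lemma measurable_prod_rV n (k : 'I_n -> R -> R) :
  (forall r, measurable_fun setT (k r)) ->
  measurable_fun setT (fun y : 'rV[R]_n => \prod_(r < n) k r (y ord0 r)).
Proof.
move=> mk; apply: measurable_prod => r _.
exact: measurableT_comp (mk r) (measurable_coord r).
Qed.

Lemma ge0_integral_prod_rV n (k : 'I_n -> R -> R) :
  (forall r, measurable_fun setT (k r)) -> (forall r u, 0 <= k r u) ->
  (\int[lebn n]_y (\prod_(r < n) k r (y ord0 r))%:E =
   \prod_(r < n) \int[leb]_u (k r u)%:E)%E.
Proof.
elim: n k => [|n IH] k mk k0.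
  rewrite integral_rV0 ?big_ord0//; under eq_fun do rewrite big_ord0.
  exact: measurable_cst.
have p0 (y : 'rV[R]_n) : 0 <= \prod_(r < n) k (lift ord0 r) (y ord0 r) by apply: prodr_ge0.
rewrite ge0_integral_rVS//; last 2 first.
- by apply/measurable_EFinP; exact: (measurable_prod_rV (k := k)).
- by move=> y; rewrite lee_fin prodr_ge0.
under eq_integral => u _.
  under eq_integral do rewrite cons_rV_prod EFinM.
  rewrite ge0_integralZl_EFin//; last 2 first.
  - by move=> y _; rewrite lee_fin.
  - by apply/measurable_EFinP; exact: (measurable_prod_rV (k := fun r => k (lift ord0 r))).
  rewrite (IH (fun r => k (lift ord0 r)))//.
  over.
rewrite big_ord_recl ge0_integralZr//.
- by apply/measurable_EFinP; exact: (mk ord0).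
- by move=> u _; rewrite lee_fin.
- by apply: prode_ge0 => r _; apply: integral_ge0 => u _; rewrite lee_fin.
Qed.

End product_rV.

Section product_kernel.
Context (R : realType).
Local Notation leb := (@lebesgue_measure R).
Local Notation lebn n := (@lebesgue_rV R n).

Lemma integrable_prod_rV n (k : 'I_n -> R -> R) :
  (forall r, leb.-integrable setT (EFin \o k r)) ->
  (lebn n).-integrable setT (fun y => (\prod_(r < n) k r (y ord0 r))%:E).
Proof.
move=> ik; have mk r : measurable_fun setT (k r).
  by apply/measurable_EFinP; exact: (measurable_int _ (ik r)).
apply/integrableP; split.
  by apply/measurable_EFinP; exact: measurable_prod_rV.
under eq_integral do rewrite /= normr_prod.
rewrite (ge0_integral_prod_rV (k := fun r u => `|k r u|))//; last first.
  by move=> r; exact: measurableT_comp (mk r).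
rewrite ltey_eq; apply/orP; left.
elim/big_ind : _ => // [a b|r _]; first exact: fin_numM.
have i1 : leb.-integrable setT (fun u => (`|k r u|)%:E) := integrable_abse (ik r).
exact: integrable_fin_num i1.
Qed.

Lemma integrable_mul_bounded d (T : measurableType d)
    (m : {measure set T -> \bar R}) (k f : T -> R) :
  m.-integrable setT (EFin \o k) -> bounded_mfun f ->
  m.-integrable setT (fun x => (k x * f x)%:E).
Proof.
move=> ik [mf [M fM]]; have mk : measurable_fun setT k.
  by apply/measurable_EFinP; exact: (measurable_int _ ik).
apply: (le_integrable measurableT _ _ (integrableZl measurableT M ik)).
  by apply/measurable_EFinP/measurable_funM.
move=> x _ /=; rewrite lee_fin !normrM mulrC ler_wpM2r//.
by rewrite (le_trans (fM x))// ler_norm.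
Qed.

Lemma cons_rV_set_coordS n u (z : 'rV[R]_n) r v :
  cons_rV (u, set_coord z r v) = set_coord (cons_rV (u, z)) (lift ord0 r) v.
Proof.
apply/rowP => j; case: (unliftP ord0 j) => [i|] ->.
  rewrite cons_rVS/=; have [->|ir] := eqVneq i r; first by rewrite !set_coord_eq.
  by rewrite !set_coord_neq ?cons_rVS// (inj_eq lift_inj).
by rewrite set_coord_neq ?cons_rV0// neq_lift.
Qed.

Lemma cons_rV_set_coord0 n u (z : 'rV[R]_n.+1) :
  cons_rV (u, (uncons_rV z).2) = set_coord z ord0 u.
Proof.
apply/rowP => j; case: (unliftP ord0 j) => [i|] ->.
  by rewrite cons_rVS/= mxE set_coord_neq// eq_sym neq_lift.
by rewrite cons_rV0 set_coord_eq.
Qed.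

(* The hypothesis moves one coordinate at a time, so that mixed derivatives of
   [f] will not be needed. *)
Lemma product_kernel_bias n (k : 'I_n -> R -> R) (kap rho : R) (x : 'rV[R]_n)
    (f : 'rV[R]_n -> R) :
  (forall r, leb.-integrable setT (EFin \o k r)) ->
  (forall r, \int[leb]_u `|k r u| <= kap) -> 0 <= rho ->
  bounded_mfun f ->
  (forall r z, `|\int[leb]_u (k r u * f (set_coord z r u)) -
     f (set_coord z r (x ord0 r))| <= rho) ->
  `|\int[lebn n]_y (\prod_(r < n) k r (y ord0 r) * f y) - f x| <=
  rho * \sum_(j < n) kap ^+ j.
Proof.
move=> + + rho0; elim: n k x f => [|n IH] k x f ik kk bf fk.
  rewrite /Rintegral integral_rV0; last first.
    apply/measurable_EFinP/measurable_funM; last by case: bf.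
    by under eq_fun do rewrite big_ord0; exact: measurable_cst.
  by rewrite /= big_ord0 mul1r [x]thinmx0 subrr normr0 big_ord0 mulr0.
have kap0 : 0 <= kap by rewrite (le_trans _ (kk ord0))// Rintegral_ge0.
pose x' := (uncons_rV x).2; pose k' r := k (lift ord0 r).
pose p (y : 'rV[R]_n) := \prod_(r < n) k' r (y ord0 r).
pose J u := \int[lebn n]_y (p y * f (cons_rV (u, y))).
have ip : (lebn n).-integrable setT (EFin \o p) by apply: integrable_prod_rV => r; exact: ik.
have bfc u : bounded_mfun (fun y => f (cons_rV (u, y))).
  apply: (bounded_mfun_comp bf).
  exact: measurableT_comp (@measurable_cons_rV R n) (measurable_pair1 u).
have ipf u : (lebn n).-integrable setT (fun y => (p y * f (cons_rV (u, y)))%:E).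
  exact: integrable_mul_bounded ip (bfc u).
have iF : (lebn n.+1).-integrable setT
    (fun y => (\prod_(r < n.+1) k r (y ord0 r) * f y)%:E).
  exact: integrable_mul_bounded (integrable_prod_rV ik) bf.
have JE u : (\int[lebn n]_y
    (\prod_(r < n.+1) k r (cons_rV (u, y) ord0 r) * f (cons_rV (u, y)))%:E =
    (k ord0 u * J u)%:E)%E.
  under eq_integral do rewrite cons_rV_prod -mulrA EFinM.
  rewrite (integralZl measurableT (ipf u)) EFinM fineK//.
  exact: (integrable_fin_num measurableT (ipf u)).
have ikJ : leb.-integrable setT (fun u => (k ord0 u * J u)%:E).
  have := integrable_fubini_F (integrable_rVS iF); congr (leb.-integrable _ _).
  by apply/funext => u; rewrite -JE.
have IHu u : `|J u - f (cons_rV (u, x'))| <= rho * \sum_(j < n) kap ^+ j.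
  apply: (IH k' x' (fun y => f (cons_rV (u, y)))) => // [r|r|r z]; [exact: ik|exact: kk|].
  under eq_Rintegral do rewrite cons_rV_set_coordS.
  by rewrite cons_rV_set_coordS /x' mxE; exact: fk.
have -> : \int[lebn n.+1]_y (\prod_(r < n.+1) k r (y ord0 r) * f y) =
    \int[leb]_u (k ord0 u * J u).
  by rewrite /Rintegral integral_rVS//; congr fine; apply: eq_integral => u _; exact: JE.
have ikf : leb.-integrable setT (fun u => (k ord0 u * f (cons_rV (u, x')))%:E).
  apply: integrable_mul_bounded (ik ord0) _.
  apply: (bounded_mfun_comp bf).
  exact: measurableT_comp (@measurable_cons_rV R n) (measurable_pair2 x').
have h1 : `|\int[leb]_u (k ord0 u * f (cons_rV (u, x'))) - f x| <= rho.
  have E u : set_coord x ord0 u = cons_rV (u, x') by rewrite -cons_rV_set_coord0.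
  have E0 : cons_rV (x ord0 ord0, x') = x by rewrite -[RHS]uncons_rVK.
  apply: le_trans (fk ord0 x); rewrite le_eqVlt; apply/orP; left; apply/eqP.
  congr (`|_ - _|).
    by apply: eq_Rintegral => u _; congr (_ * f _); exact/esym/E.
  by congr f; rewrite -[LHS]E0; exact/esym/E.
(* The error of the inner integral is weighted by [|k ord0|], of mass at most [kap]. Adding the
   [rho] of the first coordinate continues the geometric sum. *)
have h2 : `|\int[leb]_u (k ord0 u * J u) - \int[leb]_u (k ord0 u * f (cons_rV (u, x')))| <=
    kap * (rho * \sum_(j < n) kap ^+ j).
  have iB : leb.-integrable setT
      (fun u => (k ord0 u * J u - k ord0 u * f (cons_rV (u, x')))%:E).
    exact: (integrableB measurableT ikJ ikf).
  rewrite -RintegralB//; apply: (le_trans (le_normr_Rintegral measurableT iB)).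
  set S := rho * _ in IHu *.
  have ik1 : leb.-integrable setT (fun u => (S * `|k ord0 u|)%:E).
    exact: (integrableZl measurableT S (integrable_abse (ik ord0))).
  apply: (@le_trans _ _ (\int[leb]_u (S * `|k ord0 u|))).
    apply: le_Rintegral => //; first exact: integrable_abse iB.
    by move=> u _; rewrite -mulrBr normrM mulrC ler_wpM2r.
  rewrite RintegralZl//; last exact: integrable_abse (ik ord0).
  rewrite mulrC ler_wpM2r//.
  by rewrite mulr_ge0// sumr_ge0// => j _; rewrite exprn_ge0.
rewrite big_ord_recl expr0 mulrDr mulr1.
have -> : rho * \sum_(i < n) kap ^+ lift ord0 i = kap * (rho * \sum_(j < n) kap ^+ j).
  by rewrite mulrCA; congr (_ * _); rewrite mulr_sumr; apply: eq_bigr => j _; rewrite -exprS.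
rewrite -(subrKA (\int[leb]_u (k ord0 u * f (cons_rV (u, x'))))).
by rewrite (le_trans (ler_normD _ _))// addrC lerD.
Qed.

End product_kernel.

(** * Hölder functions *)

Section taylor.
Context (R : realType).

Lemma mean_value_bound (f df : R -> R) (t B : R) :
  (forall x : R, is_derive x 1 f (df x)) ->
  (forall x, `|x| <= `|t| -> `|df x| <= B) -> `|f t - f 0| <= B * `|t|.
Proof.
move=> fdf dfB.
have cf (i : interval R) : {within [set` i], continuous f}.
  by apply: derivable_within_continuous => x _; exact: ex_derive.
have [t0|t0] := leP 0 t.
  have [c] := MVT_segment t0 (fun x _ => fdf x) (cf _).
  rewrite in_itv/= => /andP[c0 ct] ->.
  by rewrite normrM subr0 ler_wpM2r// dfB// !ger0_norm.
have [c] := MVT_segment (ltW t0) (fun x _ => fdf x) (cf _).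
rewrite in_itv/= => /andP[tc c0] E.
rewrite distrC E normrM sub0r normrN ler_wpM2r// dfB// ler0_norm// ltr0_norm//.
by rewrite lerN2.
Qed.

(** The polynomial is an antiderivative of the one for [f 1], so no formula for its coefficients is
    carried along. By the mean value theorem each integration multiplies the remainder by [|t|];
    factorials are dropped. *)
Lemma taylor_bound (s : nat) (f : nat -> R -> R) (Q alpha : R) :
  0 <= Q -> 0 <= alpha ->
  (forall k (t : R), (k < s)%N -> is_derive t 1 (f k) (f k.+1 t)) ->
  (forall t, `|f s t - f s 0| <= Q * `|t| `^ alpha) ->
  exists p : {poly R}, [/\ (size p <= s.+1)%N, p.[0] = f 0%N 0 &
    forall t, `|f 0%N t - p.[t]| <= Q * `|t| `^ alpha * `|t| ^+ s].
Proof.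
move=> Q0 alpha0; elim: s f => [|s IH] f fd fs.
  exists (f 0%N 0)%:P; split; first by rewrite size_polyC leq_b1.
    by rewrite hornerC.
  by move=> t; rewrite hornerC expr0 mulr1.
have [||q [sq q0 qf]] := IH (fun k => f k.+1) => [k t ks|//|].
  exact: fd.
pose p : {poly R} := \poly_(i < s.+2) (if i is j.+1 then q`_j / j.+1%:R else f 0%N 0).
have p'E : p^`() = q.
  apply/polyP => i; rewrite coef_deriv coef_poly ltnS.
  case: ltnP => [lt_i|le_i].
    by rewrite -[LHS]mulr_natr divfK// pnatr_eq0.
  by rewrite mul0rn nth_default// (leq_trans sq).
have p0 : p.[0] = f 0%N 0 by rewrite horner_coef0 coef_poly.
exists p; split => //; first exact: size_poly.
move=> t; pose D x := f 0%N x - p.[x].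
have dD (x : R) : is_derive x 1 D (f 1%N x - q.[x]).
  apply: is_deriveB; first exact: fd.
  apply: DeriveDef; first exact: derivable_horner.
  by rewrite -derive1E -derivE p'E.
have := mean_value_bound (t := t) (B := Q * `|t| `^ alpha * `|t| ^+ s) dD.
rewrite /D p0 subrr subr0 exprSr mulrA; apply => x xt.
rewrite (le_trans (qf x))// ler_pM// ?mulr_ge0 ?powR_ge0 ?exprn_ge0//.
  by rewrite ler_wpM2l// ge0_ler_powR// nnegrE.
by rewrite lerXn2r// nnegrE.
Qed.

End taylor.

Section coordinate_lines.
Context (R : realType) (d : nat).
Implicit Types (f : 'rV[R]_d -> R) (x : 'rV[R]_d).
Local Notation "''e_' i" := (delta_mx ord0 i : 'rV[R]_d)
  (at level 8, i at level 2, format "''e_' i").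

Lemma line_is_derive f i x (t : R) : derivable f (x + t *: 'e_i) 'e_i ->
  is_derive t 1 (fun u : R => f (x + u *: 'e_i)) (partial i f (x + t *: 'e_i)).
Proof.
move=> df; have E : (fun h : R => h^-1 *: (((fun u : R => f (x + u *: 'e_i)) \o shift t) (h *: 1)
      - f (x + t *: 'e_i))) =
    (fun h : R => h^-1 *: ((f \o shift (x + t *: 'e_i)) (h *: 'e_i) - f (x + t *: 'e_i))).
  apply/funext => h /=; congr (_ *: (f _ - _)).
  by rewrite scalerDl addrCA -[h *: 1]/(h * 1) mulr1.
by apply: DeriveDef; rewrite /derivable /derive ?E.
Qed.

Lemma set_coord_line x i (c u : R) :
  set_coord x i u = set_coord x i c + (u - c) *: 'e_i.
Proof.
apply/rowP => j; have [->|ji] := eqVneq j i.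
  by rewrite !(mxE, set_coord_eq) !eqxx mulr1 addrC subrK.
by rewrite !(mxE, set_coord_neq)// (negbTE ji) andbF mulr0 addr0.
Qed.

Lemma norm_delta_le (i : 'I_d) : `|'e_i| <= 1.
Proof.
rewrite -[leLHS]/(mx_norm _) mx_normrE; apply/bigmax_leP; split => // -[a b] _ /=.
by rewrite mxE; case: (_ && _); rewrite ?normr1 ?normr0.
Qed.

End coordinate_lines.

Section holder_ball_facts.
Context (R : realType) (d : nat) (beta Q : R) (f : 'rV[R]_d -> R).
Hypotheses (beta0 : 0 < beta) (fH : holder_ball beta Q f).
Local Notation s := (sfloor beta).
Local Notation "''e_' i" := (delta_mx ord0 i : 'rV[R]_d)
  (at level 8, i at level 2, format "''e_' i").

Lemma sfloor_lt : s%:R < beta.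
Proof. by rewrite sfloorP. Qed.

(** Multi-index of a pure derivative in direction [i]. The bias moves one coordinate at a time, so
    the Hölder norm enters through these alone. *)
Definition mi_single (i : 'I_d) (k : 'I_s.+1) : multi_index beta :=
  [ffun j => if j == i then k else ord0].

Lemma mpartial_single i k g : mpartial (mi_single i k) g = iter k (partial i) g.
Proof.
rewrite /mpartial; have : i \in enum 'I_d by rewrite mem_enum.
have : uniq (enum 'I_d) by exact: enum_uniq.
have nin l : i \notin l ->
    foldr (fun j : 'I_d => iter (mi_single i k j) (partial j)) g l = g.
  elim: l => //= j l IH; rewrite inE negb_or => /andP[ij /IH ->].
  by rewrite ffunE eq_sym (negbTE ij).
elim: (enum 'I_d) => //= j l IH /andP[jl ul]; rewrite inE => /predU1P[ij|il].
  by rewrite -ij in jl *; rewrite nin// ffunE eqxx.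
rewrite IH// ffunE; case: eqP => // ji.
by rewrite ji il in jl.
Qed.

Lemma mi_order_single i k : mi_order (mi_single i k) = k.
Proof.
rewrite /mi_order (bigD1 i)//= ffunE eqxx big1 ?addn0// => j ji.
by rewrite ffunE (negbTE ji).
Qed.

Lemma supnorm_ge0 (g : 'rV[R]_d -> R) : (0 <= supnorm setT g)%E.
Proof.
have : (`|g 0|%:E <= supnorm setT g)%E by apply: ereal_sup_ubound; exists 0.
by apply: le_trans; rewrite lee_fin.
Qed.

Hypothesis d0 : (0 < d)%N.

Lemma holder_seminorm_ge0 a (g : 'rV[R]_d -> R) : (0 <= holder_seminorm a g)%E.
Proof.
(* Two distinct points exist because [d > 0]; over an empty set the supremum would be [-oo]. *)
pose z : 'rV[R]_d * 'rV[R]_d := (const_mx 1, 0).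
have : ((`|g z.1 - g z.2| / `|z.1 - z.2| `^ a)%:E <= holder_seminorm a g)%E.
  apply: ereal_sup_ubound; exists z => //=; apply/eqP => /rowP/(_ (Ordinal d0)).
  by rewrite !mxE => /eqP; rewrite oner_eq0.
by apply: le_trans; rewrite lee_fin divr_ge0 ?powR_ge0.
Qed.

Lemma holder_ball_partial (g : multi_index beta) x :
  (mi_order g)%:R < beta -> `|mpartial g f x| <= Q.
Proof.
move=> gb; have [_ fQ] := fH; rewrite -lee_fin; apply: le_trans fQ.
rewrite /holder_norm; apply: (@le_trans _ _ (supnorm setT (mpartial g f))).
  by apply: ereal_sup_ubound; exists x.
rewrite (bigD1 g)//= -addeA leeDl// adde_ge0// sume_ge0// => ? _.
  exact: supnorm_ge0.
exact: holder_seminorm_ge0.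
Qed.

Lemma holder_ball_seminorm (g : multi_index beta) x y :
  mi_order g = s ->
  `|mpartial g f x - mpartial g f y| <= Q * `|x - y| `^ (beta - s%:R).
Proof.
move=> gs; have [<-|xy] := eqVneq x y.
  rewrite subrr normr0 mulr_ge0 ?powR_ge0//.
  by apply: le_trans (normr_ge0 (mpartial g f x)) (holder_ball_partial x _); rewrite gs sfloor_lt.
rewrite -ler_pdivrMr; last by apply: powR_gt0; rewrite normr_gt0 subr_eq0.
have [_ fQ] := fH; rewrite -lee_fin; apply: le_trans fQ.
rewrite /holder_norm.
apply: (@le_trans _ _ (holder_seminorm (beta - s%:R) (mpartial g f))).
  by apply: ereal_sup_ubound; exists (x, y).
rewrite [X in (_ + X)%E](bigD1 g) ?gs//= addeCA leeDl// adde_ge0// sume_ge0// => ? _.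
  exact: supnorm_ge0.
exact: holder_seminorm_ge0.
Qed.

Lemma holder_ball_bounded x : `|f x| <= Q.
Proof.
have := @holder_ball_partial (mi_single (Ordinal d0) ord0) x.
by rewrite mi_order_single mpartial_single; apply.
Qed.

Lemma iter_partial_seminorm i x y :
  `|iter s (partial i) f x - iter s (partial i) f y| <= Q * `|x - y| `^ (beta - s%:R).
Proof.
have := @holder_ball_seminorm (mi_single i ord_max) x y.
by rewrite mi_order_single mpartial_single; exact.
Qed.

Lemma iter_partial_derivable i k x : (k < s)%N ->
  derivable (iter k (partial i) f) x 'e_i.
Proof.
move=> ks; have [+ _] := fH => /(_ (nseq k i) i).
have -> : foldr partial f (nseq k i) = iter k (partial i) f by elim: k {ks} => //= k ->.
by apply; rewrite size_nseq sfloorP.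
Qed.

Lemma holder_taylor i x : exists p : {poly R}, [/\ (size p <= s.+1)%N, p.[0] = f x &
  forall t, `|f (x + t *: 'e_i) - p.[t]| <= Q * `|t| `^ (beta - s%:R) * `|t| ^+ s].
Proof.
have Q0 : 0 <= Q by rewrite (le_trans _ (holder_ball_bounded x)).
have al0 : 0 <= beta - s%:R by rewrite subr_ge0 ltW// sfloor_lt.
pose g k (t : R) := iter k (partial i) f (x + t *: 'e_i).
have := @taylor_bound R s g Q _ Q0 al0.
rewrite /g /= scale0r addr0; apply => [k t ks|t].
  by apply: line_is_derive; exact: iter_partial_derivable.
rewrite (le_trans (iter_partial_seminorm _ _ _))//.
rewrite ler_wpM2l// [x + _]addrC addrK ge0_ler_powR// ?nnegrE//.
by rewrite normrZ ler_piMr// norm_delta_le.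
Qed.

(** If [sfloor beta > 0], the partial derivative along the line exists; otherwise the seminorm
    bounds the increments of [f] itself. *)
Lemma holder_continuous_line i x (t : R) :
  {for t, continuous (fun u : R => f (x + u *: 'e_i))}.
Proof.
have [s0|s0] := posnP s; last first.
  apply/differentiable_continuous/derivable1_diffP.
  have := line_is_derive (@iter_partial_derivable i 0 (x + t *: 'e_i) s0).
  by case.
have b0 : 0 < beta - s%:R by rewrite subr_gt0 sfloor_lt.
have fb u : `|f (x + u *: 'e_i) - f (x + t *: 'e_i)| <= Q * `|u - t| `^ (beta - s%:R).
  have := iter_partial_seminorm i (x + u *: 'e_i) (x + t *: 'e_i).
  rewrite {1 2}s0/= => /le_trans; apply; rewrite ler_wpM2l//.
    by rewrite (le_trans _ (holder_ball_bounded x)).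
  rewrite ge0_ler_powR ?nnegrE ?(ltW b0)// opprD addrACA subrr add0r -scalerBl.
  by rewrite normrZ ler_piMr// norm_delta_le.
have Q0 : 0 <= Q by rewrite (le_trans _ (holder_ball_bounded x)).
apply/cvgrPdist_le => e e0 /=.
(* [Q + 1] in the denominator, since [Q] may be 0. *)
pose c := e / (Q + 1); have c0 : 0 < c by rewrite divr_gt0// ltr_wpDl.
near=> u; rewrite distrC (le_trans (fb u))//.
have : `|u - t| <= c `^ (beta - s%:R)^-1.
  rewrite distrC; near: u; apply/nbhs_ballP; exists (c `^ (beta - s%:R)^-1) => /=.
    exact: powR_gt0.
  by move=> u /ltW.
move=> /(ge0_ler_powR (ltW b0)); rewrite !nnegrE powR_ge0 normr_ge0 => /(_ isT isT).
rewrite -powRrM mulVf ?gt_eqF// powRr1 ?(ltW c0)// => /(ler_wpM2l Q0) /le_trans; apply.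
by rewrite /c mulrA ler_pdivrMr ?ltr_wpDl// mulrC ler_pM2l// lerDl.
Unshelve. all: end_near. Qed.

End holder_ball_facts.

(** * Measurability of separately continuous functions *)

Section separately_continuous.
Context (R : realType).

Lemma measurable_floor_level (k : nat) (z : int) :
  measurable [set u : R | Num.floor (k.+1%:R * u) = z].
Proof.
have -> : [set u : R | Num.floor (k.+1%:R * u) = z] =
    (fun u : R => k.+1%:R * u) @^-1` [set` `[z%:~R, (z + 1)%:~R[].
  apply/seteqP; split => u /=; rewrite in_itv/=.
    by move=> <-; exact: floor_itv.
  by move=> h; apply: floor_def.
have mf : measurable_fun setT (fun u : R => k.+1%:R * u) by exact: measurable_funM.
by rewrite -[X in measurable X]setTI; apply: mf.
Qed.

(** Rounding the first argument down to the grid of mesh [1 / (k + 1)] gives a function built from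
    countably many measurable slices; continuity in that argument makes these converge pointwise. *)
Lemma measurable_caratheodory d (T : measurableType d) (f : R * T -> R) :
  (forall u, measurable_fun setT (fun y => f (u, y))) ->
  (forall y, continuous (fun u => f (u, y))) -> measurable_fun setT f.
Proof.
move=> mf cf.
pose q k (u : R) : R := (Num.floor (k.+1%:R * u))%:~R / k.+1%:R.
apply: (@measurable_fun_cvg _ _ _ _ (fun k p => f (q k p.1, p.2))) => [k|[u y] _] /=.
  move=> _ B mB; rewrite setTI.
  have -> : (fun p : R * T => f (q k p.1, p.2)) @^-1` B =
      \bigcup_(z in [set: int]) ([set u | Num.floor (k.+1%:R * u) = z] `*`
        ((fun y => f (z%:~R / k.+1%:R, y)) @^-1` B)).
    apply/seteqP; split => [[u y] /= Bf|[u y] [z _ [/= <- //]]].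
    by exists (Num.floor (k.+1%:R * u)).
  apply: countable_bigcupT_measurable => [|z]; first exact: countableP.
  apply: measurableX.
    exact: measurable_floor_level.
  by rewrite -[X in measurable X]setTI; exact: mf.
suff qu : q k u @[k --> \oo] --> u by exact: (cvg_comp _ _ qu (cf y u)).
apply/cvgrPdist_le => e e0; near=> k.
have k0 : 0 < k.+1%:R :> R by rewrite ltr0n.
have /andP[h1 h2] := floor_itv (k.+1%:R * u).
have ke : k.+1%:R^-1 <= e.
  rewrite -[e]invrK lef_pV2 ?posrE ?invr_gt0//.
  rewrite (le_trans (ltW (truncnS_gt _)))// ler_nat ltnS.
  by near: k; exact: nbhs_infty_ge.
apply: le_trans ke; rewrite /q.
have -> : u - (Num.floor (k.+1%:R * u))%:~R / k.+1%:R =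
    (k.+1%:R * u - (Num.floor (k.+1%:R * u))%:~R) / k.+1%:R.
  by rewrite mulrBl mulrAC mulfV ?mul1r// gt_eqF.
rewrite normrM [`|_^-1|]gtr0_norm ?invr_gt0// ler_piMl// ?invr_ge0 ?ltW//.
rewrite ger0_norm ?subr_ge0// ltrBlDl.
by rewrite intrD mulr1z in h2.
Unshelve. all: end_near. Qed.

(* Functions with partial derivatives need not be continuous, but they are
   continuous along the coordinate lines. *)
Lemma measurable_separately_continuous n (f : 'rV[R]_n -> R) :
  (forall i x, continuous (fun u : R => f (set_coord x i u))) ->
  measurable_fun setT f.
Proof.
elim: n f => [|n IH] f cf.
  rewrite (_ : f = cst (f 0)); first exact: measurable_cst.
  by apply/funext => x; rewrite [x]thinmx0.
have -> : f = (f \o @cons_rV R n) \o @uncons_rV R n.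
  by apply/funext => x /=; rewrite uncons_rVK.
apply: measurableT_comp; last exact: measurable_uncons_rV.
apply: measurable_caratheodory => [u|y] /=.
  apply: IH => i x; rewrite (_ : (fun _ => _) =
    (fun v => f (set_coord (cons_rV (u, x)) (lift ord0 i) v))); first exact: cf.
  by apply/funext => v /=; rewrite cons_rV_set_coordS.
rewrite (_ : (fun _ => _) = (fun u => f (set_coord (cons_rV (0, y)) ord0 u))); first exact: cf.
by apply/funext => u; rewrite -cons_rV_set_coord0 cons_rVK.
Qed.

End separately_continuous.

Section holder_measurable.
Context (R : realType) (d : nat) (beta Q : R) (f : 'rV[R]_d -> R).
Hypotheses (beta0 : 0 < beta) (fH : holder_ball beta Q f) (d0 : (0 < d)%N).

Lemma holder_ball_bounded_mfun : bounded_mfun f.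
Proof.
split; last by exists Q => x; exact: (holder_ball_bounded beta0 fH).
apply: measurable_separately_continuous => i x t.
rewrite (_ : (fun _ => _) =
  (fun u : R => f (set_coord x i 0 + u *: delta_mx ord0 i))); last first.
  by apply/funext => u; rewrite (set_coord_line x i 0) subr0.
exact: (holder_continuous_line beta0 fH).
Qed.

End holder_measurable.

(** * Kernels *)

Lemma fsupport_eq0 (R : realType) (T : topologicalType) (f : T -> R) (A : set T) x :
  fsupport f `<=` A -> ~ A x -> f x = 0.
Proof.
move=> fA Ax; apply: contrapT => /eqP fx; apply: Ax; apply: fA.
exact: subset_closure.
Qed.

Section kernel_bias.
Context (R : realType).
Local Notation leb := (@lebesgue_measure R).
Local Notation lebn n := (@lebesgue_rV R n).
Variable K : R -> R.
Hypothesis iK : leb.-integrable setT (EFin \o K).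

Definition kernel_mass : R := \int[leb]_u `|K u|.

Definition scaled_kernel (h c u : R) : R := h^-1 * K ((u - c) / h).

Let mK : measurable_fun setT K.
Proof. by apply/measurable_EFinP; exact: (measurable_int _ iK). Qed.

Lemma kernel_mass_ge0 : 0 <= kernel_mass.
Proof. exact: Rintegral_ge0. Qed.

Lemma integrable_scaled_kernel h c : 0 < h ->
  leb.-integrable setT (EFin \o scaled_kernel h c).
Proof.
move=> h0.
exact: (integrableZl measurableT h^-1 (integrable_affine c h0 iK)).
Qed.

Lemma norm_scaled_kernel h c u : 0 < h ->
  `|scaled_kernel h c u| = h^-1 * `|K ((u - c) / h)|.
Proof. by move=> h0; rewrite normrM gtr0_norm ?invr_gt0. Qed.

Lemma scaled_kernel_mass h c : 0 < h ->
  \int[leb]_u `|scaled_kernel h c u| = kernel_mass.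
Proof.
move=> h0; have iaK : leb.-integrable setT (EFin \o (fun u => `|K u|)).
  exact: integrable_abse iK.
under eq_Rintegral do rewrite norm_scaled_kernel//.
rewrite RintegralZl//; last exact: (integrable_affine c h0 iaK).
rewrite (Rintegral_affine c (f := fun u => `|K u|) h0 iaK) mulKf// gt_eqF//.
Qed.

Lemma scaled_kernel_mass_center h u : 0 < h ->
  leb.-integrable setT (fun c => `|scaled_kernel h c u|%:E) /\
  \int[leb]_c `|scaled_kernel h c u| = kernel_mass.
Proof.
move=> h0; have iaK : leb.-integrable setT (EFin \o (fun u => `|K u|)).
  exact: integrable_abse iK.
have [iN eN] := Rintegral_opp iaK (fun u => normr_ge0 (K u)).
have E c : `|scaled_kernel h c u| = h^-1 * `|K (- ((c - u) / h))|.
  by rewrite norm_scaled_kernel// -mulNr opprB.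
have iA := integrable_affine u h0 iN.
split.
  rewrite (_ : (fun c => _) = (fun c => (h^-1)%:E * `|K (- ((c - u) / h))|%:E)%E).
    exact: (integrableZl measurableT h^-1 iA).
  by apply/funext => c; rewrite E EFinM.
under eq_Rintegral do rewrite E.
rewrite RintegralZl// (Rintegral_affine u (f := fun v => `|K (- v)|) h0 iN).
by rewrite eN mulKf// gt_eqF.
Qed.

Variables (d : nat) (beta Q : R) (f : 'rV[R]_d -> R).
Hypotheses (beta0 : 0 < beta) (fH : holder_ball beta Q f) (d0 : (0 < d)%N).
Hypothesis orderK : kernel_of_order (sfloor beta) K.
Hypothesis suppK : fsupport K `<=` `[-1, 1]%classic.
Local Notation s := (sfloor beta).

Lemma kernel_out u : 1 < `|u| -> K u = 0.
Proof.
move=> u1; apply: (fsupport_eq0 suppK).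
by rewrite /= in_itv/= -ler_norml leNgt u1.
Qed.

Lemma kernel_moment_integrable l : (l <= s)%N ->
  leb.-integrable setT (fun u => (u ^+ l * K u)%:E).
Proof.
case: l => [_|l ls]; last by have [_ /(_ l.+1) []] := orderK.
by under eq_fun do rewrite expr0 mul1r.
Qed.

Lemma kernel_moment l : (l <= s)%N ->
  \int[leb]_u (u ^+ l * K u) = (l == 0%N)%:R.
Proof.
case: l => [_|l ls]; last first.
  by have [_ /(_ l.+1) []// _ e _] := orderK; rewrite /Rintegral e.
have [[_ e] _ _] := orderK.
by under eq_Rintegral do rewrite expr0 mul1r; rewrite /Rintegral e.
Qed.

Lemma kernel_moment_sum (c : nat -> R) n : (n <= s.+1)%N ->
  leb.-integrable setT (fun u => (\sum_(l < n) c l * (u ^+ l * K u))%:E) /\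
  \int[leb]_u (\sum_(l < n) c l * (u ^+ l * K u)) = \sum_(l < n) c l * (l == 0%N :> nat)%:R.
Proof.
elim: n => [_|n IH ns].
  under eq_fun do rewrite big_ord0; under eq_Rintegral do rewrite big_ord0.
  by rewrite big_ord0 Rintegral_cst// mul0r; split => //; exact: integrable0.
have [iS eS] := IH (ltnW ns); have iM := kernel_moment_integrable ns.
have iZ := integrableZl measurableT (c n) iM.
under eq_fun do rewrite big_ord_recr/=; split.
  exact: (integrableD measurableT iS iZ).
under eq_Rintegral do rewrite big_ord_recr/=.
by rewrite RintegralD// RintegralZl// kernel_moment// eS big_ord_recr.
Qed.

(** The vanishing moments leave only the constant coefficient. *)
Lemma kernel_poly (p : {poly R}) (h : R) : (size p <= s.+1)%N ->
  leb.-integrable setT (fun u => (K u * p.[h * u])%:E) /\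
  \int[leb]_u (K u * p.[h * u]) = p.[0].
Proof.
move=> sp; have [iS eS] := kernel_moment_sum (fun l => p`_l * h ^+ l) (leqnn _).
have E u : K u * p.[h * u] = \sum_(l < s.+1) p`_l * h ^+ l * (u ^+ l * K u).
  rewrite (horner_coef_wide _ sp) mulr_sumr; apply: eq_bigr => l _.
  by rewrite exprMn; ring.
under eq_fun do rewrite E; under eq_Rintegral do rewrite E; split => //.
rewrite eS big_ord_recl expr0 !mulr1 big1 ?addr0 ?horner_coef0// => l _.
by rewrite mulr0.
Qed.

(** After the substitution [u = c + h v] the kernel reproduces the Taylor polynomial exactly. The
    remainder at [h v] is at most [Q h^beta], because the kernel lives on [|v| <= 1]. *)
Lemma kernel_line_bias h z r c : 0 < h ->
  `|\int[leb]_u (scaled_kernel h c u * f (set_coord z r u)) - f (set_coord z r c)|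
  <= Q * kernel_mass * h `^ beta.
Proof.
move=> h0; set x := set_coord z r c; pose e : 'rV[R]_d := delta_mx ord0 r.
have [p [sp p0 fp]] := holder_taylor beta0 fH d0 r x.
have bf := holder_ball_bounded_mfun beta0 fH d0.
have bfl : bounded_mfun (fun u : R => f (x + (h * u) *: e)).
  apply: (bounded_mfun_comp bf); apply: measurable_fun_rV => j.
  under eq_fun do rewrite !mxE.
  by apply: measurable_funD => //; do 2 apply: measurable_funM => //.
have iKf := integrable_mul_bounded iK bfl.
have [iKp eKp] := kernel_poly h sp.
have -> : \int[leb]_u (scaled_kernel h c u * f (set_coord z r u)) =
    \int[leb]_v (K v * f (x + (h * v) *: e)).
  transitivity (\int[leb]_u (h^-1 * (K ((u - c) / h) * f (x + (h * ((u - c) / h)) *: e)))).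
    apply: eq_Rintegral => u _; rewrite /scaled_kernel -mulrA (set_coord_line z r c).
    congr (_ * (_ * f (_ + _ *: _))).
    by rewrite [RHS]mulrC divfK// gt_eqF.
  rewrite RintegralZl//; last exact: (integrable_affine c h0 iKf).
  rewrite (Rintegral_affine c (f := fun v => K v * f (x + (h * v) *: e)) h0 iKf).
  by rewrite mulKf// gt_eqF.
rewrite -p0 -eKp -RintegralB//.
have iB : leb.-integrable setT
    (fun u => (K u * f (x + (h * u) *: e) - K u * p.[h * u])%:E).
  exact: (integrableB measurableT iKf iKp).
apply: (le_trans (le_normr_Rintegral measurableT iB)).
have iQ := integrableZl measurableT (Q * h `^ beta) (integrable_abse iK).
have -> : Q * kernel_mass * h `^ beta = \int[leb]_u (Q * h `^ beta * `|K u|).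
  rewrite RintegralZl//; last exact: (integrable_abse iK).
  by rewrite -/kernel_mass mulrAC.
apply: le_Rintegral => // [|u _]; first exact: integrable_abse iB.
rewrite -mulrBr normrM mulrC.
have [u1|u1] := leP `|u| 1; last by rewrite (kernel_out u1) normr0 !mulr0.
rewrite ler_wpM2r// (le_trans (fp _))// -mulrA.
have Q0 : 0 <= Q by rewrite (le_trans _ (holder_ball_bounded beta0 fH d0 0)).
rewrite ler_wpM2l// normrM (gtr0_norm h0).
have hu : h * `|u| <= h by rewrite ler_piMr// ltW.
have sb : 0 <= beta - s%:R by rewrite subr_ge0 ltW// sfloor_lt.
have h0' := ltW h0.
apply: (@le_trans _ _ (h `^ (beta - s%:R) * h ^+ s)).
  rewrite ler_pM ?powR_ge0 ?exprn_ge0 ?mulr_ge0//.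
    by rewrite ge0_ler_powR ?nnegrE ?mulr_ge0.
  by rewrite lerXn2r// nnegrE ?mulr_ge0.
by rewrite -powR_mulrn// -powRD ?subrK//; apply/implyP => _; rewrite gt_eqF.
Qed.

End kernel_bias.

(** * Mass and bias of the product kernel under a bounded density *)

Section product_kernel_density.
Context (R : realType).
Local Notation leb := (@lebesgue_measure R).
Local Notation lebn n := (@lebesgue_rV R n).
Variables (d : nat) (K : R -> R) (Kinf h : R).
Hypothesis iK : leb.-integrable setT (EFin \o K).
Hypotheses (KKinf : forall u, `|K u| <= Kinf) (h0 : 0 < h).

Definition product_kernel (p : 'rV[R]_d * 'rV[R]_d) : R :=
  \prod_(r < d) scaled_kernel K h (p.2 ord0 r) (p.1 ord0 r).

Let mK : measurable_fun setT K.
Proof. by apply/measurable_EFinP; exact: (measurable_int _ iK). Qed.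

Lemma product_kernelE y x : product_kernel (y, x) =
  (h ^+ d)^-1 * \prod_(r < d) K ((y ord0 r - x ord0 r) / h).
Proof.
rewrite /product_kernel /scaled_kernel big_split/= prodr_const card_ord.
by rewrite exprVn.
Qed.

Lemma product_kernel_le p : h ^+ d * `|product_kernel p| <= Kinf ^+ d.
Proof.
case: p => y x; rewrite product_kernelE normrM normfV (gtr0_norm (exprn_gt0 _ h0)).
rewrite mulVKf ?gt_eqF ?exprn_gt0// normr_prod.
rewrite -[X in _ <= _ ^+ X]card_ord -prodr_const.
by apply: ler_prod => r _; rewrite normr_ge0 KKinf.
Qed.

Lemma bounded_mfun_product_kernel : bounded_mfun product_kernel.
Proof.
split; last first.
  exists ((h ^+ d)^-1 * Kinf ^+ d) => p.
  by rewrite ler_pdivlMl ?exprn_gt0// product_kernel_le.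
apply: measurable_prod => r _; apply: measurable_funM => //.
apply: measurableT_comp mK _; apply: measurable_funM => //.
apply: measurable_funB.
  exact: measurableT_comp (measurable_coord r) measurable_fst.
exact: measurableT_comp (measurable_coord r) measurable_snd.
Qed.

Variables (beta Q F : R) (f : 'rV[R]_d -> R) (mu : probability 'rV[R]_d R).
Hypotheses (d0 : (0 < d)%N) (beta0 : 0 < beta) (fH : holder_ball beta Q f).
Hypotheses (f0 : forall x, 0 <= f x) (QF : Q <= F).
Hypothesis muf : forall A, measurable A ->
  mu A = (\int[lebn d]_(x in A) (f x)%:E)%E.

Let bf : bounded_mfun f := holder_ball_bounded_mfun beta0 fH d0.

Let fF x : f x <= F.
Proof.
by rewrite (le_trans (ler_norm _))// (le_trans (holder_ball_bounded beta0 fH d0 x)).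
Qed.

Let km := kernel_mass K.

(** Bounding the density by [F] leaves a Lebesgue integral, which factorizes. It serves both
    variables of the product kernel. *)
Lemma expect_norm_le_lebesgue (k : 'I_d -> R -> R) :
  bounded_mfun (fun y : 'rV[R]_d => \prod_(r < d) k r (y ord0 r)) ->
  (forall r, measurable_fun setT (k r)) -> (forall r u, 0 <= k r u) ->
  (forall r, (\int[leb]_u (k r u)%:E = km%:E)%E) ->
  \int[mu]_y (\prod_(r < d) k r (y ord0 r)) <= F * km ^+ d.
Proof.
move=> bk mk k0 kk; rewrite -lee_fin -fin_Rintegral//.
have p0 (y : 'rV[R]_d) : 0 <= \prod_(r < d) k r (y ord0 r) by exact: prodr_ge0.
have F0 : 0 <= F by rewrite (le_trans (f0 0)).
have mp : measurable_fun setT (fun y : 'rV[R]_d => \prod_(r < d) k r (y ord0 r)).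
  exact: measurable_prod_rV.
rewrite (expect_density bf.1 muf bk).
apply: (@le_trans _ _ (\int[lebn d]_y (F%:E * (\prod_(r < d) k r (y ord0 r))%:E))%E).
  apply: ge0_le_integral => //.
  - by move=> y _; rewrite lee_fin mulr_ge0.
  - by apply/measurable_EFinP/measurable_funM => //; case: bf.
  - by apply: measurable_funeM; exact/measurable_EFinP.
  - by move=> y _; rewrite -EFinM lee_fin mulrC ler_wpM2r.
rewrite ge0_integralZl_EFin//; [|by move=> y _; rewrite lee_fin|exact/measurable_EFinP].
rewrite ge0_integral_prod_rV//; under eq_bigr do rewrite kk.
by rewrite prodEFin -EFinM prodr_const card_ord.
Qed.

Lemma product_kernel_mass1 x : \int[mu]_y `|product_kernel (y, x)| <= F * km ^+ d.
Proof.
pose k r u := `|scaled_kernel K h (x ord0 r) u|.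
have E y : `|product_kernel (y, x)| = \prod_(r < d) k r (y ord0 r) by rewrite normr_prod.
under eq_Rintegral do rewrite E; apply: expect_norm_le_lebesgue => //.
- under eq_fun do rewrite -E.
  exact/bounded_mfun_norm/bounded_mfun_pair1/bounded_mfun_product_kernel.
- move=> r; apply: measurableT_comp => //; apply/measurable_EFinP.
  exact: (measurable_int _ (integrable_scaled_kernel iK _ h0)).
- by move=> r u; exact: normr_ge0.
- move=> r; rewrite /km -(scaled_kernel_mass iK (x ord0 r) h0) fineK//.
  have i1 : leb.-integrable setT (fun u => `|scaled_kernel K h (x ord0 r) u|%:E).
    exact: integrable_abse (integrable_scaled_kernel iK _ h0).
  exact: integrable_fin_num i1.
Qed.

Lemma product_kernel_mass2 y : \int[mu]_x `|product_kernel (y, x)| <= F * km ^+ d.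
Proof.
pose k r u := `|scaled_kernel K h u (y ord0 r)|.
have E x : `|product_kernel (y, x)| = \prod_(r < d) k r (x ord0 r) by rewrite normr_prod.
under eq_Rintegral do rewrite E; apply: expect_norm_le_lebesgue => //.
- under eq_fun do rewrite -E.
  exact/bounded_mfun_norm/bounded_mfun_pair2/bounded_mfun_product_kernel.
- move=> r; apply/measurable_EFinP.
  exact: (measurable_int _ (scaled_kernel_mass_center iK (y ord0 r) h0).1).
- by move=> r u; exact: normr_ge0.
- move=> r; have [i1 e1] := scaled_kernel_mass_center iK (y ord0 r) h0.
  by rewrite /km -e1 fineK//; exact: integrable_fin_num i1.
Qed.

Hypothesis orderK : kernel_of_order (sfloor beta) K.
Hypothesis suppK : fsupport K `<=` `[-1, 1]%classic.

Lemma product_kernel_bias_mu x : `|\int[mu]_y product_kernel (y, x) - f x| <=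
  Q * km * h `^ beta * \sum_(j < d) km ^+ j.
Proof.
have Q0 : 0 <= Q by rewrite (le_trans _ (holder_ball_bounded beta0 fH d0 0)).
have -> : \int[mu]_y product_kernel (y, x) =
    \int[lebn d]_y (\prod_(r < d) scaled_kernel K h (x ord0 r) (y ord0 r) * f y).
  rewrite /Rintegral (expect_density bf.1 muf)//.
  exact/bounded_mfun_pair1/bounded_mfun_product_kernel.
apply: (product_kernel_bias (k := fun r => scaled_kernel K h (x ord0 r))) => //.
- by move=> r; exact: integrable_scaled_kernel.
- by move=> r; rewrite scaled_kernel_mass.
- by rewrite !mulr_ge0 ?powR_ge0 ?kernel_mass_ge0.
- by move=> r z; exact: kernel_line_bias.
Qed.

End product_kernel_density.

(** * The density estimation model *)

Lemma ln_ge1 (R : realType) n : (3 <= n)%N -> 1 <= ln n%:R :> R.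
Proof.
move=> n3; have n0 : (0 : R) < n%:R by rewrite ltr0n (leq_trans _ n3).
rewrite -ler_expR lnK ?posrE// (@le_trans _ _ 3)//; last by rewrite ler_nat.
(* This amounts to [exp 1 <= 3]; the eighth power is the approximation of [exp (-1)] used, and it
   lies just above [1/3]. *)
have h : (1 - 8^-1) ^+ 8 <= expR (-1) :> R.
  have -> : -1 = 8%:R * (- 8^-1) :> R by field.
  rewrite expRM_natl lerXn2r// ?nnegrE ?expR_ge0//; first lra.
  by rewrite (le_trans _ (expR_ge1Dx _)).
have h3 : 3^-1 <= (1 - 8^-1) ^+ 8 :> R by lra.
by rewrite -[leLHS]invrK -expRN invf_ple ?posrE ?invr_gt0 ?expR_gt0// (le_trans h3).
Qed.

Section le_integral_ge0.
Import HBNNSimple.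

(* [g] need not be measurable: the integral of a nonnegative function is a supremum
   over the simple functions below it. *)
Lemma le_integral_ge0 d (T : measurableType d) (R : realType)
    (mu : probability T R) (f g : T -> R) : bounded_mfun f ->
  (forall x, 0 <= g x) -> (forall x, f x <= g x) ->
  (\int[mu]_x (f x)%:E <= \int[mu]_x (g x)%:E)%E.
Proof.
move=> bf g0 fg; pose fp x := Num.max (f x) 0.
have bfp : bounded_mfun fp.
  apply: (bounded_mfun_le _ bf) => [|x].
    exact: measurable_maxr bf.1 (measurable_cst _).
  by rewrite /fp; case: (leP (f x) 0); rewrite ?normr0 ?normr_ge0 ?lexx.
apply: (@le_trans _ _ (\int[mu]_x (fp x)%:E)%E).
  by rewrite !fin_Rintegral// lee_fin expect_le// => x; rewrite le_max lexx.
have fp0 x : 0 <= fp x by rewrite le_max lexx orbT.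
rewrite !ge0_integralTE//.
apply: ereal_sup_le => _ [k kfp <-]; exists k => // x /=.
by rewrite (le_trans (kfp x))// lee_fin ge_max fg g0.
Qed.

End le_integral_ge0.

Lemma measurable_cube (R : realType) d : measurable (@cube R d).
Proof.
have -> : @cube R d = \bigcap_(i in [set: 'I_d])
    ((fun x : 'rV[R]_d => x ord0 i) @^-1` `[0, 1]%classic).
  by apply/seteqP; split => x xc i; have := xc i; rewrite /= in_itv/=; exact.
apply: fin_bigcap_measurable => // i _; rewrite -[X in measurable X]setTI.
by apply: measurable_coord => //; exact: measurable_itv.
Qed.

Lemma le_supnorm (R : realType) (T : Type) (D : set T) (f : T -> R) (M : R) x :
  (supnorm D f <= M%:E)%E -> D x -> `|f x| <= M.
Proof.
move=> fM Dx; rewrite -lee_fin (le_trans _ fM)//.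
by apply: ereal_sup_ubound; exists x.
Qed.

Lemma integral_law d d' (Omega : measurableType d) (T : measurableType d')
    (R : realType) (P : probability Omega R) (Z : {RV P >-> T}) (G : T -> R) :
  bounded_mfun G ->
  (\int[P]_omega (G (Z omega))%:E)%E = (\int[distribution P Z]_w G w)%:E.
Proof.
move=> bG; rewrite -fin_Rintegral// integral_distribution//.
  exact: bounded_mfun_emeasurable.
apply: (bounded_mfun_integrable P (f := G \o Z)).
exact: bounded_mfun_comp bG (measurable_funP Z).
Qed.

Section restriction_to_cube.
Context (R : realType) (d : nat).
Implicit Types f : 'rV[R]_d -> R.

(** Members of the class are controlled on the cube only. Extension by 0 makes them bounded and
    measurable everywhere without changing any value at an observation. *)
Lemma bounded_mfun_restrict_cube (F : R) f : 0 <= F ->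
  measurable_fun cube f -> (supnorm cube f <= F%:E)%E -> bounded_mfun (f \_ cube).
Proof.
move=> F0 mf fF; split.
  exact: (measurable_restrictT f (@measurable_cube R d)).1.
exists F => x; rewrite patchE; case: ifPn => [/set_mem|_].
  exact: le_supnorm.
by rewrite normr0.
Qed.

Lemma restrict_cube_le (F : R) f x : 0 <= F ->
  (supnorm cube f <= F%:E)%E -> `|(f \_ cube) x| <= F.
Proof.
move=> F0 fF; rewrite patchE; case: ifPn => [/set_mem|_].
  exact: le_supnorm.
by rewrite normr0.
Qed.

Lemma restrict_cubeE f x : cube x -> (f \_ cube) x = f x.
Proof. by move=> cx; rewrite patchE mem_set. Qed.

End restriction_to_cube.

Section sample_data.
Context (R : realType) (d n : nat) (K : R -> R) (h : R).
Local Notation V := 'rV[R]_d.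
Local Notation W := 'rV[V]_#|{: option ('I_n + 'I_n)}|.

Definition sample_data (w : W) : n.-tuple (V * R) :=
  two_stage_data K h (fun i => w ord0 (coord1 i)) (fun i => w ord0 (coord2 i)).

Lemma kde_smooth (w : W) x :
  kde K h (fun i => w ord0 (coord2 i)) x = smooth (product_kernel K h) (x, w).
Proof.
rewrite /kde /smooth invfM -mulrA; congr (_ * _); rewrite mulr_sumr.
by apply: eq_bigr => l _; rewrite product_kernelE.
Qed.

Lemma sample_data_coord0 (w : W) y :
  sample_data (set_coord w (coord0 n) y) = sample_data w.
Proof.
rewrite /sample_data; congr (two_stage_data K h _ _); apply/funext => i;
  by rewrite set_coord_neq// ?coord10 ?coord20.
Qed.

Lemma measurable_sample_data (Kinf : R) :
  (@lebesgue_measure R).-integrable setT (EFin \o K) ->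
  (forall u, `|K u| <= Kinf) -> 0 < h ->
  measurable_fun setT sample_data.
Proof.
move=> iK KKinf h0; apply/measurable_fun_tnthP => i.
have -> : (@tnth n _)^~ i \o sample_data = fun w : W => (w ord0 (coord1 i),
    smooth (product_kernel K h) (w ord0 (coord1 i), w)).
  by apply/funext => w /=; rewrite tnth_mktuple kde_smooth.
apply: measurable_fun_pair; first exact: measurable_coord.
apply: (bounded_mfun_coord (coord1 i) _).1.
exact/bounded_mfun_smooth/(bounded_mfun_product_kernel _ iK KKinf h0).
Qed.

Context dO (Omega : measurableType dO) (P : probability Omega R).
Variables (X X' : 'I_n -> {RV P >-> V}) (X0 : {RV P >-> V}).

Lemma observed_sample_data omega : observed K h X X' omega =
  sample_data (sample_vector (all_vectors X X' X0) omega).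
Proof.
rewrite /sample_data /observed; congr (two_stage_data K h _ _); apply/funext => i;
  by rewrite mxE enum_rankK.
Qed.

End sample_data.

(** The reciprocal of the sum of three nonnegative brackets meets the three constraints on [tau] at
    once, and [n] does not enter. *)
Definition exponent_scale (R : realType) (kap M1 F : R) : R :=
  (16 * F ^+ 2 + 16 * F * level kap M1 F + 16 * F * M1 +
   (128 * F ^+ 2 + 256 * level kap M1 F ^+ 2 + 128 * M1 ^+ 2))^-1.

Lemma exponent_scaleP (R : realType) (kap M1 F : R) : 0 <= M1 -> 1 <= F ->
  let tau := exponent_scale kap M1 F in
  [/\ 0 < tau, tau * (16 * F ^+ 2 + 16 * F * level kap M1 F) <= 1,
      tau * (16 * F * M1) <= 1 &
      tau * (128 * F ^+ 2 + 256 * level kap M1 F ^+ 2 + 128 * M1 ^+ 2) <= 1].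
Proof.
move=> M10 F1; have F0 : 0 <= F by exact: le_trans ler01 F1.
have l0 : 0 <= level kap M1 F.
  by rewrite /level !addr_ge0 ?mulr_ge0 ?expR_ge0.
have a0 : 0 < 16 * F ^+ 2.
  by rewrite mulr_gt0// exprn_gt0// (lt_le_trans ltr01).
have b0 : 0 <= 16 * F * level kap M1 F by rewrite !mulr_ge0.
have c0 : 0 <= 16 * F * M1 by rewrite !mulr_ge0.
have e0 : 0 <= 128 * F ^+ 2 + 256 * level kap M1 F ^+ 2 + 128 * M1 ^+ 2.
  by rewrite !addr_ge0 ?mulr_ge0 ?sqr_ge0.
rewrite /= /exponent_scale; set a := 16 * F ^+ 2 in a0 *.
set b := 16 * F * level _ _ _ in b0 *; set c := 16 * F * M1 in c0 *.
set e := _ + _ + 128 * _ in e0 *.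
have s0 : 0 < a + b + c + e by lra.
by split; rewrite ?invr_gt0// ler_pdivrMl// mulr1; lra.
Qed.

Lemma kernel_mass_ge1 (R : realType) (K : R -> R) : is_kernel K -> 1 <= kernel_mass K.
Proof.
move=> [iK K1].
rewrite /kernel_mass -lee_fin /Rintegral fineK; last first.
  have i1 : (@lebesgue_measure R).-integrable setT (fun u => `|K u|%:E).
    exact: integrable_abse iK.
  exact: integrable_fin_num i1.
have := le_abse_integral (@lebesgue_measure R) measurableT (measurable_int _ iK).
by rewrite K1 /= normr1.
Qed.

Lemma inf_empirical_risk_le (R : realType) d n (s : n.-tuple ('rV[R]_d * R))
    (FF : set ('rV[R]_d -> R)) f :
  FF f -> inf [set empirical_risk s g | g in FF] <= empirical_risk s f.
Proof.
move=> Ff; apply: ge_inf; last by exists f.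
exists 0 => _ [g _ <-]; rewrite mulr_ge0 ?invr_ge0// sumr_ge0// => i _.
exact: sqr_ge0.
Qed.

(** * The abstract bound applied to the density model *)

Section two_stage_model.
Context (R : realType) (d n : nat).
Local Notation V := 'rV[R]_d.
Local Notation W := 'rV[V]_#|{: option ('I_n + 'I_n)}|.
Variables (beta Q F Kinf h : R) (K : R -> R) (f0 f1 : V -> R).
Hypotheses (n3 : (3 <= n)%N) (d0 : (0 < d)%N) (beta0 : 0 < beta).
Hypotheses (QF : Q <= F) (F1 : 1 <= F).
Hypotheses (orderK : kernel_of_order (sfloor beta) K).
Hypotheses (KKinf : forall u, `|K u| <= Kinf).
Hypothesis suppK : fsupport K `<=` `[-1, 1]%classic.
Hypothesis bw : bandwidth d n h.
Hypotheses (f1S : smooth_density beta Q f1) (f01 : forall x, cube x -> f0 x = f1 x).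
Context dO (Omega : measurableType dO) (P : probability Omega R).
Variables (X X' : 'I_n -> {RV P >-> V}) (X0 : {RV P >-> V}).
Hypothesis model : density_model f0 X X' X0.
Variables (FF : set (V -> R)) (fhat : n.-tuple (V * R) -> V -> R).
Hypothesis FFF : forall f, FF f -> measurable_fun cube f /\ (supnorm cube f <= F%:E)%E.
Hypothesis est : is_estimator FF fhat.

Local Notation sample := (sample_vector (all_vectors X X' X0)).
Local Notation L := (distribution P sample).
Local Notation mu := (distribution P X0).
Local Notation km := (kernel_mass K).
Local Notation Kh := (product_kernel K h).
Local Notation M1 := (F * km ^+ d).
Local Notation kap := (Kinf ^+ d).
Local Notation rho := (Q * km * h `^ beta * \sum_(j < d) km ^+ j).
Local Notation tau := (exponent_scale kap M1 F).

Let F0 : 0 <= F. Proof. exact: le_trans ler01 F1. Qed.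

Let iK : (@lebesgue_measure R).-integrable setT (EFin \o K).
Proof. by case: orderK => -[]. Qed.

Let n0 : (0 : R) < n%:R. Proof. by rewrite ltr0n (leq_trans _ n3). Qed.

Let t0 : 0 < ln n%:R / n%:R :> R.
Proof. by rewrite divr_gt0// (lt_le_trans ltr01)// ln_ge1. Qed.

Let h0 : 0 < h.
Proof. by case: bw => + _ _; apply: lt_le_trans; rewrite powR_gt0. Qed.

Lemma ln_le_bandwidth : ln n%:R <= n%:R * h ^+ d.
Proof.
rewrite mulrC -ler_pdivrMr//; case: bw => hl _ _.
have -> : ln n%:R / n%:R = ((ln n%:R / n%:R) `^ (d%:R^-1)) ^+ d :> R.
  by rewrite -powR_mulrn ?powR_ge0// -powRrM mulVf ?powRr1 ?ltW// pnatr_eq0 -lt0n.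
by rewrite lerXn2r// nnegrE ?powR_ge0 ?ltW.
Qed.

Lemma bandwidth_powR :
  h `^ beta <= 2 `^ beta * (ln n%:R / n%:R) `^ (beta / d%:R).
Proof.
case: bw => _ hu _; rewrite mulrC [beta / _]mulrC powRrM mulrC -powRM ?powR_ge0//.
apply: ge0_ler_powR => //; first exact: ltW.
  by rewrite nnegrE ltW.
by rewrite nnegrE mulr_ge0 ?powR_ge0.
Qed.

Lemma law_density A : measurable A ->
  mu A = (\int[lebesgue_rV d]_(x in A) (f1 x)%:E)%E.
Proof.
case: model => _ /(_ None) /= mX0 _ mA; rewrite mX0//.
rewrite integral_mkcondr; apply: eq_integral => x _.
rewrite patchE; case: ifPn => [/set_mem cx|/negP cx]; first by rewrite f01.
case: f1S => _ supp _ _; rewrite (fsupport_eq0 supp)// => cx'.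
by apply: cx; exact: mem_set.
Qed.

Lemma law_all_vectors i A : measurable A ->
  distribution P (all_vectors X X' X0 i) A = mu A.
Proof.
by case: model => _ dens _ mA; rewrite (dens i)// -[X0]/(all_vectors X X' X0 None) dens.
Qed.

Let HL : resampling L mu.
Proof.
by case: model => _ _ indep; apply: (resampling_sample_vector indep) => i A; exact: law_all_vectors.
Qed.

Let f1H : holder_ball beta Q f1. Proof. by case: f1S. Qed.

Let f1_ge0 x : 0 <= f1 x. Proof. by case: f1S. Qed.

Let bf1 : bounded_mfun f1. Proof. exact: holder_ball_bounded_mfun f1H d0. Qed.

Let f1F x : 0 <= f1 x <= F.
Proof.
rewrite f1_ge0 (le_trans (ler_norm _))//.
exact: le_trans (holder_ball_bounded beta0 f1H d0 x) QF.
Qed.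

Let cubeZ k omega : cube (all_vectors X X' X0 k omega).
Proof. by case: model. Qed.

Let km0 : 0 < km.
Proof. by case: orderK => kK _ _; exact: lt_le_trans ltr01 (kernel_mass_ge1 kK). Qed.

Definition estimate (p : V * W) : R := (fhat (sample_data K h p.2) \_ cube) p.1.

Lemma bounded_mfun_estimate : bounded_mfun estimate.
Proof.
case: est => FFhat mfhat; split; last first.
  by exists F => p; apply: restrict_cube_le => //; exact: (FFF (FFhat _)).2.
pose g (q : n.-tuple (V * R) * V) := fhat q.1 q.2.
have mD : measurable ([set: n.-tuple (V * R)] `*` @cube R d).
  by apply: measurableX => //; exact: measurable_cube.
have mg := (measurable_restrictT g mD).1 mfhat.
pose u (p : V * W) := (sample_data K h p.2, p.1).
have mu : measurable_fun setT u.
  apply: measurable_fun_pair => //.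
  have ms : measurable_fun setT (@sample_data R d n K h).
    exact: measurable_sample_data iK KKinf h0.
  exact: measurableT_comp ms measurable_snd.
have := measurableT_comp mg mu; congr (measurable_fun _ _).
apply/funext => p; rewrite /estimate/= !patchE /u /g/=.
have -> : ((sample_data K h p.2, p.1) \in [set: n.-tuple (V * R)] `*` cube) =
   (p.1 \in cube) by apply/idP/idP => /set_mem /= cp; apply/mem_set => //; case: cp.
by [].
Qed.

(** The data ignore the coordinate of [X0], so redrawing that coordinate turns the risk into an
    iterated integral. *)
Lemma risk_estimate : risk K h f0 X X' X0 fhat =
  (\int[L]_w \int[mu]_x ((estimate (x, w) - f1 x) ^+ 2))%:E.
Proof.
pose G p := (estimate p - f1 p.1) ^+ 2.
have bG : bounded_mfun G.
  apply/bounded_mfunX/bounded_mfunB; first exact: bounded_mfun_estimate.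
  exact: bounded_mfun_comp bf1 measurable_fst.
rewrite -(expect_coord HL (k := coord0 n) bG); last first.
  by move=> x y w; rewrite /G /estimate/= sample_data_coord0.
rewrite -integral_law; last exact: bounded_mfun_coord.
rewrite /risk expectation.unlock; apply: eq_integral => omega _; congr EFin.
have c0 := cubeZ None omega.
rewrite (observed_sample_data _ _ _ _ X0) /G /estimate/= !mxE enum_rankK/=.
by rewrite restrict_cubeE// f01.
Qed.

Section competitor.
Variable fs : V -> R.
Hypothesis FFs : FF fs.

Lemma expect_competitor :
  ('E_P[fun omega => ((fs (X0 omega) - f0 (X0 omega)) ^+ 2)%R])%E =
  (\int[mu]_x (((fs \_ cube) x - f1 x) ^+ 2))%:E.
Proof.
rewrite -integral_law; last first.
  apply/bounded_mfunX/bounded_mfunB => //.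
  by have [mfs fsF] := FFF FFs; exact: bounded_mfun_restrict_cube mfs fsF.
rewrite expectation.unlock; apply: eq_integral => omega _; congr EFin.
have c0 := cubeZ None omega.
by rewrite restrict_cubeE// f01.
Qed.

(** The infimum over the class is at most the value at the competitor. As the infimum may fail to be
    measurable, the comparison goes through [le_integral_ge0]. *)
Lemma expect_gain_le_optim_error :
  ((\int[L]_w (n%:R^-1 * \sum_(i < n)
     gain Kh (fs \_ cube) estimate (w ord0 (coord1 i), w)))%:E <=
   optim_error K h X X' FF fhat)%E.
Proof.
case: est => FFhat _.
have [mfs fsF] := FFF FFs; have bfs := bounded_mfun_restrict_cube F0 mfs fsF.
have bK : bounded_mfun Kh := bounded_mfun_product_kernel d iK KKinf h0.
pose G (w : W) := n%:R^-1 * \sum_(i < n)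
  gain Kh (fs \_ cube) estimate (w ord0 (coord1 i), w).
have bG : bounded_mfun G.
  apply/bounded_mfunZ/bounded_mfun_sum => i; apply: bounded_mfun_coord.
  by apply: bounded_mfun_gain => //; exact: bounded_mfun_estimate.
have bGS : bounded_mfun (fun omega => G (sample omega)).
  by apply: bounded_mfun_comp bG _; exact: measurable_sample_vector.
rewrite -integral_law// /optim_error expectation.unlock.
apply: (@le_integral_ge0 _ _ _ P (fun omega => G (sample omega))) => //.
- by move=> omega /=; rewrite subr_ge0 inf_empirical_risk_le.
move=> omega /=; rewrite /G; apply: (@le_trans _ _ (empirical_risk (observed K h X X' omega)
    (fhat (observed K h X X' omega)) - empirical_risk (observed K h X X' omega) fs)).
  rewrite /empirical_risk -mulrBr ler_wpM2l ?invr_ge0//.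
  rewrite -sumrB le_eqVlt; apply/orP; left; apply/eqP/eq_bigr => i _.
  rewrite (observed_sample_data _ _ _ _ X0) tnth_mktuple/= kde_smooth /gain /estimate/=.
  have := cubeZ (Some (inl i)) omega; rewrite !mxE enum_rankK/= => ci.
  by rewrite !restrict_cubeE.
by rewrite lerD2l lerN2 inf_empirical_risk_le.
Qed.

Lemma risk_le_covering m (cs : 'I_m -> V -> R) (delta : R) : 0 < delta ->
  (forall j, FF (cs j)) ->
  (forall f, FF f -> exists j, (supnorm cube (f \- cs j)%R <= delta%:E)%E) ->
  (risk K h f0 X X' X0 fhat <=
    4%:E * (\int[L]_w (n%:R^-1 * \sum_(i < n)
      gain Kh (fs \_ cube) estimate (w ord0 (coord1 i), w)))%:E +
    7%:E * 'E_P[fun omega => ((fs (X0 omega) - f0 (X0 omega)) ^+ 2)%R] +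
    (32 * rho ^+ 2 + ln m%:R / (tau * n%:R) + 32 * F / n%:R +
      (20 * F + 8 * (M1 + F)) * delta)%:E)%E.
Proof.
move=> delta0 FFcs cover; have [FFhat _] := est.
have [mfs fsF] := FFF FFs; have bfs := bounded_mfun_restrict_cube F0 mfs fsF.
rewrite risk_estimate expect_competitor -!EFinM -!EFinD lee_fin.
have M10 : 0 < M1 by rewrite mulr_gt0 ?exprn_gt0// (lt_le_trans ltr01).
have [tau0 tau1 tau2 tau3] := exponent_scaleP kap (ltW M10) F1.
rewrite !addrA.
apply: (@two_stage_bound _ V R n L mu HL Kh f1 (n%:R * h ^+ d) kap M1 F rho tau
  _ _ _ _ _ _ _ _ _ _ _ _ _ _ _ _ m (fun j => cs j \_ cube)) => //.
- by rewrite (leq_trans _ n3).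
- by rewrite (le_trans (ln_ge1 R n3))// ln_le_bandwidth.
- exact: ln_le_bandwidth.
- exact: bounded_mfun_product_kernel iK KKinf h0.
- by move=> p; rewrite -mulrA mulrC ler_wpM2r// product_kernel_le.
- exact: (product_kernel_mass1 iK KKinf h0 d0 beta0 f1H f1_ge0 QF (fun A => @law_density A)).
- exact: (product_kernel_mass2 iK KKinf h0 d0 beta0 f1H f1_ge0 QF (fun A => @law_density A)).
- exact: (product_kernel_bias_mu iK KKinf h0 d0 beta0 f1H (fun A => @law_density A) orderK suppK).
- by move=> j; have [mc cF] := FFF (FFcs j); exact: bounded_mfun_restrict_cube mc cF.
- exact: bounded_mfun_estimate.
- by move=> j x; have [mc cF] := FFF (FFcs j); exact: restrict_cube_le.
- by move=> x; exact: restrict_cube_le.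
- by move=> p; apply: restrict_cube_le => //; exact: (FFF (FFhat _)).2.
- move=> w; have [j hj] := cover _ (FFhat (sample_data K h w)); exists j => x.
  rewrite /estimate/= !patchE; case: ifPn => [/set_mem cx|_].
    exact: (le_supnorm hj cx).
  by rewrite subrr normr0 ltW.
- exact: ltW.
Qed.

End competitor.

End two_stage_model.

(** * Covering numbers, the infimum over competitors, and the rates *)

Section covering_number.
Context (R : realType) (d : nat) (FF : set ('rV[R]_d -> R)) (delta : R).

Definition has_cover m := exists2 c : 'I_m -> ('rV[R]_d -> R), (forall j, FF (c j)) &
  forall f, FF f -> exists j, (supnorm cube (f \- c j)%R <= delta%:E)%E.

(** Sizes of covers are natural numbers, so the infimum, if finite, is attained by an actual
    cover. *)
Lemma covering_numberP : covering_number FF delta = +oo%E \/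
  exists2 m, has_cover m & covering_number FF delta = m%:R%:E.
Proof.
have [[m0 cm0]|nc] := pselect (exists m, has_cover m); last first.
  left; rewrite /covering_number; apply/eqP; rewrite -leye_eq.
  by apply: le_ereal_inf_tmp => _ [m cm <-]; case: nc; exists m.
right; have ex : exists m, `[< has_cover m >] by exists m0; exact/asboolP.
case: (ex_minnP ex) => m /asboolP cm mmin; exists m => //.
apply/eqP; rewrite eq_le; apply/andP; split.
  by apply: ereal_inf_lbound; exists m.
apply: le_ereal_inf_tmp => _ [k ck <-]; rewrite lee_fin ler_nat.
exact/mmin/asboolP.
Qed.

Lemma has_cover_gt0 m f : FF f -> has_cover m -> (0 < m)%N.
Proof. by move=> Ff [c _ /(_ _ Ff)[j _]]; case: m c j => [_ []|]. Qed.

End covering_number.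

(** A best approximation in the class may not exist, so the bound is proved for every competitor and
    passed to the infimum. Finiteness of [r] permits the rearrangement, and [a] may be infinite. *)
Lemma le_inf_mul (R : realType) (S : set (\bar R)) (r a : \bar R) (c : R) :
  (0 < c)%R -> r \is a fin_num -> (0 <= a)%E ->
  (forall e, S e -> (0 <= e /\ r <= a + c%:E * e)%E) ->
  (r <= a + c%:E * ereal_inf S)%E.
Proof.
move=> c0 rfin a0 h.
have i0 : (0 <= ereal_inf S)%E by apply: le_ereal_inf_tmp => e /h[].
have [->|aoo] := eqVneq a +oo%E.
  rewrite addye ?leey// gt_eqF// (lt_le_trans (ltNyr 0))// mule_ge0// lee_fin.
  exact: ltW.
have /fineK aE : a \is a fin_num by rewrite ge0_fin_numE// ltey.
move: h; rewrite -aE -(fineK rfin) => h.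
have : (((fine r - fine a) / c)%:E <= ereal_inf S)%E.
  apply: le_ereal_inf_tmp => -[e||] /h[] // _; last by rewrite leey.
  by rewrite -EFinM -EFinD !lee_fin ler_pdivrMr// mulrC; lra.
case: (ereal_inf S) i0 => [e _|_ _|//]; last by rewrite gt0_muley ?lte_fin// addey// leey.
by rewrite -EFinM -EFinD !lee_fin ler_pdivrMr// mulrC; lra.
Qed.

Lemma optim_error_ge0 (R : realType) d n (K : R -> R) h dO
    (Omega : measurableType dO) (P : probability Omega R)
    (X X' : 'I_n -> {RV P >-> 'rV[R]_d}) FF
    (fhat : n.-tuple ('rV[R]_d * R) -> 'rV[R]_d -> R) :
  (forall s, FF (fhat s)) -> (0 <= optim_error K h X X' FF fhat)%E.
Proof.
move=> FFhat; rewrite /optim_error expectation.unlock.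
apply: integral_ge0 => omega _; rewrite lee_fin subr_ge0.
exact: inf_empirical_risk_le.
Qed.

(** For [n >= 3] both [ln n] and the logarithm of the maximum are at least 1, so the latter
    dominates [ln m] as well as the constant term. *)
Lemma variance_rate (R : realType) n m (tau F : R) :
  (3 <= n)%N -> (0 < m)%N -> 0 < tau -> 0 < F ->
  ln m%:R / (tau * n%:R) + 32 * F / n%:R <=
  (tau^-1 + 32 * F) * ln n%:R ^+ 2 / n%:R * ln (Num.max n%:R m%:R).
Proof.
move=> n3 m0 tau0 F0; have n0 : (0 : R) < n%:R by rewrite ltr0n (leq_trans _ n3).
have ln1 : 1 <= ln n%:R :> R by exact: ln_ge1.
set l := ln (Num.max _ _).
have lm : ln m%:R <= l.
  by rewrite ler_ln ?posrE ?lt_max ?n0 ?ltr0n// le_max lexx orbT.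
have l1 : 1 <= l.
  by rewrite (le_trans ln1)// ler_ln ?posrE ?lt_max ?n0// le_max lexx.
rewrite invfM mulrA -mulrDl mulrAC ler_pM2r ?invr_gt0//.
have t0 : 0 < tau^-1 by rewrite invr_gt0.
apply: (@le_trans _ _ ((tau^-1 + 32 * F) * l)).
  have := ler_wpM2l (ltW t0) lm; have := ler_wpM2l (ltW F0) l1; lra.
rewrite -mulrA ler_pM2l; last by have := F0; have := t0; lra.
by rewrite ler_peMl ?exprn_ege1//; have := l1; lra.
Qed.

Lemma bias_rate (R : realType) d n (beta h q S : R) :
  0 < beta -> bandwidth d n h -> 0 < q -> 0 < S -> (3 <= n)%N ->
  32 * (q * h `^ beta * S) ^+ 2 <=
  32 * (q * 2 `^ beta * S) ^+ 2 * (ln n%:R / n%:R) `^ (2 * beta / d%:R).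
Proof.
move=> beta0 bw q0 S0 n3; rewrite -[leRHS]mulrA ler_pM2l//.
have -> : (2 * beta / d%:R : R) = (beta / d%:R) * 2%:R by ring.
rewrite powRrM powR_mulrn ?powR_ge0// -exprMn.
have qS : q * h `^ beta * S <= q * 2 `^ beta * S * (ln n%:R / n%:R) `^ (beta / d%:R).
  have := bandwidth_powR n3 beta0 bw.
  by rewrite -(ler_pM2l (mulr_gt0 q0 S0)); set u := _ `^ _; set v := _ `^ _; lra.
by rewrite lerXn2r// nnegrE !mulr_ge0 ?powR_ge0 ?ltW.
Qed.

Unset Implicit Arguments.

Theorem theorem3p1 (R : realType) (d : nat) (beta Q F : R) (K : R -> R) :
  (1 <= d)%N -> 0 < beta -> 0 < Q -> Num.max Q 1 <= F ->
  kernel_of_order (sfloor beta) K ->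
  (supnorm setT K < +oo)%E ->
  fsupport K `<=` `[-1, 1]%classic ->
  exists C1 C2 C3 : R, [/\ 0 < C1, 0 < C2 & 0 < C3] /\
  forall (n : nat) (h : R) (f0 : 'rV[R]_d -> R)
    (disp : measure_display) (Omega : measurableType disp)
    (P : probability Omega R)
    (X X' : 'I_n -> {RV P >-> 'rV[R]_d}) (X0 : {RV P >-> 'rV[R]_d})
    (FF : set ('rV[R]_d -> R))
    (fhat : n.-tuple ('rV[R]_d * R) -> 'rV[R]_d -> R) (delta : R),
    (3 <= n)%N ->
    bandwidth d n h ->
    smooth_density_cube beta Q f0 ->
    density_model f0 X X' X0 ->
    (forall f, FF f -> measurable_fun cube f /\ (supnorm cube f <= F%:E)%E) ->
    is_estimator FF fhat ->
    0 < delta ->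
    (risk K h f0 X X' X0 fhat <=
       (C1 * ln n%:R ^+ 2 / n%:R)%:E *
         lne (Order.max n%:R%:E (covering_number FF delta))
       + (C2 * delta)%:E
       + (C3 * (ln n%:R / n%:R) `^ (2 * beta / d%:R))%:E
       + 6%:E * optim_error K h X X' FF fhat
       + 7%:E * approx_error f0 X0 FF)%E.
Proof.
move=> d0 beta0 Q0; rewrite ge_max => /andP[QF F1] orderK Kfin suppK.
have F0 : 0 < F by exact: lt_le_trans ltr01 F1.
have [Kinf KKinf] : exists Kinf, forall u, `|K u| <= Kinf.
  have K0 : (0 <= supnorm setT K)%E.
    apply: (@le_trans _ _ `|K 0|%:E); first by rewrite lee_fin.
    by apply: ereal_sup_ubound; exists 0.
  exists (fine (supnorm setT K)) => u; apply: (@le_supnorm _ _ setT) => //.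
  by rewrite fineK// ge0_fin_numE.
have [iK _ _] := orderK; have km1 := kernel_mass_ge1 iK.
set km := kernel_mass K in km1; have km0 : 0 < km by exact: lt_le_trans ltr01 km1.
have M0 : 0 < F * km ^+ d by rewrite mulr_gt0 ?exprn_gt0.
pose tau := exponent_scale (Kinf ^+ d) (F * km ^+ d) F.
have [tau0 _ _ _] := exponent_scaleP (Kinf ^+ d) (ltW M0) F1; rewrite -/tau in tau0.
pose S := \sum_(j < d) km ^+ j.
have S0 : 0 < S.
  rewrite /S; case: (d) d0 => // k _; rewrite big_ord_recl ltr_wpDr// sumr_ge0// => j _.
  by rewrite exprn_ge0// ltW.
have C10 : 0 < tau^-1 + 32 * F by rewrite addr_gt0 ?mulr_gt0// invr_gt0.
have C20 : 0 < 20 * F + 8 * (F * km ^+ d + F) by rewrite addr_gt0 ?mulr_gt0// addr_gt0.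
have C30 : 0 < 32 * (Q * km * 2 `^ beta * S) ^+ 2.
  by rewrite mulr_gt0// exprn_gt0// !mulr_gt0// powR_gt0.
(* The first constant merges the two terms of order [1 / n], the second is the factor of [delta] in
   [two_stage_bound], and the third is [32 rho^2] with the upper bandwidth bound inserted. *)
exists (tau^-1 + 32 * F), (20 * F + 8 * (F * km ^+ d + F)),
  (32 * (Q * km * 2 `^ beta * S) ^+ 2); split => //.
move=> n h f0 disp Omega P X X' X0 FF fhat delta n3 bw [f1 f1S f01] model FFF est delta0.
have [FFhat _] := est.
have n0 : (0 : R) < n%:R by rewrite ltr0n (leq_trans _ n3).
have ln1 : 1 <= ln n%:R :> R by exact: ln_ge1.
have opt0 := optim_error_ge0 K h X X' FFhat.
have c10 : 0 < (tau^-1 + 32 * F) * ln n%:R ^+ 2 / n%:R.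
  by rewrite divr_gt0// mulr_gt0// exprn_gt0// (lt_le_trans ltr01).
have c20 : 0 <= (20 * F + 8 * (F * km ^+ d + F)) * delta by rewrite mulr_ge0// ltW.
have c30 : 0 <= 32 * (Q * km * 2 `^ beta * S) ^+ 2 * (ln n%:R / n%:R) `^ (2 * beta / d%:R).
  by rewrite mulr_ge0 ?powR_ge0// ltW.
have appr0 e : [set ('E_P[fun omega => ((f (X0 omega) - f0 (X0 omega)) ^+ 2)%R])%E
    | f in FF] e -> (0 <= e)%E.
  by move=> [f _ <-]; apply: expectation_ge0 => omega; exact: sqr_ge0.
apply: le_inf_mul => //.
- by rewrite (risk_estimate n3 d0 beta0 F1 orderK KKinf bw f1S f01 model FFF est).
- rewrite !adde_ge0 ?lee_fin// ?mule_ge0 ?lee_fin ?(ltW c10)//.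
  rewrite lne_ge0 le_max lee_fin ler1n (leq_trans _ n3)//.
move=> _ [fs FFs <-]; split; first by apply: appr0; exists fs.
(* Without a finite cover the right-hand side is [+oo]. *)
have [->|[m [cs FFcs cover] ->]] := covering_numberP FF delta.
  have appr_fs : (0 <= 7%:E * 'E_P[fun omega => ((fs (X0 omega) - f0 (X0 omega)) ^+ 2)%R])%E.
    by apply: mule_ge0 => //; apply: appr0; exists fs.
  have Ny (e : \bar R) : (0 <= e -> e != -oo)%E by case: e.
  by rewrite maxey gt0_muley ?lte_fin// !addye ?leey// Ny// mule_ge0.
have m0 := has_cover_gt0 FFs (ex_intro2 _ _ cs FFcs cover).
rewrite -EFin_max lne_EFin ?lt_max ?n0// -EFinM -!EFinD.
apply: le_trans (risk_le_covering n3 d0 beta0 QF F1 orderK KKinf suppK bw f1S f01 model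
  FFF est FFs delta0 FFcs cover) _.
have gopt := expect_gain_le_optim_error n3 F1 orderK KKinf bw model FFF est FFs.
rewrite addeAC leeD2r// addeC; apply: leeD; last first.
  (* The argument yields the factor 4; the optimization error is nonnegative, so 6 bounds it. *)
  apply: (@le_trans _ _ (4%:E * optim_error K h X X' FF fhat)%E).
    by rewrite lee_pmul2l.
  by rewrite lee_wpmul2r// lee_fin ler_nat.
have var := variance_rate n3 m0 tau0 F0.
have bias := bias_rate beta0 bw (mulr_gt0 Q0 km0) S0 n3.
rewrite lee_fin -/km -/S -/tau -[leRHS]addrA [X in _ <= _ + X]addrC.
by rewrite !addrA lerD2r -addrA addrC lerD.
Qed.
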